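(* Let $n\geq 1$ and equip $\mathbb{R}^{2n+1}$ with its standard contact structure $\xi_0=\ker\alpha_0$. (i) For every $f\in \mathrm{Diff}_0(\mathbb{R}^{2n+1})$ there exist a null path of diffeomorphisms from $\mathrm{id}$ to $f$ and a positive path of diffeomorphisms from $\mathrm{id}$ to $f$. (ii) For every $f\in \mathrm{Diff}_c(\mathbb{R}^{2n+1})$ there exists a compactly supported null path from $\mathrm{id}$ to $f$. Moreover, $f$ is connected to $\mathrm{id}$ by a positive path that is arbitrarily close to $\mathrm{id}$ in the $C^\infty$-compact open topology outside of a compact set, i.e. there is a compact set $K\subset\mathbb{R}^{2n+1}$ such that for every neighbourhood $\mathcal{W}$ of the inclusion $\mathbb{R}^{2n+1}\setminus K\hookrightarrow\mathbb{R}^{2n+1}$ in $C^\infty(\mathbb{R}^{2n+1}\setminus K,\mathbb{R}^{2n+1})$ with the $C^\infty$-compact open topology there is a positive path $(g_t)_{t\in[0,1]}$ of diffeomorphisms with $g_0=\mathrm{id}$, $g_1=f$ and $g_t|_{\mathbb{R}^{2n+1}\setminus K}\in\mathcal{W}$ for all $t\in[0,1]$.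
   Context: The standard contact structure on $\mathbb{R}^{2n+1}$ with coordinates $(x_1,\dots,x_n,y_1,\dots,y_n,z)$ is $\xi_0=\ker\alpha_0$ with $\alpha_0=dz+\sum_{i=1}^n x_i\,dy_i$, cooriented by $\alpha_0$. A smooth path of diffeomorphisms $(f_t)_{t\in[0,1]}$ of a manifold $M$ is a family of diffeomorphisms of $M$ such that $(t,p)\mapsto f_t(p)$ is smooth as a map $[0,1]\times M\to M$; all paths of diffeomorphisms are smooth in this sense. It generates the time-dependent vector field $X_t^f$ determined by $\frac{d}{dt}f_t(p)=X_t^f(f_t(p))$. Given a cooriented contact structure $\xi=\ker\alpha$ on $M$, the path is called positive if $\alpha(X_t^f)>0$ everywhere on $M$ for all $t$, and a null path if $\alpha(X_t^f)=0$ everywhere on $M$ for all $t$ (these notions depend only on $\xi$ and its coorientation). A path is compactly supported if there is a compact set outside of which $f_t=\mathrm{id}$ for all $t$. $\mathrm{Diff}_0(M)$ is the group of diffeomorphisms of $M$ that are (smoothly) isotopic to the identity; $\mathrm{Diff}_c(M)$ is the group of compactly supported diffeomorphisms that are isotopic to the identity through a compactly supported path of diffeomorphisms. *)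

(* Defs.v *)
From HB Require Import structures.
From mathcomp Require Import all_boot all_order all_algebra.
From mathcomp Require Import all_classical all_reals all_analysis.

Set Implicit Arguments.
Unset Strict Implicit.
Unset Printing Implicit Defensive.

Import Order.TTheory GRing.Theory Num.Theory.
Import numFieldNormedType.Exports.

Local Open Scope classical_set_scope.
Local Open Scope ring_scope.

Section Smoothness.
Context {R : realType} {V W : normedModType R}.

(* dderiv [:: v1; ...; vk] f = D_v1 (... (D_vk f)); 'D_v takes a junk value where
   the derivative does not exist, so derivability is asserted separately. *)
Definition dderiv (s : seq V) (f : V -> W) : V -> W :=
  foldr (fun v g => 'D_v g) f s.

(* Meaningful for U open only. *)
Definition smooth_open (U : set V) (f : V -> W) : Prop :=
  forall (s : seq V) (x : V), U x ->
    {for x, continuous (dderiv s f)} /\ forall v : V, derivable (dderiv s f) x v.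

(* Smoothness on an arbitrary set, such as a manifold with boundary: f agrees,
   locally around each point of A, with a smooth map on an open set. *)
Definition smooth_on (A : set V) (f : V -> W) : Prop :=
  forall p, A p -> exists (U : set V) (g : V -> W),
    [/\ open_nbhs p U, smooth_open U g & forall x, A x -> U x -> f x = g x].

End Smoothness.

Section CinftySpace.
Context {R : realType} {V W : normedModType R}.

Definition Cinfty (U : set V) : set (U -> W) :=
  [set h | smooth_open U ('valL_(0 : W) h)].

(* The C^infty compact-open topology: the coarsest one making all iterated
   derivatives continuous for uniform convergence on compact subsets of U. For
   an open U, derivatives at points of U do not depend on the extension by 0.
   The topology is put on all functions U -> W, of which Cinfty U is a
   subspace. *)
Definition Cinfty_space (U : set V) : Type := U -> W.

HB.instance Definition _ (U : set V) := Choice.copy (Cinfty_space U) (U -> W).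

HB.instance Definition _ (U : set V) :=
  Topological.copy (Cinfty_space U)
    (sup_topology (fun s : seq V => Topological.class
      (initial_topology (fun h : Cinfty_space U =>
        (dderiv s ('valL_(0 : W) h) : {family compactly_in U, V -> W}))))).

(* Neighbourhoods of h in the subspace Cinfty U. *)
Definition Cinfty_nbhs (U : set V) (h : U -> W) : set_system (U -> W) :=
  within (@Cinfty U) (nbhs (h : Cinfty_space U)).

End CinftySpace.

Section Paths.
Context {R : realType} {V : normedModType R}.

Definition is_diffeo (f : V -> V) : Prop :=
  smooth_open setT f /\
  exists g : V -> V, [/\ smooth_open setT g, cancel f g & cancel g f].

(* Only the values F t with t in [0, 1] matter. *)
Definition diffeo_path (F : R -> V -> V) : Prop :=
  (forall t, t \in `[0, 1] -> is_diffeo (F t)) /\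
  smooth_on ([set` `[0, 1]] `*` setT : set (R^o * V)%type)
    (fun q => F q.1 q.2).

Definition path_from_to (f g : V -> V) (F : R -> V -> V) : Prop :=
  F 0 = f /\ F 1 = g.

(* d/dt (F t p) = X t (F t p), with one-sided derivatives at t = 0 and t = 1. *)
Definition generates (F : R -> V -> V) (X : R -> V -> V) : Prop :=
  forall t p, t \in `[0, 1] ->
    (s - t)^-1 *: (F s p - F t p) @[s --> within `[0, 1] t^']
      --> X t (F t p).

Definition positive_path (alpha : V -> V -> R) (F : R -> V -> V) : Prop :=
  diffeo_path F /\ exists X, generates F X /\
    forall t q, t \in `[0, 1] -> 0 < alpha q (X t q).

Definition null_path (alpha : V -> V -> R) (F : R -> V -> V) : Prop :=
  diffeo_path F /\ exists X, generates F X /\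
    forall t q, t \in `[0, 1] -> alpha q (X t q) = 0.

Definition compactly_supported (f : V -> V) : Prop :=
  exists K : set V, compact K /\ forall p, ~ K p -> f p = p.

Definition compactly_supported_path (F : R -> V -> V) : Prop :=
  exists K : set V, compact K /\
    forall t p, t \in `[0, 1] -> ~ K p -> F t p = p.

Definition Diff0 (f : V -> V) : Prop :=
  is_diffeo f /\ exists F, diffeo_path F /\ path_from_to id f F.

Definition Diffc (f : V -> V) : Prop :=
  [/\ is_diffeo f, compactly_supported f & exists F,
    [/\ diffeo_path F, compactly_supported_path F & path_from_to id f F]].

End Paths.

Section StandardContact.
Context {R : realType} {n : nat}.

(* Coordinates (x_1, ..., x_n, y_1, ..., y_n, z). *)
Definition xcoord (p : 'rV[R]_(n + n + 1)) (i : 'I_n) : R :=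
  p 0 (lshift 1 (lshift n i)).
Definition ycoord (p : 'rV[R]_(n + n + 1)) (i : 'I_n) : R :=
  p 0 (lshift 1 (rshift n i)).
Definition zcoord (p : 'rV[R]_(n + n + 1)) : R := p 0 (rshift (n + n) ord0).

(* alpha0 q v: the form dz + sum_i x_i dy_i at q, applied to v. *)
Definition alpha0 (q v : 'rV[R]_(n + n + 1)) : R :=
  zcoord v + \sum_(i < n) xcoord q i * ycoord v i.

End StandardContact.

(* Main.v *)
From HB Require Import structures.
Require Import Defs.
From mathcomp Require Import all_boot all_order all_algebra.
From mathcomp Require Import all_classical all_reals all_analysis.
From mathcomp Require Import lra ring.

Set Implicit Arguments.
Unset Strict Implicit.
Unset Printing Implicit Defensive.

Import Order.TTheory GRing.Theory Num.Theory.
Import numFieldNormedType.Exports.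

Local Open Scope classical_set_scope.
Local Open Scope ring_scope.

(** Call f reachable if it is the end of a null path starting at the identity.
Composing every diffeomorphism of a path on the right with a fixed one does not
change the generated field, so the reachable diffeomorphisms form a group: to
compose, the two motions are put in disjoint time intervals ([null_concat]).  The
elementary null paths move points along straight lines tangent to xi_0, namely
the orbits of d/dx_i and of Y_i = d/dy_i - x_i d/dz; a shear p + b(p) E(p) along
such a field E is reached by letting the displacement grow from 0 to b along E
([null_reach_shear]).

The fields d/dx_i and Y_i span only xi_0, and the missing direction comes from a
commutator.  Conjugating Y_i by the translation of length c along d/dx_i gives
Y_i - c d/dz, so a flow along Y_i followed by the opposite flow along the
conjugate field is a shear along d/dz ([null_reach_zshear]).  Any diffeomorphism
with compact support and close to the identity is a product of shears along the
Y_i, the d/dx_i and d/dz, hence is reachable within a slightly larger compact set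
([null_reach_near]).  For an isotopy with compact support, the set of times at
which it is reachable is thus open and closed, so the end of the isotopy is
reached by a null path with compact support ([null_reach_isotopy]).

An isotopy F_t of the whole space need not have bounded support.  On each ball of
radius j it agrees with a compactly supported isotopy ([isotopy_extension]), with
end H_j say.  With H_0 = id, the quotient h_j = H_j^-1 H_(j+1) is the identity on
the ball of radius j and has compact support, so that it is reached by a null path
supported outside the ball of radius j - 1.  The infinite product h_0 h_1 h_2 ...
converges to F_1, being finite on every ball; running the j-th null path during
the j-th of a sequence of time intervals that shrink to 0 gives one smooth null
path from id to F_1 ([null_reach_infinite]).

Positive paths are null paths that rise.  The translations P_t of length t along z
preserve alpha_0 and move with alpha_0-speed 1, so P_t N_t is positive whenever
N_t is null; a null path from id to P_1^-1 f yields a positive path from id to f.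
If f is the end of a null path supported in a compact set K, one can moreover
stay close to the identity off K.  A small loop d (u, v) in a plane (x_i, y_i)
lifts to a null path of affine maps, which differ from the identity by O(d) on
bounded sets and which end at the translation by - d^2 along z, because the loop
encloses an area of order d^2 ([null_helix], [helix1]).  Put this path after the
null path from id to f and let everything rise at speed d^2: the result is
positive, ends at f and off K is affine and tends to the identity with d.
Closeness of affine maps only involves values and first derivatives
([Cinfty_nbhs_affine]).

The analysis that this requires rests on directional derivatives.  A map whose
directional derivatives are continuous is Frechet differentiable
([C1_differentiable]), and smooth maps are therefore stable under composition.  A
scalar implicit function theorem ([smooth_implicit]) shows that shears are
diffeomorphisms, a C^1-small perturbation of the identity is a product of shears
([perturbation_diffeo]), and by rescaling a map with invertible derivative at a
point agrees near it with a global diffeomorphism ([local_extension]).  So inverse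
maps depend smoothly on parameters ([joint_inverse]). *)

(** * Coordinates on a finite-dimensional normed space *)

Lemma sum_ltS (Z : nmodType) m (F : 'I_m -> Z) (k : 'I_m) :
  \sum_(i < m | (i < k.+1)%N) F i = \sum_(i < m | (i < k)%N) F i + F k.
Proof.
rewrite (bigD1 k)//= addrC; congr (_ + _); apply: eq_bigl => i.
by rewrite ltnS leq_eqVlt -val_eqE/=; case: (ltngtP i k).
Qed.

Section Frames.
Context {R : realType}.

(** The coordinates are chosen abstractly so that the same statements apply to
row vectors, to the real line and, for maps that depend on time or other
parameters, to their products, which are not spaces of row vectors. *)
Class frame (V : normedModType R) := Frame {
  fdim : nat;
  fvec : 'I_fdim -> V;
  fco : 'I_fdim -> V -> R;
  fco_linear : forall i a u v, fco i (a *: u + v) = a * fco i u + fco i v;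
  fco_bound : exists2 c : R, 0 < c & forall i v, `|fco i v| <= c * `|v|;
  frameE : forall v, v = \sum_i fco i v *: fvec i }.

#[global] Arguments fdim V {frame}.
#[global] Arguments fco {V frame}.
#[global] Arguments fvec {V frame}.

Context {V : normedModType R} {FV : frame V}.

Lemma fcoD i u v : fco i (u + v) = fco i u + fco i v.
Proof. by have := fco_linear i 1 u v; rewrite scale1r mul1r. Qed.
Lemma fco0 i : fco i 0 = 0 :> R.
Proof. by have := fco_linear i 1 0 0; rewrite scale1r mul1r addr0; lra. Qed.
Lemma fcoZ i a u : fco i (a *: u) = a * fco i u.
Proof. by have := fco_linear i a u 0; rewrite fco0 !addr0. Qed.
Lemma fcoB i u v : fco i (u - v) = fco i u - fco i v.
Proof. by rewrite -scaleN1r fcoD fcoZ mulN1r. Qed.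

Lemma fco_continuous i : continuous (fco i : V -> R).
Proof.
have [c c0 bd] := @fco_bound _ FV.
move=> x; apply/cvgrPdist_le => /= e e0.
near=> y.
rewrite -fcoB (le_trans (bd _ _))// -ler_pdivlMl//.
near: y; apply: cvgr_dist_le => //; rewrite mulr_gt0// ?invr_gt0//.
Unshelve. all: by end_near. Qed.

Lemma norm_frame : exists2 c : R, 0 < c &
  forall v : V, `|v| <= c * \sum_i `|fco i v|.
Proof.
exists (1 + \sum_i `|fvec i : V|) => [|v].
  by rewrite ltr_wpDr// sumr_ge0.
rewrite {1}[v]frameE (le_trans (ler_norm_sum _ _ _))//.
rewrite mulr_sumr; apply: ler_sum => i _; rewrite normrZ mulrC ler_wpM2r//.
rewrite (bigD1 i)//= addrCA lerDl addr_ge0 ?ler01// sumr_ge0//.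
Qed.

(** The partial sums lead from 0 to u by moves in one coordinate at a time, which
reduces statements on several variables to one variable. *)
Definition partial_sum (k : nat) (u : V) : V :=
  \sum_(i < fdim V | (i < k)%N) fco i u *: fvec i.

Lemma partial_sum0 u : partial_sum 0 u = 0.
Proof. by rewrite /partial_sum big_pred0. Qed.

Lemma partial_sum_full u : partial_sum (fdim V) u = u.
Proof. by rewrite [RHS]frameE; apply: eq_bigl => i; exact: ltn_ord. Qed.

Lemma partial_sumS (k : 'I_(fdim V)) u :
  partial_sum k.+1 u = partial_sum k u + fco k u *: fvec k.
Proof. exact: sum_ltS. Qed.

Lemma partial_sumP k a u v :
  partial_sum k (a *: u + v) = a *: partial_sum k u + partial_sum k v.
Proof.
rewrite /partial_sum scaler_sumr -big_split/=; apply: eq_bigr => i _.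
by rewrite fco_linear scalerDl scalerA.
Qed.

Lemma frame_bound : exists2 B : R, 0 < B &
  (forall k u, `|partial_sum k u| <= B * `|u|) /\
  (forall i u, `|fco i u| * `|fvec i : V| <= B * `|u|).
Proof.
have [c c0 cP] := @fco_bound _ FV.
have s0 : 0 <= \sum_(i < fdim V) c * `|fvec i : V|.
  by rewrite sumr_ge0// => i _; rewrite mulr_ge0// ltW.
exists (1 + \sum_(i < fdim V) c * `|fvec i : V|); first by rewrite ltr_wpDr.
split=> [k w|i u].
  rewrite mulrDl mul1r ler_wpDl// mulr_suml.
  rewrite (le_trans (ler_norm_sum _ _ _))// big_mkcond/=; apply: ler_sum => i _.
  case: ifP => _; last by rewrite !mulr_ge0// ltW.
  by rewrite normrZ mulrAC ler_wpM2r.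
apply: (@le_trans _ _ (c * `|fvec i : V| * `|u|)); first by rewrite mulrAC ler_wpM2r.
rewrite ler_wpM2r// ler_wpDl// (bigD1 i)//= lerDl sumr_ge0// => j _.
by rewrite mulr_ge0// ltW.
Qed.

End Frames.

Section Instances.
Context {R : realType}.

Program Definition frameR : frame (R^o) :=
  @Frame R R^o 1 (fun _ => 1) (fun _ v => v) _ _ _.
Next Obligation. by []. Qed.
Next Obligation. by exists 1 => // _ v; rewrite mul1r. Qed.
Next Obligation.
move=> v; rewrite (big_ord_recl 0) big_ord0 addr0.
by rewrite /GRing.scale/= mulr1.
Qed.
#[global] Existing Instance frameR.

Program Definition frame_rV (m : nat) : frame ('rV[R]_m) :=
  @Frame R _ m (fun i => delta_mx 0 i) (fun i v => v 0 i) _ _ _.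
Next Obligation. by move=> m i a u v /=; rewrite !mxE. Qed.
Next Obligation.
move=> m; exists 1 => // i v; rewrite mul1r.
rewrite [leRHS]/Num.norm/= mx_normrE.
exact: (le_bigmax _ (fun ij => `|v ij.1 ij.2|) (0, i)).
Qed.
Next Obligation. by move=> m v; exact: row_sum_delta. Qed.
#[global] Existing Instance frame_rV.

Program Definition frame_prod (V W : normedModType R) (FV : frame V)
    (FW : frame W) : frame (V * W)%type :=
  @Frame R _ (fdim V + fdim W)
   (fun i => match fintype.split i with inl j => (fvec j, 0) | inr j => (0, fvec j) end)
   (fun i v => match fintype.split i with inl j => fco j v.1 | inr j => fco j v.2 end)
    _ _ _.
Next Obligation.
by move=> V W FV FW i a [u1 u2] [v1 v2]/=; case: fintype.split => j /=; rewrite fco_linear.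
Qed.
Next Obligation.
move=> V W FV FW; have [c c0 bc] := @fco_bound _ _ FV.
have [d d0 bd] := @fco_bound _ _ FW.
exists (c + d) => [|i [v w]]; first exact: addr_gt0.
case: fintype.split => j /=.
  rewrite (le_trans (bc _ _))// ler_pM ?(ltW c0)//.
    by rewrite lerDl ltW.
  by rewrite prod_normE/= le_max lexx.
rewrite (le_trans (bd _ _))// ler_pM ?(ltW d0)//.
  by rewrite lerDr ltW.
by rewrite prod_normE/= le_max lexx orbT.
Qed.
Next Obligation.
move=> V W FV FW [v w]/=; rewrite big_split_ord/=.
under eq_bigr do rewrite -[lshift _ _]/(unsplit (inl _)) unsplitK.
under [X in _ + X]eq_bigr do rewrite -[rshift _ _]/(unsplit (inr _)) unsplitK.
rewrite [X in (X, _)](frameE v) [X in (_, X)](frameE w).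
have -> : \sum_(i < fdim V) fco i v *: (fvec i, 0) =
   (\sum_(i < fdim V) fco i v *: fvec i, 0) :> V * W.
  elim/big_rec2 : _ => //= i a b _ ->.
  by congr pair; rewrite /= scaler0 addr0.
have -> : \sum_(i < fdim W) fco i w *: (0, fvec i) =
   (0, \sum_(i < fdim W) fco i w *: fvec i) :> V * W.
  elim/big_rec2 : _ => //= i a b _ ->.
  by congr pair; rewrite /= scaler0 addr0.
by congr pair; rewrite /= ?addr0 ?add0r.
Qed.
#[global] Existing Instance frame_prod.

End Instances.

(** * Functions of class C^k *)

Section Ck.
Context {R : realType}.

(** The iterated derivatives [dderiv] grow on the outside, which is inconvenient
for proofs about compositions.  Peeling off the innermost derivative instead gives
a notion on which one can do induction. *)
Fixpoint Ck {V W : normedModType R} (k : nat) (U : set V) (f : V -> W) : Prop :=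
  (forall x, U x -> {for x, continuous f}) /\
  if k is k'.+1 then
    forall v, (forall x, U x -> derivable f x v) /\ Ck k' U ('D_v f)
  else True.

Section Generic.
Context {V W : normedModType R}.
Implicit Types (U : set V) (f g : V -> W).

Lemma is_derive_cvg f x v l :
  (fun h : R => h^-1 *: ((f \o shift x) (h *: v) - f x)) @ 0^' --> l ->
  is_derive x v f l.
Proof.
move=> cv; apply: DeriveDef; last exact: cvg_lim cv.
by apply/cvg_ex; exists l.
Qed.

Lemma Ck_continuous k U f : Ck k U f -> forall x, U x -> {for x, continuous f}.
Proof. by case: k => [|k] []. Qed.

Lemma Ck_derivable k U f : Ck k.+1 U f -> forall v x, U x -> derivable f x v.
Proof. by move=> [_ fk] v; have [] := fk v. Qed.

Lemma Ck_derive k U f v : Ck k.+1 U f -> Ck k U ('D_v f).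
Proof. by move=> [_ fk]; have [] := fk v. Qed.

Lemma dderiv_rcons s v f : dderiv (rcons s v) f = dderiv s ('D_v f).
Proof. by rewrite /dderiv foldr_rcons. Qed.

Lemma smooth_open_derive U f v : smooth_open U f -> smooth_open U ('D_v f).
Proof. by move=> sf s x Ux; rewrite -dderiv_rcons; exact: sf. Qed.

Lemma smooth_openP U f : smooth_open U f <-> forall k, Ck k U f.
Proof.
split=> [sf k|].
  elim: k f sf => [|k IH] f sf; have c0 x := sf [::] x.
    by split=> // x /c0[].
  split=> [x /c0[]//|v]; split=> [x /c0[] //|].
  exact/IH/smooth_open_derive.
move=> fk s; elim/last_ind: s f fk => [|s v IH] f fk x Ux.
  split; first exact: Ck_continuous (fk 0) _ Ux.
  by move=> v; exact: Ck_derivable (fk 1) v _ Ux.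
by rewrite dderiv_rcons; apply: IH => // k; apply: Ck_derive (fk k.+1).
Qed.

Lemma CkS k U f : Ck k.+1 U f -> Ck k U f.
Proof.
elim: k f => [|k IH] f; first by case.
by move=> [fc fd]; split=> // v; have [? ?] := fd v; split=> //; exact: IH.
Qed.

Lemma open_near U (P : V -> Prop) x : open U -> U x -> (forall y, U y -> P y) ->
  \forall y \near x, P y.
Proof.
by move=> oU Ux UP; apply: filterS (open_nbhs_nbhs (conj oU Ux)) => y /UP.
Qed.

Lemma near_eq_continuous f g x : {near x, f =1 g} ->
  {for x, continuous f} -> {for x, continuous g}.
Proof.
move=> fg fc; suff : g @ x --> g x by [].
rewrite -(nbhs_singleton fg).
by apply: cvg_trans fc; exact: near_eq_cvg.
Qed.

Lemma Ck_ext k U f g : open U -> (forall x, U x -> f x = g x) ->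
  Ck k U f -> Ck k U g.
Proof.
move=> oU; elim: k f g => [|k IH] f g fg [fc fd].
  split=> // x Ux; apply: near_eq_continuous (fc x Ux).
  exact: open_near Ux fg.
split=> [x Ux|v].
  apply: near_eq_continuous (fc x Ux).
  exact: open_near Ux fg.
have [dv kv] := fd v; split=> [x Ux|].
  apply: near_eq_derivable (dv x Ux); exact: open_near Ux fg.
apply: IH kv => x Ux; apply: near_eq_derive; exact: open_near Ux fg.
Qed.

Lemma Ck_local k U f : (forall x, U x -> exists U', [/\ open U', U' x & Ck k U' f]) ->
  Ck k U f.
Proof.
elim: k f => [|k IH] f loc; split=> //.
- by move=> x /loc[U' [oU' U'x [fc _]]]; exact: fc.
- by move=> x /loc[U' [oU' U'x [fc _]]]; exact: fc.
- move=> v; split=> [x /loc[U' [oU' U'x [fc fd]]]|].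
    by have [] := fd v; auto.
  apply: IH => x /loc[U' [oU' U'x [fc fd]]]; exists U'; split => //.
  by have [] := fd v.
Qed.

Lemma Ck_cst k U (a : W) : Ck k U (fun _ => a).
Proof.
elim: k a => [|k IH] a; first by split=> // x _; exact: cst_continuous.
split=> [x _|v]; first exact: cst_continuous.
split=> [x _|]; first exact: derivable_cst.
rewrite (_ : 'D_v _ = fun=> 0)//; apply/funext => x.
exact: (derive_cst a).
Qed.

Lemma CkD k U f g : open U -> Ck k U f -> Ck k U g -> Ck k U (fun x => f x + g x).
Proof.
move=> oU; elim: k f g => [|k IH] f g [fc fd] [gc gd].
  by split=> // x Ux; apply: cvgD; [exact: fc|exact: gc].
split=> [x Ux|v]; first by apply: cvgD; [exact: fc|exact: gc].
have [fv fk] := fd v; have [gv gk] := gd v; split=> [x Ux|].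
  by apply: derivableD; auto.
apply: Ck_ext (IH _ _ fk gk) => // x Ux.
by rewrite -[RHS]/('D_v (f + g) x) deriveD; auto.
Qed.

End Generic.

Section Generic2.
Context {V W : normedModType R}.
Implicit Types (U : set V) (f g : V -> W).

Lemma is_derive_scale (a : V -> R) f (x v : V) :
  derivable a x v -> derivable f x v -> {for x, continuous f} ->
  is_derive x v (fun y => a y *: f y) (a x *: 'D_v f x + 'D_v a x *: f x).
Proof.
move=> da df cf.
have E : (fun h : R => h^-1 *: ((((fun y => a y *: f y) \o shift x) (h *: v)) - a x *: f x))
   = (fun h => a x *: (h^-1 *: ((f \o shift x) (h *: v) - f x))
       + (h^-1 *: ((a \o shift x) (h *: v) - a x)) *: f (h *: v + x)).
  apply/funext => h /=; set A := a _; set B := f _.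
  rewrite (_ : h^-1 *: (A - a x) = h^-1 * (A - a x))// scalerA [a x * _]mulrC.
  rewrite -!scalerA -scalerDr; congr (_ *: _).
  by rewrite scalerBr scalerBl [RHS]addrC addrA subrK.
apply: is_derive_cvg; rewrite E/=; apply: cvgD; first by apply: cvgZr; exact: df.
apply: cvgZ; first exact: da.
apply: cvg_within_filter.
have : (fun h : R => h *: v + x) @ (0 : R) --> x.
  rewrite -[X in _ --> X]add0r -(scale0r v).
  by apply: cvgD; [apply: cvgZl; exact: cvg_id|exact: cvg_cst].
move=> h0; exact: cvg_comp h0 cf.
Qed.

Lemma Ck_scale k U (a : V -> R) f : open U -> Ck k U a -> Ck k U f ->
  Ck k U (fun x => a x *: f x).
Proof.
move=> oU; elim: k a f => [|k IH] a f [ac ad] [fc fd].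
  by split=> // x Ux; apply: cvgZ; [exact: ac|exact: fc].
split=> [x Ux|v]; first by apply: cvgZ; [exact: ac|exact: fc].
have [av ak] := ad v; have [fv fk] := fd v.
have ka : Ck k.+1 U a by split.
have kf : Ck k.+1 U f by split.
have H x : U x -> is_derive x v (fun y => a y *: f y) (a x *: 'D_v f x + 'D_v a x *: f x).
  by move=> Ux; apply: is_derive_scale; auto.
split=> [x Ux|]; first by have [] := H x Ux.
apply: (@Ck_ext _ _ k U (fun x => a x *: 'D_v f x + 'D_v a x *: f x)) => //.
  by move=> x Ux; have [_ ->] := H x Ux.
by apply: CkD => //; apply: IH => //; apply: CkS.
Qed.

Lemma Ck_bigsum k U (I : finType) (F : I -> V -> W) : open U ->
  (forall i, Ck k U (F i)) -> Ck k U (fun x => \sum_i F i x).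
Proof.
move=> oU FC.
suff H (s : seq I) : Ck k U (fun x => \sum_(i <- s) F i x) by exact: H.
elim: s => [|i s IH].
  by apply: (Ck_ext oU _ (Ck_cst _ _ 0)) => x _; rewrite big_nil.
by apply: (Ck_ext oU _ (CkD oU (FC i) IH)) => x _; rewrite big_cons.
Qed.

Lemma CkN k U f : open U -> Ck k U f -> Ck k U (fun x => - f x).
Proof.
move=> oU fk; apply: (Ck_ext oU _ (Ck_scale oU (Ck_cst k U (-1 : R)) fk)) => x _.
by rewrite scaleN1r.
Qed.

Lemma is_derive_co {FW : frame W} i f x v : derivable f x v ->
  is_derive x v (fun y => fco i (f y)) (fco i ('D_v f x)).
Proof.
move=> df.
apply: is_derive_cvg => /=.
rewrite (_ : (fun h => _) = fun h => fco i (h^-1 *: ((f \o shift x) (h *: v) - f x))).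
  apply: continuous_cvg; first exact: fco_continuous.
  exact: df.
by apply/funext => h /=; rewrite fcoZ fcoB.
Qed.

Lemma Ck_co {FW : frame W} i k U f : open U ->
  Ck k U f -> Ck k U (fun x => fco i (f x)).
Proof.
move=> oU; elim: k f => [|k IH] f [fc fd].
  by split=> // x Ux; apply: continuous_cvg (fc x Ux); exact: fco_continuous.
split=> [x Ux|v]; first by apply: continuous_cvg (fc x Ux); exact: fco_continuous.
have [fv fk] := fd v; split=> [x Ux|].
  by have [] := is_derive_co i (fv x Ux).
apply: (Ck_ext oU _ (IH _ fk)) => x Ux.
by have [_ ->] := is_derive_co i (fv x Ux).
Qed.

Lemma Ck_frame {FW : frame W} k U f : open U ->
  (forall i, Ck k U (fun x => fco i (f x))) -> Ck k U f.
Proof.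
move=> oU H; apply: (@Ck_ext _ _ k U (fun x => \sum_i fco i (f x) *: fvec i)) => //.
  by move=> x _; rewrite -frameE.
by apply: Ck_bigsum => // i; apply: Ck_scale => //; exact: Ck_cst.
Qed.

End Generic2.

Section MeanValue.
Context {V : normedModType R}.

Lemma is_derive_line {W : normedModType R} (f : V -> W) (y v : V) (s : R) :
  derivable f (s *: v + y) v ->
  is_derive s 1 (fun s : R => f (s *: v + y)) ('D_v f (s *: v + y)).
Proof.
move=> df.
suff E : (fun h : R => h^-1 *: (((fun s : R => f (s *: v + y)) \o shift s) (h *: 1) - f (s *: v + y)))
  = (fun h : R => h^-1 *: ((f \o shift (s *: v + y)) (h *: v) - f (s *: v + y))).
  by apply: DeriveDef; rewrite /derivable/derive E.
by apply/funext => h /=; rewrite [h *: 1]mulr1 scalerDl addrA.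
Qed.

(** The mean value theorem on the segment from y to y + a v; the sign of a is
arbitrary. *)
Lemma MVT_line (f : V -> R) (y v : V) (a : R) :
  (forall s : R, `|s| <= `|a| -> derivable f (s *: v + y) v) ->
  exists2 s : R, `|s| <= `|a| & f (a *: v + y) - f y = a * 'D_v f (s *: v + y).
Proof.
move=> df; have D (s : R) : `|s| <= `|a| -> is_derive s 1 (fun s : R => f (s *: v + y)) ('D_v f (s *: v + y)).
  by move=> sa; apply: is_derive_line; exact: df.
have [a0|a0] := leP 0 a.
  have sub (s : R) : s \in `[0, a] -> `|s| <= `|a|.
    by rewrite in_itv/= => /andP[s0 sa]; rewrite !ger0_norm.
  have [|||s /sub sa E] := @MVT_segment _ (fun s : R => f (s *: v + y)) (fun s => 'D_v f (s *: v + y)) 0 a => //.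
  - by move=> s sa; apply: D; apply: sub; exact: subset_itv_oo_cc.
  - by apply: derivable_within_continuous => s /sub sa; have [] := D s sa.
  by exists s => //; move: E; rewrite /= scale0r add0r subr0 mulrC.
have sub (s : R) : s \in `[a, 0] -> `|s| <= `|a|.
  by rewrite in_itv/= => /andP[s0 sa]; rewrite !ler0_norm ?lerN2// ltW.
have [|||s /sub sa E] := @MVT_segment _ (fun s : R => f (s *: v + y)) (fun s => 'D_v f (s *: v + y)) a 0 => //.
- exact: ltW.
- by move=> s sa; apply: D; apply: sub; exact: subset_itv_oo_cc.
- by apply: derivable_within_continuous => s /sub sa; have [] := D s sa.
exists s => //; move: E; rewrite /= scale0r add0r sub0r mulrN mulrC => E.
by rewrite -[LHS]opprK opprB E opprK.
Qed.

End MeanValue.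
End Ck.

(** * Frechet differentiability and the chain rule *)

Section Frechet.
Context {R : realType}.

Lemma differentiable_remainder (V W : normedModType R) (f : V -> W) (x : V)
    (df : {linear V -> W}) : continuous df ->
  (forall e : R, 0 < e -> \forall w \near (0 : V),
     `|f (w + x) - (f x + df w)| <= e * `|w|) -> differentiable f x.
Proof.
move=> dfc H.
have E : f \o shift x = cst (f x) + df +o_ (0 : V) id.
  apply/eqaddoP => e e0 /=; near=> w.
  rewrite /=.
  by near: w; exact: H.
apply/diff_locallyP; rewrite (diff_unique dfc E); split => //.
Unshelve. all: by end_near. Qed.

Section Scalar.
Context {V : normedModType R} {FV : frame V}.

Let D (f : V -> R) x (k : nat) (w : V) : R :=
  \sum_(i < fdim V | (i < k)%N) fco i w * 'D_(fvec i) f x.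

(** The classical argument that continuous partial derivatives suffice: the
increment is telescoped over the partial sums of w, and the mean value theorem is
applied in each coordinate. *)
Lemma C1_differentiable_scalar (U : set V) (f : V -> R) x :
  open U -> U x -> Ck 1 U f -> differentiable f x.
Proof.
move=> oU Ux [fc fd].
have Llin : linear (D f x (fdim V) : V -> R^o).
  move=> a u v; rewrite /D scaler_sumr -big_split/=; apply: eq_bigr => i _.
  by rewrite fco_linear mulrDl -mulrA.
pose L : {linear V -> R^o} := HB.pack (D f x (fdim V) : V -> R^o) (GRing.isLinear.Build _ _ _ _ _ Llin).
have [M M0 [PM _]] := @frame_bound _ _ FV.
have [c c0 cP] := @fco_bound _ V FV.
have key (k : nat) : (k <= fdim V)%N -> forall e : R, 0 < e -> \forall w \near (0 : V),
     `|f (partial_sum k w + x) - (f x + D f x k w)| <= e * `|w|.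
  elim: k => [_ e e0|k IH kn e e0].
    apply: nearW => w; rewrite partial_sum0 /D big_pred0//.
    by rewrite add0r addr0 subrr normr0 mulr_ge0// ltW.
  pose k' := Ordinal kn.
  pose N := M + c * `|fvec k' : V| + 1.
  have N0 : 0 < N by rewrite ltr_wpDl// addr_ge0// ?mulr_ge0// ltW.
  pose e' := e / 2 / c.
  have e'0 : 0 < e' by rewrite !divr_gt0.
  have [dk /(_ 0) /Ck_continuous kc] : (forall x, U x -> derivable f x (fvec k')) /\ forall x : nat, Ck 0 U ('D_(fvec k') f).
    by have [? ?] := fd (fvec k').
  have nb : \forall y \near x, U y /\ `|'D_(fvec k') f x - 'D_(fvec k') f y| <= e'.
    apply: filterI; first exact: open_near Ux _.
    by have /cvgrPdist_le := kc x Ux; apply.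
  have /nbhs_ballP[d /= d0 dP] := nb.
  near=> w.
  have IHw : `|f (partial_sum k w + x) - (f x + D f x k w)| <= e / 2 * `|w|.
    by near: w; apply: IH => //; [exact: ltnW|rewrite divr_gt0].
  have wd : N * `|w| < d.
    rewrite -ltr_pdivlMl//; near: w.
    apply: cvgr0_norm_lt; first exact: cvg_id.
    by rewrite mulr_gt0// invr_gt0.
  have inb (s : R) : `|s| <= `|fco k' w| -> ball x d (s *: fvec k' + (partial_sum k w + x)).
    move=> sw; rewrite -ball_normE /ball_/= [_ + (_ + x)]addrA opprD addrCA.
    rewrite subrr addr0 normrN addrC.
    rewrite (le_lt_trans _ wd)// (le_trans (ler_normD _ _))// normrZ.
    rewrite /N mulrDl mul1r ler_wpDr// mulrDl lerD//.
    by rewrite mulrAC ler_wpM2r// (le_trans sw).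
  have [|s sw sE] := @MVT_line _ _ f (partial_sum k w + x) (fvec k') (fco k' w).
    by move=> s sw; apply: dk; have [] := dP _ (inb _ sw).
  rewrite (partial_sumS k') /D (sum_ltS _ k') -/(D f x k w).
  have [_ De] := dP _ (inb _ sw).
  rewrite [X in _ <= X * _](splitr e) mulrDl.
  rewrite (_ : _ - _ = (f (fco k' w *: fvec k' + (partial_sum k w + x)) - f (partial_sum k w + x)
      - fco k' w * 'D_(fvec k') f x) + (f (partial_sum k w + x) - (f x + D f x k w))); last first.
    by rewrite -(addrA (partial_sum k w)) (addrCA (partial_sum k w)); ring.
  rewrite (le_trans (ler_normD _ _))// lerD// sE -mulrBr normrM distrC.
  apply: (@le_trans _ _ ((c * `|w|) * e')); first by rewrite ler_pM.
  by rewrite /e' mulrC mulrA divfK ?gt_eqF.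
apply: (@differentiable_remainder _ _ _ _ L) => [|e e0].
  have -> : (L : V -> R) = fun w => \sum_(i < fdim V) ('D_(fvec i) f x *: fco i w).
    apply/funext => w; rewrite /= /D; apply: eq_big => i; first by rewrite ltn_ord.
    by rewrite mulrC.
  have H : Ck 0 setT (fun w : V => \sum_(i < fdim V) ('D_(fvec i) f x *: (fco i w : R))).
    apply: Ck_bigsum => [|i]; first exact: openT.
    by split=> // w _; apply: cvgZr; exact: fco_continuous.
  by move=> w; exact: (Ck_continuous H).
have := key _ (leqnn _) e e0; apply: filterS => w.
by rewrite (@partial_sum_full _ _ FV).
Unshelve. all: by end_near. Qed.

End Scalar.

Section ChainRule.
Context {V W Z : normedModType R} {FW : frame W} {FZ : frame Z}.

Lemma C1_differentiable (U : set W) (f : W -> Z) x :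
  open U -> U x -> Ck 1 U f -> differentiable f x.
Proof.
move=> oU Ux fC.
have -> : f = \sum_(i < fdim Z) (fun y => fco i (f y) *: fvec i).
  by apply/funext => y; rewrite fct_sumE -frameE.
apply: differentiable_sum => i; apply: differentiableZl.
by apply: (C1_differentiable_scalar oU Ux); exact: Ck_co.
Qed.

(** The inner function matters only along the line through x in the direction v,
where derivability is already Frechet differentiability; only g needs more. *)
Lemma is_derive_comp (U : set W) (g : W -> Z) (f : V -> W) x v :
  open U -> U (f x) -> Ck 1 U g -> derivable f x v ->
  is_derive x v (fun y => g (f y)) ('D_('D_v f x) g (f x)).
Proof.
move=> oU Ufx gC df.
have dg := C1_differentiable oU Ufx gC.
pose c (h : R) := f (h *: v + x).
have c0 : c 0 = f x by rewrite /c scale0r add0r.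
have E (F : V -> Z) : (fun h : R => h^-1 *: ((F \o shift x) (h *: v) - F x)) =
   (fun h : R => h^-1 *: (((fun h : R => F (h *: v + x)) \o shift 0) (h *: 1) - F (0 *: v + x))).
  by apply/funext => h /=; rewrite [h *: 1]mulr1 addr0 scale0r add0r.
have E' (F : V -> W) : (fun h : R => h^-1 *: ((F \o shift x) (h *: v) - F x)) =
   (fun h : R => h^-1 *: (((fun h : R => F (h *: v + x)) \o shift 0) (h *: 1) - F (0 *: v + x))).
  by apply/funext => h /=; rewrite [h *: 1]mulr1 addr0 scale0r add0r.
have dc : differentiable c 0.
  by apply/derivable1_diffP; apply/(derivable1P f x v).
have Dc : 'D_v f x = 'd c 0 1 by rewrite -deriveE// /derive E'.
have dgc : differentiable (g \o c) 0 by apply: differentiable_comp => //; rewrite c0.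
have dgf : derivable (fun y => g (f y)) x v.
  by apply/derivable1P/derivable1_diffP; exact: dgc.
apply: DeriveDef => //.
rewrite /derive E -[LHS]/('D_1 (g \o c) 0) deriveE// diff_comp//; last by rewrite c0.
by rewrite /= c0 -Dc -deriveE.
Qed.

Lemma derive_frame (U : set W) (g : W -> Z) x v : open U -> U x -> Ck 1 U g ->
  'D_v g x = \sum_i fco i v *: 'D_(fvec i) g x.
Proof.
move=> oU Ux gC; have dg := C1_differentiable oU Ux gC.
rewrite deriveE// {1}(frameE v) linear_sum; apply: eq_bigr => i _.
by rewrite linearZ deriveE.
Qed.

Lemma Ck1 k (U : set W) (g : W -> Z) : Ck k.+1 U g -> Ck 1 U g.
Proof. by elim: k => // k IH /CkS. Qed.

End ChainRule.

(** The derivative of the composition is a sum of products of derivatives of f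
and of derivatives of g composed with f, and these have class C^(k-1) by
induction. *)
Lemma Ck_comp {V W Z : normedModType R} {FW : frame W} {FZ : frame Z}
   k (U : set W) (U' : set V) (g : W -> Z) (f : V -> W) :
  open U -> open U' -> (forall x, U' x -> U (f x)) ->
  Ck k U g -> Ck k U' f -> Ck k U' (fun x => g (f x)).
Proof.
move=> oU oU' UU; elim: k g => [|k IH] g [gc gd] [fc fd].
  by split=> // x Ux; apply: continuous_comp; [exact: fc|apply: gc; exact: UU].
have gC : Ck k.+1 U g by split.
have gC1 := Ck1 gC.
have fC : Ck k.+1 U' f by split.
split=> [x Ux|v]; first by apply: continuous_comp; [exact: fc|apply: gc; exact: UU].
have [fv fk] := fd v.
have H x : U' x -> is_derive x v (fun y => g (f y)) ('D_('D_v f x) g (f x)).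
  by move=> Ux; apply: (is_derive_comp oU); auto.
split=> [x Ux|]; first by have [] := H x Ux.
apply: (Ck_ext (f := fun x => \sum_i fco i ('D_v f x) *: 'D_(fvec i) g (f x))) => //.
  by move=> x Ux; have [_ ->] := H x Ux; rewrite (derive_frame _ oU)//; exact: UU.
apply: Ck_bigsum => // i; apply: Ck_scale => //; first exact: Ck_co.
by apply: (IH ('D_(fvec i) g)); [have [] := gd (fvec i)|apply: CkS].
Qed.

End Frechet.

(** * Smooth maps *)

Notation smooth f := (smooth_open setT f).

Section Smooth.
Context {R : realType}.
Implicit Types (V W Z : normedModType R).

Lemma smooth_open_sub V W (U U' : set V) (f : V -> W) :
  U' `<=` U -> smooth_open U f -> smooth_open U' f.
Proof. by move=> UU sf s x /UU Ux; exact: sf. Qed.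

Lemma smooth_open_ext V W (U : set V) (f g : V -> W) : open U ->
  (forall x, U x -> f x = g x) -> smooth_open U f -> smooth_open U g.
Proof.
move=> oU fg /smooth_openP sf; apply/smooth_openP => k.
exact: Ck_ext oU fg (sf k).
Qed.

Lemma smooth_open_comp V W Z {FW : frame W} {FZ : frame Z}
   (U : set W) (U' : set V) (g : W -> Z) (f : V -> W) :
  open U -> open U' -> (forall x, U' x -> U (f x)) ->
  smooth_open U g -> smooth_open U' f -> smooth_open U' (fun x => g (f x)).
Proof.
move=> oU oU' UU /smooth_openP sg /smooth_openP sf; apply/smooth_openP => k.
exact: Ck_comp oU oU' UU (sg k) (sf k).
Qed.

Lemma smooth_comp V W Z {FW : frame W} {FZ : frame Z} (g : W -> Z) (f : V -> W) :
  smooth g -> smooth f -> smooth (fun x => g (f x)).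
Proof. by apply: smooth_open_comp => //; exact: openT. Qed.

Lemma smooth_local V W (f : V -> W) :
  (forall x, exists U g, [/\ open U, U x, smooth_open U g &
     forall y, U y -> f y = g y]) -> smooth f.
Proof.
move=> H; apply/smooth_openP => k; apply: Ck_local => x _.
have [U [g [oU Ux /smooth_openP sg fg]]] := H x; exists U; split => //.
by apply: Ck_ext oU _ (sg k) => y Uy; rewrite fg.
Qed.

Lemma smooth_cst V W (a : W) : smooth (fun _ : V => a).
Proof. by apply/smooth_openP => k; exact: Ck_cst. Qed.

Lemma smooth_id V : smooth (fun x : V => x).
Proof.
apply/smooth_openP => -[|k]; first by split=> // x _; exact: cvg_id.
split=> [x _|v]; first exact: cvg_id.
split=> [x _|]; first exact: derivable_id.
rewrite (_ : 'D_v _ = fun=> v); first exact: Ck_cst.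
by apply/funext => x; exact: derive_id.
Qed.

Lemma smoothD V W (f g : V -> W) : smooth f -> smooth g -> smooth (fun x => f x + g x).
Proof.
move=> /smooth_openP sf /smooth_openP sg; apply/smooth_openP => k.
by apply: CkD => //; exact: openT.
Qed.

Lemma smoothN V W (f : V -> W) : smooth f -> smooth (fun x => - f x).
Proof.
move=> /smooth_openP sf; apply/smooth_openP => k.
by apply: CkN => //; exact: openT.
Qed.

Lemma smoothB V W (f g : V -> W) : smooth f -> smooth g -> smooth (fun x => f x - g x).
Proof. by move=> sf sg; apply: smoothD => //; exact: smoothN. Qed.

Lemma smoothZ V W (a : V -> R) (f : V -> W) :
  smooth a -> smooth f -> smooth (fun x => a x *: f x).
Proof.
move=> /smooth_openP sf /smooth_openP sg; apply/smooth_openP => k.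
by apply: Ck_scale => //; exact: openT.
Qed.

Lemma smoothM V (a b : V -> R) : smooth a -> smooth b -> smooth (fun x => a x * b x).
Proof. exact: smoothZ. Qed.

Lemma smooth_sum V W (I : finType) (F : I -> V -> W) :
  (forall i, smooth (F i)) -> smooth (fun x => \sum_i F i x).
Proof.
move=> sF; apply/smooth_openP => k; apply: Ck_bigsum => [|i]; first exact: openT.
by have /smooth_openP := sF i.
Qed.

Lemma smooth_co V W {FW : frame W} i (f : V -> W) : smooth f -> smooth (fun x => fco i (f x)).
Proof.
move=> /smooth_openP sf; apply/smooth_openP => k.
by apply: Ck_co => //; exact: openT.
Qed.

Lemma smooth_frame V W {FW : frame W} (f : V -> W) :
  (forall i, smooth (fun x => fco i (f x))) -> smooth f.
Proof.
move=> sf; apply/smooth_openP => k; apply: Ck_frame => [|i]; first exact: openT.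
by have /smooth_openP := sf i.
Qed.

Lemma smooth_fst V W Z {FW : frame W} {FZ : frame Z} (f : V -> W * Z) :
  smooth f -> smooth (fun x => (f x).1).
Proof.
move=> sf; apply: smooth_frame => i.
have := smooth_co (FW := frame_prod FW FZ) (lshift (fdim Z) i) sf => /=.
by rewrite -[lshift _ _]/(unsplit (inl _)) unsplitK.
Qed.

Lemma smooth_snd V W Z {FW : frame W} {FZ : frame Z} (f : V -> W * Z) :
  smooth f -> smooth (fun x => (f x).2).
Proof.
move=> sf; apply: smooth_frame => i.
have := smooth_co (FW := frame_prod FW FZ) (rshift (fdim W) i) sf => /=.
by rewrite -[rshift _ _]/(unsplit (inr _)) unsplitK.
Qed.

Lemma smooth_pair V W Z {FW : frame W} {FZ : frame Z} (f : V -> W) (g : V -> Z) :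
  smooth f -> smooth g -> smooth (fun x => (f x, g x)).
Proof.
move=> sf sg; apply: smooth_frame => i /=.
by case: (fintype.split i) => j /=; exact: smooth_co.
Qed.

Lemma smooth_coord V m (f : V -> 'rV[R]_m) j : smooth f -> smooth (fun x => f x 0 j).
Proof. by move=> sf; exact: (smooth_co (FW := frame_rV m) j sf). Qed.

Lemma smooth_derive V W (f : V -> W) v : smooth f -> smooth ('D_v f).
Proof. exact: smooth_open_derive. Qed.

Lemma smooth_derivable V W (f : V -> W) x v : smooth f -> derivable f x v.
Proof. by move=> sf; have [_] := sf [::] x I; apply. Qed.

Lemma smooth_continuous V W (f : V -> W) : smooth f -> continuous f.
Proof. by move=> sf x; have [? _] := sf [::] x I. Qed.

Lemma smooth_C1 V W (f : V -> W) : smooth f -> Ck 1 setT f.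
Proof. by move=> /smooth_openP/(_ 1). Qed.

Lemma smooth_differentiable V W {FV : frame V} {FW : frame W} (f : V -> W) x :
  smooth f -> differentiable f x.
Proof.
by move=> sf; apply: (C1_differentiable openT I); exact: smooth_C1.
Qed.

Lemma derive_linear V W {FV : frame V} {FW : frame W} (f : V -> W) x a u v :
  smooth f -> 'D_(a *: u + v) f x = a *: 'D_u f x + 'D_v f x.
Proof.
move=> sf; have df : differentiable f x by exact: smooth_differentiable.
by rewrite !deriveE// linearP.
Qed.

Lemma derive_sumE V W {FV : frame V} {FW : frame W} (f : V -> W) x v :
  smooth f -> 'D_v f x = \sum_i fco i v *: 'D_(fvec i) f x.
Proof.
by move=> sf; apply: (derive_frame _ openT) => //; exact: smooth_C1.
Qed.

Lemma derive_chain V W Z {FW : frame W} {FZ : frame Z} (g : W -> Z) (f : V -> W) x v :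
  smooth g -> smooth f -> 'D_v (fun y => g (f y)) x = 'D_('D_v f x) g (f x).
Proof.
move=> sg sf.
by have [_ ->] := is_derive_comp openT I (smooth_C1 sg) (smooth_derivable (x := x) (v := v) sf).
Qed.

(** Derivatives are linear in the direction, so that a derivative in a variable
direction is a finite sum of derivatives in fixed ones. *)
Lemma smooth_derive2 V W Z {FW : frame W} {FZ : frame Z} (g : W -> Z) (f w : V -> W) :
  smooth g -> smooth f -> smooth w -> smooth (fun x => 'D_(w x) g (f x)).
Proof.
move=> sg sf sw.
rewrite (_ : (fun x => _) = fun x => \sum_i fco i (w x) *: 'D_(fvec i) g (f x)).
  apply: smooth_sum => i; apply: smoothZ; first exact: smooth_co.
  apply: (smooth_comp (g := 'D_(fvec i) g)) sf; exact: smooth_derive.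
by apply/funext => x; rewrite derive_sumE.
Qed.

Lemma Ck_inv V k (U : set V) (a : V -> R) : open U -> (forall x, U x -> a x != 0) ->
  Ck k U a -> Ck k U (fun x => (a x)^-1).
Proof.
move=> oU a0; elim: k => [|k IH] [ac ad].
  by split=> // x Ux; apply: cvgV; [exact: a0|exact: ac].
have aC : Ck k.+1 U a by split.
split=> [x Ux|v]; first by apply: cvgV; [exact: a0|exact: ac].
have [av ak] := ad v; split=> [x Ux|]; first by apply: derivableV; auto.
apply: (Ck_ext (f := fun x => (- ((a x)^-1 *: (a x)^-1 : R^o)) *: 'D_v a x)) => //.
  by move=> x Ux; rewrite deriveV//; [rewrite expr2 invfM|exact: a0|exact: av].
apply: Ck_scale => //; apply: CkN => //.
by apply: Ck_scale => //; apply: IH; exact: (CkS aC).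
Qed.

Lemma smoothV V (a : V -> R) : (forall x, a x != 0) -> smooth a -> smooth (fun x => (a x)^-1).
Proof.
move=> a0 /smooth_openP sa; apply/smooth_openP => k.
by apply: Ck_inv => //; exact: openT.
Qed.

End Smooth.

(** * A smooth step function *)

Section Step.
Context {R : realType}.

(** To differentiate infinitely often it is enough to stay within a family of
functions. *)
Lemma smooth_closed_family (F : set (R -> R)) :
  (forall f, F f -> exists2 g, F g & forall x : R, is_derive x 1 f (g x)) ->
  forall f, F f -> smooth f.
Proof.
move=> H f Ff; apply/smooth_openP => k.
elim: k f Ff => [|k IH] f Ff; have [g Fg Df] := H f Ff.
  split=> // x _; apply/differentiable_continuous/derivable1_diffP.
  by have [] := Df x.
have df x : differentiable f x by apply/derivable1_diffP; have [] := Df x.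
split=> [x _|v]; first exact/differentiable_continuous.
split=> [x _|]; first exact: diff_derivable.
apply: (Ck_ext (f := fun x => v *: g x)) => //; first exact: openT.
  move=> x _; rewrite deriveE//.
  have [_ <-] := Df x; rewrite deriveE//.
  by rewrite -[in RHS](mulr1 v) [RHS]linearZ.
by apply: Ck_scale; [exact: openT|exact: Ck_cst|exact: IH].
Qed.

(** The functions p(1/x) exp(-1/x), extended by 0 to the left half-line, form a
family that is closed under differentiation. *)
Definition flat (p : {poly R}) (x : R) : R :=
  if 0 < x then p.[x^-1] * expR (- x^-1) else 0.

Lemma horner_le_expR (p : {poly R}) :
  exists2 C : R, 0 < C & forall y, 0 <= y -> `|p.[y]| * expR (- y) <= C.
Proof.
exists (1 + \sum_(i < size p) `|p`_i| * (1 + i`!%:R)).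
  by rewrite ltr_wpDr// sumr_ge0// => i _; rewrite mulr_ge0// addr_ge0.
move=> y y0; rewrite ler_wpDl// horner_coef.
rewrite expRN ler_pdivrMr ?expR_gt0//.
rewrite (le_trans (ler_norm_sum _ _ _))// mulr_suml; apply: ler_sum => i _.
rewrite normrM -mulrA ler_wpM2l// ger0_norm ?exprn_ge0//.
case: (nat_of_ord i) => [|n].
  rewrite expr0 mulrDl !mul1r ler_wpDr// ?mulr_ge0 ?expR_ge0//.
  by rewrite (le_trans _ (expR_ge1Dx _))// lerDl.
rewrite mulrDl mul1r ler_wpDl ?expR_ge0// mulrC -ler_pdivrMr ?ltr0n ?fact_gt0//.
by rewrite (le_trans _ (expR_ge1Dxn n y0))// lerDr.
Qed.

(** A quadratic bound makes the derivative at 0 vanish; the factor X^2 absorbs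
the division by x^2. *)
Lemma flat_bound p : exists2 C : R, 0 < C & forall x, `|flat p x| <= C * x ^+ 2.
Proof.
have [C C0 HC] := horner_le_expR (p * 'X^2).
exists C => // x; rewrite /flat; case: ifPn => x0; last first.
  by rewrite normr0 mulr_ge0 ?sqr_ge0// ltW.
rewrite normrM [X in _ * X]gtr0_norm ?expR_gt0//.
have := HC x^-1; rewrite invr_ge0 => /(_ (ltW x0)).
rewrite hornerM hornerXn normrM [X in _ * X * _]ger0_norm ?exprn_ge0 ?invr_ge0 ?(ltW x0)//.
rewrite mulrAC -ler_pdivlMr ?exprn_gt0 ?invr_gt0//.
by rewrite exprVn invrK.
Qed.

Lemma is_derive_flat p (x : R) :
  is_derive x 1 (flat p) (flat ('X^2 * (p - p^`())) x).
Proof.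
have [x0|x0|->] := ltgtP x 0.
- rewrite {2}/flat ltNge (ltW x0)/=.
  apply: (near_eq_is_derive (f := cst 0)).
  near=> y; rewrite /flat ifN// -leNgt ltW//.
  by near: y; apply: lt_nbhsl.
- have xn : x != 0 by rewrite gt_eqF.
  rewrite {2}/flat x0.
  apply: (near_eq_is_derive (f := fun y => (horner p \o GRing.inv) y * (expR \o (fun y : R => - y^-1)) y)).
    near=> y; rewrite /flat ifT//.
    by near: y; apply: lt_nbhsr.
  have d1 : is_derive x 1 (GRing.inv : R -> R) (- x^-2).
    by apply: DeriveDef; [apply: derivableV => //; exact: derivable_id|
      rewrite deriveV ?derive_id ?scaler1//; exact: derivable_id].
  apply: is_derive_eq.
  rewrite !hornerE /=.
  by rewrite /GRing.scale/=; field.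
- rewrite {2}/flat ltxx.
  have [C C0 HC] := flat_bound p.
  apply: is_derive_cvg.
  apply/cvgr0Pnorm_le => /= e e0; near=> h.
  have hn : h != 0 by near: h; exact: nbhs_dnbhs_neq.
  rewrite addr0 [h *: 1]mulr1 {2}/flat ltxx subr0 normrZ normfV.
  rewrite ler_pdivrMl ?normr_gt0// (le_trans (HC _))//.
  rewrite -real_normK ?num_real// expr2 mulrA mulrC ler_pM2l ?normr_gt0//.
  rewrite -ler_pdivlMl//.
  near: h; apply: cvgr0_norm_le; last by rewrite mulr_gt0 ?invr_gt0.
  by apply: cvg_within_filter; exact: cvg_id.
Unshelve. all: by end_near. Qed.

Lemma smooth_flat p : smooth (flat p).
Proof.
apply: (@smooth_closed_family (range flat)) => // _ [q _ <-].
by exists (flat ('X^2 * (q - q^`()))) => // x; exact: is_derive_flat.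
Qed.

(** Besides building cut-off functions, the step serves to reparametrize time:
a path run at the time [step t] is constant outside the unit interval. *)
Definition step (x : R) : R := flat 1 x / (flat 1 x + flat 1 (1 - x)).

Lemma flat_ge0 x : 0 <= flat 1 x.
Proof. by rewrite /flat; case: ifP => // _; rewrite hornerE mul1r expR_ge0. Qed.

Lemma flat_gt0 x : 0 < x -> 0 < flat 1 x.
Proof. by rewrite /flat => ->; rewrite hornerE mul1r expR_gt0. Qed.

Lemma flat_eq0 x : x <= 0 -> flat 1 x = 0.
Proof. by rewrite /flat leNgt => /negPf ->. Qed.

Lemma step_den x : 0 < flat 1 x + flat 1 (1 - x).
Proof.
have [x0|x0] := ltP 0 x; first by rewrite ltr_wpDr ?flat_ge0 ?flat_gt0.
by rewrite ltr_wpDl ?flat_ge0// flat_gt0//; lra.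
Qed.

Lemma smooth_step : smooth step.
Proof.
apply: smoothM; first exact: smooth_flat.
apply: smoothV => [x|]; first by rewrite gt_eqF// step_den.
apply: smoothD; first exact: smooth_flat.
apply: (smooth_comp (g := flat 1) (f := fun x : R => 1 - x)); first exact: smooth_flat.
by apply: smoothB; [exact: smooth_cst|exact: smooth_id].
Qed.

Lemma step0 x : x <= 0 -> step x = 0.
Proof. by move=> x0; rewrite /step flat_eq0 ?mul0r. Qed.

Lemma step1 x : 1 <= x -> step x = 1.
Proof.
move=> x1; rewrite /step [flat 1 (1 - x)]flat_eq0 ?addr0 ?subr_le0//.
by rewrite divff// gt_eqF// flat_gt0// (lt_le_trans _ x1).
Qed.

Lemma step_ge0 x : 0 <= step x.
Proof. by rewrite divr_ge0 ?flat_ge0// ltW// step_den. Qed.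

Lemma step_le1 x : step x <= 1.
Proof. by rewrite ler_pdivrMr ?step_den// mul1r lerDl flat_ge0. Qed.

End Step.

(** * Cut-off functions *)

Section Cutoff.
Context {R : realType}.

Lemma smooth_prod (V : normedModType R) (I : finType) (F : I -> V -> R) :
  (forall i, smooth (F i)) -> smooth (fun x => \prod_i F i x).
Proof.
move=> sF; suff H (s : seq I) : smooth (fun x => \prod_(i <- s) F i x) by exact: H.
elim: s => [|i s IH].
  by rewrite (_ : (fun x => _) = fun=> 1); [exact: smooth_cst|apply/funext => x; rewrite big_nil].
rewrite (_ : (fun x => _) = fun x => F i x * \prod_(i <- s) F i x).
  exact: (smoothM (sF i) IH).
by apply/funext => x; rewrite big_cons.
Qed.

Context {V : normedModType R} {FV : frame V}.

(** A product over the coordinates, because the norm is not smooth; the squares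
replace absolute values for the same reason. *)
Definition cutoff (a b : R) (x : V) : R :=
  \prod_(i < fdim V) step ((b ^+ 2 - fco i x ^+ 2) / (b ^+ 2 - a ^+ 2)).

Lemma smooth_cutoff a b : smooth (cutoff a b).
Proof.
apply: smooth_prod => i.
apply: (smooth_comp (g := step) (f := fun x => (b ^+ 2 - fco i x ^+ 2) / (b ^+ 2 - a ^+ 2))); first exact: smooth_step.
apply: smoothM; last exact: smooth_cst.
apply: smoothB; first exact: smooth_cst.
by apply: smoothM; apply: smooth_co; exact: smooth_id.
Qed.

Lemma cutoff1 a b x : 0 <= a -> a < b -> (forall i, `|fco i x| <= a) -> cutoff a b x = 1.
Proof.
move=> a0 ab xa; rewrite /cutoff big1// => i _; apply: step1.
rewrite ler_pdivlMr ?mul1r ?lerD2l ?lerN2; last first.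
  by rewrite subr_gt0 ltr_pXn2r// nnegrE// (le_trans a0 (ltW ab)).
by rewrite -real_normK ?num_real// ler_pXn2r// nnegrE.
Qed.

Lemma cutoff0 a b x i : 0 <= a -> a < b -> b <= `|fco i x| -> cutoff a b x = 0.
Proof.
move=> a0 ab xb; rewrite /cutoff (bigD1 i)//= step0 ?mul0r//.
have b0 : 0 <= b by exact: ltW (le_lt_trans a0 ab).
rewrite mulr_le0_ge0//; last first.
  by rewrite invr_ge0 subr_ge0 ler_pXn2r ?nnegrE// ltW.
by rewrite subr_le0 -[leRHS]real_normK ?num_real// ler_pXn2r// nnegrE.
Qed.

End Cutoff.

(** * The scalar implicit function theorem *)

Section Implicit.
Context {R : realType} {W : normedModType R} {FW : frame W}.
Variables (Phi : W -> R -> R) (kappa : W -> R).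
Let G (q : W * R^o) : R := Phi q.1 q.2.
Hypothesis sG : smooth G.
Hypothesis G_incr : forall q, 0 < 'D_(0, 1) G q.
Hypothesis Gk : forall w, Phi w (kappa w) = 0.

Lemma implicit_incr w (k1 k2 : R) : k1 < k2 -> Phi w k1 < Phi w k2.
Proof.
move=> k12.
have [|s sw sE] := @MVT_line _ _ G (w, k1) (0, 1) (k2 - k1).
  by move=> s _; exact: smooth_derivable.
rewrite -subr_gt0.
have -> : Phi w k2 - Phi w k1 = G ((k2 - k1) *: (0, 1) + (w, k1)) - G (w, k1).
  rewrite /G/=; congr (Phi _ _ - _); first by rewrite scaler0 add0r.
  by rewrite [_ *: _]mulr1 subrK.
by rewrite sE mulr_gt0 ?subr_gt0.
Qed.

Let G_continuous : continuous G. Proof. exact: smooth_continuous. Qed.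

Let Phi_near (w : W) (k : R) (P : R -> Prop) :
  (\forall y \near Phi w k, P y) -> \forall w' \near w, P (Phi w' k).
Proof.
move=> PP; have : (fun w' : W => G (w', k : R^o)) @ w --> G (w, k : R^o).
  apply: (continuous_comp (f := fun w' : W => (w', k : R^o)) (g := G)).
    by apply: (@cvg_pair _ _ _ _ (nbhs w) (nbhs (k : R^o))); [exact: cvg_id|exact: cvg_cst].
  exact: G_continuous.
by apply.
Qed.

(** Phi w changes sign between kappa w - e and kappa w + e, and still does so
for w' near w; by monotonicity kappa w' lies in between. *)
Let kappa_continuous : continuous kappa.
Proof.
move=> w; apply/cvgrPdist_lt => /= e e0; near=> w'.
have l1 : Phi w' (kappa w - e) < 0.
  near: w'; apply: (Phi_near (P := fun y => y < 0)); apply: lt_nbhsl.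
  by rewrite -(Gk w); apply: implicit_incr; rewrite ltrBlDr ltrDl.
have l2 : 0 < Phi w' (kappa w + e).
  near: w'; apply: (Phi_near (P := fun y => 0 < y)); apply: lt_nbhsr.
  by rewrite -(Gk w); apply: implicit_incr; rewrite ltrDl.
rewrite ltr_distlC; apply/andP; split.
  rewrite ltNge; apply/negP; rewrite le_eqVlt => /predU1P[E|].
    by move: l1; rewrite -E Gk ltxx.
  by move=> /(implicit_incr w'); rewrite Gk => /lt_trans/(_ l1); rewrite ltxx.
rewrite ltNge; apply/negP; rewrite le_eqVlt => /predU1P[E|].
  by move: l2; rewrite E Gk ltxx.
by move=> /(implicit_incr w'); rewrite Gk => /lt_trans - /(_ _ l2); rewrite ltxx.
Unshelve. all: by end_near. Qed.

(** The mean value theorem on the segment between two points of the graph of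
kappa, where G vanishes, gives the difference quotient as the value of the
continuous function Q at a point of that segment. *)
Let is_derive_kappa w v : is_derive w v kappa
  (- ('D_(v, 0) G (w, kappa w) / 'D_(0, 1) G (w, kappa w))).
Proof.
pose Q q : R := - ('D_((v, 0) : W * R^o) G q / 'D_((0, 1) : W * R^o) G q).
have Qc : continuous Q.
  move=> q; apply: cvgN; apply: cvgM; last apply: cvgV.
  - exact: (smooth_continuous (smooth_derive _ sG)).
  - by rewrite gt_eqF.
  - exact: (smooth_continuous (smooth_derive _ sG)).
pose d h := kappa (h *: v + w) - kappa w.
have H (h : R) : exists q : W * R^o, `|q - (w, kappa w)| <= `|(h *: v, d h) : W * R^o| /\
   (h != 0 -> h^-1 *: d h = Q q).
  have [|s] := @MVT_line _ _ G (w, kappa w) (h *: v, d h) 1.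
    by move=> s _; exact: smooth_derivable.
  rewrite normr1 => s1 sE; exists (s *: (h *: v, d h) + (w, kappa w)); split.
    by rewrite addrK normrZ ler_piMl.
  move=> h0; set q := (s *: _ + _).
  have E0 : G (1 *: ((h *: v, d h) : W * R^o) + (w, kappa w)) - G (w, kappa w) = 0.
    by rewrite scale1r /G/= /d subrK !Gk subrr.
  have E1 : ((h *: v, d h) : W * R^o) = h *: (v, 0) + (d h *: (0, 1) + 0).
    by congr pair; rewrite /= ?scaler0 ?addr0// add0r [RHS]mulr1.
  have : h * 'D_((v, 0) : W * R^o) G q + d h * 'D_((0, 1) : W * R^o) G q = 0.
    rewrite -[RHS]E0 sE mul1r -/q E1 (derive_linear q h (v, 0) _ sG).
    by rewrite (derive_linear q (d h) (0, 1) 0 sG) derive0 addr0.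
  have := G_incr q; rewrite /Q.
  move: ('D_((v, 0) : W * R^o) G q) ('D_((0, 1) : W * R^o) G q) (d h) => a b dh b0 E2.
  rewrite -[LHS]/(h^-1 * dh); apply: (mulfI h0); rewrite mulVKf//.
  apply: (mulIf (lt0r_neq0 b0)); rewrite -mulrA mulNr divfK ?gt_eqF// mulrN.
  by apply/eqP; rewrite -addr_eq0 addrC E2.
pose xi h := sval (cid (H h)).
have xi1 h : `|xi h - (w, kappa w)| <= `|(h *: v, d h) : W * R^o|.
  by rewrite /xi; case: cid => q [].
have xi2 h : h != 0 -> h^-1 *: d h = Q (xi h).
  by rewrite /xi; case: cid => q [].
apply: (is_derive_cvg (l := Q (w, kappa w))).
have xic : xi @ (0 : R) --> ((w, kappa w) : W * R^o).
  apply/subr_cvg0/cvgr0Pnorm_le => /= e e0; near=> h.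
  apply: (le_trans (xi1 h)).
  near: h; apply: cvgr0_norm_le => //.
  have -> : (0 : W * R^o) = (0 *: v, kappa (0 *: v + w) - kappa w :> R^o).
    by rewrite scale0r add0r subrr.
  apply: (@cvg_pair _ _ _ _ (nbhs _) (nbhs _)).
    by apply: cvgZl; exact: cvg_id.
  apply: cvgB; last exact: cvg_cst.
  apply: (@continuous_comp R W R (fun h : R => h *: v + w) kappa 0); last exact: kappa_continuous.
  by apply: cvgD; [apply: cvgZl; exact: cvg_id|exact: cvg_cst].
have : Q (xi h) @[h --> 0^'] --> Q (w, kappa w).
  by apply: cvg_within_filter; apply: continuous_cvg; [exact: Qc|exact: xic].
apply: cvg_trans; apply: near_eq_cvg; near=> h.
rewrite -xi2//; near: h; exact: nbhs_dnbhs_neq.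
Unshelve. all: by end_near. Qed.

(** The formula for the derivative expresses it through kappa and smooth
functions, so each degree of regularity of kappa gives the next one. *)
Lemma smooth_implicit : smooth kappa.
Proof.
apply/smooth_openP; elim=> [|k IH]; first by split=> // x _; exact: kappa_continuous.
split=> [x _|v]; first exact: kappa_continuous.
split=> [x _|]; first by have [] := is_derive_kappa x v.
pose Q q : R := - ('D_((v, 0) : W * R^o) G q / 'D_((0, 1) : W * R^o) G q).
have sQ : smooth Q.
  apply: smoothN; apply: smoothM; first exact: smooth_derive.
  by apply: smoothV => [q|]; [rewrite gt_eqF|exact: smooth_derive].
rewrite (_ : 'D_v kappa = fun w => Q (w, kappa w)); last first.
  by apply/funext => w; have [_ ->] := is_derive_kappa w v.
apply: (Ck_comp (g := Q) (U := setT)) => //; try exact: openT.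
  by have /smooth_openP := sQ.
apply: Ck_frame => [|i]; first exact: openT.
rewrite /=; case: (fintype.split i) => j /=; last exact: IH.
by have /smooth_openP := smooth_co j (@smooth_id R W).
Qed.

End Implicit.

(** * Diffeomorphisms and shears *)

Section Diffeo.
Context {R : realType}.

Lemma is_derive_affine (V W : normedModType R) (f : V -> W) x v w :
  (forall h : R, f (h *: v + x) = f x + h *: w) -> is_derive x v f w.
Proof.
move=> H.
apply: is_derive_cvg.
have : w @[_ --> (0 : R)^'] --> w by exact: cvg_cst.
apply: cvg_trans; apply: near_eq_cvg; near=> h => /=.
rewrite H addrAC subrr add0r scalerA mulVf ?scale1r//.
near: h; exact: nbhs_dnbhs_neq.
Unshelve. all: by end_near. Qed.

Section FV.
Context {V : normedModType R} {FV : frame V}.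
Implicit Types f g : V -> V.

Lemma derive_dirN {W : normedModType R} {FW : frame W} (f : V -> W) x v :
  smooth f -> 'D_(- v) f x = - 'D_v f x.
Proof.
move=> sf; have := derive_linear (FV := FV) (FW := FW) x (-1) v 0 sf.
by rewrite addr0 derive0 addr0 !scaleN1r.
Qed.

Lemma derive_dirZ {W : normedModType R} {FW : frame W} (f : V -> W) x a v :
  smooth f -> 'D_(a *: v) f x = a *: 'D_v f x.
Proof.
by move=> sf; have := derive_linear (FV := FV) (FW := FW) x a v 0 sf; rewrite addr0 derive0 addr0.
Qed.

Lemma derive_dirD {W : normedModType R} {FW : frame W} (f : V -> W) x u v :
  smooth f -> 'D_(u + v) f x = 'D_u f x + 'D_v f x.
Proof. by move=> sf; have := derive_linear (FV := FV) (FW := FW) x 1 u v sf; rewrite !scale1r. Qed.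

Lemma diffeo_id : is_diffeo (fun x : V => x).
Proof. by split; [exact: smooth_id|exists id; split => //; exact: smooth_id]. Qed.

Lemma diffeo_comp f g : is_diffeo f -> is_diffeo g -> is_diffeo (fun x => f (g x)).
Proof.
move=> [sf [f' [sf' ff' f'f]]] [sg [g' [sg' gg' g'g]]].
split; first exact: smooth_comp.
exists (fun x => g' (f' x)); split.
- exact: smooth_comp.
- by move=> x; rewrite ff' gg'.
- by move=> x; rewrite g'g f'f.
Qed.

Lemma diffeo_inv f : is_diffeo f -> exists2 g, is_diffeo g & cancel f g /\ cancel g f.
Proof. by move=> [sf [g [sg fg gf]]]; exists g => //; split=> //; exists f. Qed.

Lemma diffeo_smooth f : is_diffeo f -> smooth f. Proof. by case. Qed.

Lemma diffeo_ext f g : (forall x, f x = g x) -> is_diffeo f -> is_diffeo g.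
Proof. by move=> /funext ->. Qed.

Lemma diffeo_quotient f g : is_diffeo g -> is_diffeo (fun x => f (g x)) -> is_diffeo f.
Proof.
move=> /diffeo_inv[g' dg' [gg' g'g]] /diffeo_comp/(_ dg').
by apply: diffeo_ext => x; rewrite g'g.
Qed.

Section Shear.
Variables (E : V -> V) (h : V -> R).
Hypothesis sE : smooth E.
Hypothesis EE : forall p (s : R), E (p + s *: E p) = E p.
Hypothesis sh : smooth h.

(** The field E is constant along its orbits, which are straight lines.  The
shear maps each of these lines to itself, increasingly because of the slope
condition and onto because h is bounded.  The inverse q - kappa(q) E(q) solves an
implicit equation for its displacement kappa. *)
Lemma shear_diffeo (M : R) : (forall p, `|h p| <= M) ->
  (forall p, 0 < 1 + 'D_(E p) h p) -> is_diffeo (fun p => p + h p *: E p).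
Proof.
move=> hM h1.
have EE' p (s : R) : E (p - s *: E p) = E p by rewrite -scaleNr EE.
pose Phi q (k : R) := k - h (q - k *: E q).
pose f (q : V * R^o) := q.1 - (q.2 : R) *: E q.1.
have sf1 : smooth (fun q : V * R^o => q.1) by apply: smooth_fst; exact: smooth_id.
have sf2 : smooth (fun q : V * R^o => q.2 : R) by apply: smooth_snd; exact: smooth_id.
have sf : smooth f.
  exact: (smoothB sf1 (smoothZ sf2 (smooth_comp sE sf1))).
pose G (q : V * R^o) := Phi q.1 q.2.
have sG : smooth G by exact: (smoothB sf2 (smooth_comp sh sf)).
have Gincr q : 0 < 'D_(0, 1) G q.
  have -> : 'D_((0, 1) : V * R^o) G q = 1 + 'D_(E (f q)) h (f q); last exact: h1.
  have df : is_derive q ((0, 1) : V * R^o) f (- E q.1).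
    apply: is_derive_affine => k; rewrite /f/= scaler0 add0r scalerN -addrA; congr (_ + _).
    by rewrite -opprD -scalerDl [k *: 1]mulr1 addrC.
  have d2 : is_derive q ((0, 1) : V * R^o) (fun q => q.2 : R) 1.
    by apply: is_derive_affine => k; rewrite /= addrC.
  have dhf : is_derive q ((0, 1) : V * R^o) (fun q => h (f q)) (- 'D_(E (f q)) h (f q)).
    have df' : derivable f q (0, 1) by [].
    have := is_derive_comp openT I (smooth_C1 sh) df' => -[] // d1 d3.
    apply: DeriveDef => //; rewrite d3.
    by have [_ ->] := df; rewrite derive_dirN// /f EE'.
  have := is_deriveB (f := fun q : V * R^o => q.2 : R) (g := fun q => h (f q)).
  move=> /(_ q (0, 1) _ _ d2 dhf) [_].
  by rewrite opprK.
have ex q : exists k, Phi q k = 0.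
  have M0 : 0 <= M by exact: le_trans (normr_ge0 _) (hM 0).
  have Mk k : `|h (q - k *: E q)| <= M by exact: hM.
  have [] := @IVT _ (Phi q) (- M - 1) (M + 1) 0.
  - lra.
  - apply: continuous_subspaceT => k.
    apply: (@continuous_comp R (V * R^o)%type R (fun k => (q, k)) G).
      by apply: (@cvg_pair _ _ _ _ (nbhs _) (nbhs _)); [exact: cvg_cst|exact: cvg_id].
    exact: smooth_continuous.
  - have := Mk (- M - 1); have := Mk (M + 1); rewrite /Phi !ler_norml.
    move=> /andP[a1 a2] /andP[a3 a4].
    by rewrite ge_min le_max; apply/andP; split; apply/orP; [left|right]; lra.
  - by move=> k _ kE; exists k.
pose kappa q := sval (cid (ex q)).
have kE q : Phi q (kappa q) = 0 by rewrite /kappa; case: cid.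
have sk : smooth kappa by apply: (smooth_implicit (Phi := Phi)).
have uniq q k : Phi q k = 0 -> kappa q = k.
  move=> k0; have inc := implicit_incr (Phi := Phi) sG Gincr.
  have [/(inc q)|/(inc q)|//] := ltgtP (kappa q) k; by rewrite kE k0 ltxx.
split; first by apply: smoothD; [exact: smooth_id|exact: smoothZ].
exists (fun q => q - kappa q *: E q); split.
- by apply: smoothB; [exact: smooth_id|exact: smoothZ].
- move=> p; rewrite EE (uniq _ (h p)) ?addrK//.
  by rewrite /Phi EE addrK subrr.
- move=> q; rewrite EE'; have /eqP := kE q; rewrite /Phi subr_eq0 => /eqP <-.
  by rewrite subrK.
Qed.

End Shear.
End FV.
End Diffeo.

(** * Small perturbations of the identity *)

Section Perturbation.
Context {R : realType} {V : normedModType R} {FV : frame V}.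
Local Notation partial_sum := (@partial_sum R V FV).

Lemma smooth_partial_sum k : smooth (partial_sum k).
Proof.
rewrite (_ : partial_sum k = fun u => \sum_(i < fdim V)
   (if (i < k)%N then fco i u *: fvec i else 0)).
  apply: smooth_sum => i; case: (i < k)%N; last exact: smooth_cst.
  by apply: smoothZ; [apply: smooth_co; exact: smooth_id|exact: smooth_cst].
by apply/funext => u; rewrite /partial_sum big_mkcond.
Qed.

Lemma derive_partial_sum k u x : 'D_u (partial_sum k) x = partial_sum k u.
Proof.
have [_ ->//] : is_derive x u (partial_sum k) (partial_sum k u).
by apply: is_derive_affine => h; rewrite partial_sumP addrC.
Qed.

(** The map g_k = id + (the first k coordinates of h) is a diffeomorphism by
induction on k: g_(k+1) is g_k followed by a shear in the coordinate k, with
displacement h_k g_k^-1.  A bound on the derivative of h makes the derivative of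
g_k^-1 at most 2 and the slope of the shear at least 1/2. *)
Lemma perturbation_diffeo : exists2 eps : R, 0 < eps & forall (h : V -> V) (M : R),
  smooth h -> (forall x, `|h x| <= M) ->
  (forall x w, `|'D_w h x| <= eps * `|w|) -> is_diffeo (fun x => x + h x).
Proof.
have [B B0 [pB fB]] := frame_bound.
have [c c0 cP] := @fco_bound _ V FV.
(* Partial sums cost a factor B: the derivative of the first k coordinates of h then
   has norm at most 1/4, and that of g_k^-1 at most 4/3, which is estimated by 2. *)
exists (4 * B)^-1; first by rewrite invr_gt0 mulr_gt0.
have BB : B * (4 * B)^-1 = 1 / 4 by field; rewrite gt_eqF.
move=> h M sh hM Dh.
suff H k : (k <= @fdim _ _ FV)%N -> is_diffeo (fun x => x + partial_sum k (h x)).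
  by have := H _ (leqnn _); apply: diffeo_ext => x; rewrite partial_sum_full.
elim: k => [_|k IH kn].
  by apply: diffeo_ext (@diffeo_id _ V) => x; rewrite partial_sum0 addr0.
have {IH} dg := IH (ltnW kn).
pose k' := Ordinal kn.
pose g x := x + partial_sum k (h x).
have [g' dg' [gg' g'g]] := diffeo_inv dg.
pose a q := fco k' (h (g' q)).
have sg' := diffeo_smooth dg'.
have sps : smooth (fun x => partial_sum k (h x)).
  by apply: smooth_comp sh; exact: smooth_partial_sum.
have sa : smooth a by apply: smooth_co; exact: smooth_comp.
suff S : is_diffeo (fun q => q + a q *: (fvec k' : V)).
  apply: diffeo_ext (diffeo_comp S dg) => x /=.
  by rewrite /a gg' -addrA (partial_sumS k').
apply: (@shear_diffeo _ _ _ (fun _ => fvec k') a _ _ _ (c * M)) => //.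
- exact: smooth_cst.
- by move=> p; rewrite /a (le_trans (cP _ _))// ler_pM2l.
move=> q; set e := fvec k'.
pose p := g' q; pose w := 'D_e g' q.
have wE : w + partial_sum k ('D_w h p) = e.
  have : 'D_e (fun q => g (g' q)) q = e.
    rewrite (_ : (fun q => g (g' q)) = id) ?derive_id//.
    by apply/funext => y; rewrite /g g'g.
  rewrite (derive_chain (g := g) (f := g'))//; last exact: diffeo_smooth dg.
  rewrite -/w -/p => <-; rewrite /g.
  have d1 : derivable (id : V -> V) p w by exact: derivable_id.
  have d2 : derivable (fun x => partial_sum k (h x)) p w by exact: smooth_derivable.
  apply/esym; etransitivity; first exact: (deriveD d1 d2).
  rewrite derive_id (derive_chain (g := partial_sum k) (f := h))//.
    by rewrite derive_partial_sum.
  exact: smooth_partial_sum.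
have hw : `|'D_w h p| <= (4 * B)^-1 * `|w| by exact: Dh.
have w2 : `|w| <= 2 * `|e|.
  have : `|partial_sum k ('D_w h p)| <= `|w| / 2.
    rewrite (le_trans (pB _ _))// (le_trans (ler_wpM2l (ltW B0) hw))//.
    by rewrite mulrA BB; have := normr_ge0 w; lra.
  have : `|w| <= `|e| + `|partial_sum k ('D_w h p)|.
    by rewrite -[X in `|X| <= _](addrK (partial_sum k ('D_w h p))) wE ler_normB.
  lra.
have -> : 'D_e a q = fco k' ('D_w h p).
  have [_ ->] := is_derive_co k' (smooth_derivable (x := q) (v := e) (smooth_comp sh sg')).
  congr (fco k' _); exact: derive_chain.
suff : `|fco k' ('D_w h p)| <= 1 / 2 by rewrite ler_norml => /andP[]; lra.
have [e0|e0] := eqVneq e 0.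
  have w0 : w = 0 by apply/eqP; rewrite -normr_le0 (le_trans w2)// e0 normr0 mulr0.
  by rewrite w0 derive0 fco0 normr0; lra.
rewrite -(ler_pM2r (x := `|e|)) ?normr_gt0//.
rewrite (le_trans (fB _ _))// (le_trans (ler_wpM2l (ltW B0) hw))//.
by rewrite mulrA BB; move: w2; lra.
Qed.

(** Smallness near each point of K is uniform by compactness. *)
Lemma small_diffeo (I : Type) (F : set_system I) {FF : Filter F} (h : I -> V -> V)
   (K : set V) : compact K ->
  (\forall i \near F, smooth (h i)) -> (forall i p, ~ K p -> h i p = 0) ->
  (forall eta p, 0 < eta -> K p -> \forall p' \near p & i \near F,
     `|h i p'| <= eta /\ forall j, `|'D_(fvec j) (h i) p'| <= eta) ->
  \forall i \near F, is_diffeo (fun x => x + h i x).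
Proof.
move=> cK sh hK hs.
have [eps e0 P] := perturbation_diffeo.
have [c c0 cP] := @fco_bound _ V FV.
pose eta := eps / (c * (@fdim _ _ FV)%:R + 1).
have den0 : 0 < c * (@fdim _ _ FV)%:R + 1 by rewrite ltr_wpDl// mulr_ge0// ltW.
have eta0 : 0 < eta by rewrite divr_gt0.
have := (compact_near_coveringP K).1 cK I F (fun i p' => `|h i p'| <= eta /\
   forall j : 'I_(@fdim _ _ FV), `|'D_(fvec j) (h i) p'| <= eta) FF.
move=> /(_ (fun p Kp => hs eta p eta0 Kp)) H.
near=> i.
have Hi : K `<=` (fun p' => `|h i p'| <= eta /\ forall j : 'I_(@fdim _ _ FV), `|'D_(fvec j) (h i) p'| <= eta).
  by near: i; exact: H.
have shi : smooth (h i) by near: i.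
apply: (P _ eta) => //.
  move=> x; have [/Hi[]//|/hK ->] := pselect (K x).
  by rewrite normr0 ltW.
move=> x w; have [/Hi[_ Hx]|nKx] := pselect (K x); last first.
  rewrite (near_eq_derive (g := cst 0)) ?derive_cst ?normr0 ?mulr_ge0 ?(ltW e0)//.
  have oK : open (~` K) by apply: closed_openC; apply: compact_closed => //; exact: norm_hausdorff.
  exact: (open_near (P := fun y => h i y = 0) oK nKx (hK i)).
rewrite derive_sumE// (le_trans (ler_norm_sum _ _ _))//.
apply: (@le_trans _ _ (\sum_(j < @fdim _ _ FV) c * `|w| * eta)).
  by apply: ler_sum => j _; rewrite normrZ ler_pM.
rewrite sumr_const card_ord -mulr_natr.
have E : eta * (c * (@fdim _ _ FV)%:R + 1) = eps by rewrite divfK ?gt_eqF.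
rewrite -E mulrDr mulr1 mulrDl.
have -> : c * `|w| * eta * (@fdim _ _ FV)%:R = eta * (c * (@fdim _ _ FV)%:R) * `|w| by ring.
by rewrite lerDl mulr_ge0// ltW.
Unshelve. all: by end_near. Qed.

Lemma frame_box_compact (r : R) : exists2 K : set V, compact K &
  forall y, (forall i, `|fco i y| <= r) -> K y.
Proof.
pose n := @fdim _ _ FV.
pose f (a : 'rV[R]_n) : V := \sum_(i < n) a 0 i *: fvec i.
have sf : smooth f.
  apply: smooth_sum => i; apply: smoothZ; last exact: smooth_cst.
  by apply: smooth_coord; exact: smooth_id.
exists (image [set a : 'rV[R]_n | forall i, [set` `[- r, r]] (a 0 i)] f).
  apply: continuous_compact; first exact/continuous_subspaceT/smooth_continuous.
  by apply: (@rV_compact R n (fun=> [set` `[- r, r]])) => i; exact: segment_compact.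
move=> y yr; exists (\row_i fco i y); last first.
  by rewrite /f [RHS]frameE; apply: eq_bigr => i _; rewrite mxE.
by move=> i /=; rewrite mxE in_itv/= -ler_norml.
Qed.

End Perturbation.

(** * Local extension to a global diffeomorphism *)

Section LocalExtension.
Context {R : realType} {V : normedModType R} {FV : frame V}.

Lemma near_pair_dnbhs (p : V) (P : V * R -> Prop) :
  (\forall q \near (p, 0 : R), q.2 != 0 -> P q) ->
  \forall p' \near p & r \near (0 : R)^', P (p', r).
Proof.
move=> [[A B] /= [Ap B0] AB].
exists (A, [set r | B r /\ r != 0]) => /=.
  split=> //; near=> r; split; last by near: r; exact: nbhs_dnbhs_neq.
  by near: r; rewrite near_withinE; apply: filterS B0.
by move=> [p' r] [/= Ap' [Br r0]]; apply: (AB (p', r)).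
Unshelve. all: by end_near. Qed.

(** Balls in the scale variable are symmetric intervals, so estimates near 0
also hold at all smaller scales; the mean value theorem needs this. *)
Lemma near_pair_shrink (p : V) (P : V * R -> Prop) :
  (\forall q \near (p, 0 : R), P q) ->
  \forall q \near (p, 0 : R), forall s : R, `|s| <= `|q.2| -> P (q.1, s).
Proof.
move=> /nbhs_ballP[e /= e0 eP]; apply/nbhs_ballP; exists e => //= -[p' r] [/= pe re] s sr.
apply: eP; split => //=; move: re; rewrite -ball_normE /ball_/= !sub0r !normrN.
exact: le_lt_trans.
Qed.

Lemma near_forall_fin (p : V) (I : finType) (P : I -> V * R -> Prop) :
  (forall i, \forall q \near (p, 0 : R), P i q) ->
  \forall q \near (p, 0 : R), forall i, P i q.
Proof. by move=> H; apply: (@filter_forall _ I P (nbhs (p, 0 : R)) _ H). Qed.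

Lemma continuous_small (W : normedModType R) (p : V) (L : V * R -> W) (eta : R) : 0 < eta ->
  continuous L -> L (p, 0) = 0 -> \forall q \near (p, 0 : R), `|L q| <= eta.
Proof.
move=> eta0 cL L0.
have L00 : L q @[q --> (p, 0 : R)] --> (0 : W) by rewrite -L0; exact: cL.
by move/cvgr0_norm_le : L00; apply.
Qed.

(** This takes the place of the inverse function theorem.  After an affine change
of coordinates, Phi is y + g(y) near 0, with g and its derivative vanishing at 0.
Rescaled by r, the perturbation becomes g(r y) / r, which is C^1-small on a fixed
ball when r is small; cut off outside that ball, it defines a diffeomorphism, and
undoing the rescaling gives one that agrees with Phi near x0.  The linear maps A
and B, inverse to each other, are the inverse of the derivative and the
derivative. *)
Lemma local_extension (Phi A B : V -> V) x0 : smooth Phi -> is_diffeo B ->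
  smooth A -> (forall a u v, A (a *: u + v) = a *: A u + A v) ->
  cancel A B -> cancel B A -> (forall w, 'D_w Phi x0 = B w) ->
  exists2 Theta, is_diffeo Theta & \forall x \near x0, Phi x = Theta x.
Proof.
move=> sPhi dB sA linA AB BA DPhi.
have A0 : A 0 = 0 by have := linA 1 0 0; rewrite !scale1r addr0 => /eqP; rewrite -subr_eq0 opprD addrA subrr add0r oppr_eq0 => /eqP.
have BZ a w : B (a *: w) = a *: B w.
  by apply: (can_inj AB); rewrite BA; have := linA a (B w) 0; rewrite !addr0 A0 addr0 BA.
pose g y := A (Phi (x0 + y) - Phi x0) - y.
have sPx : smooth (fun y => Phi (x0 + y) - Phi x0).
  apply: smoothB; last exact: smooth_cst.
  apply: (smooth_comp (g := Phi)) => //.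
  by apply: smoothD; [exact: smooth_cst|exact: smooth_id].
have sAP : smooth (fun y => A (Phi (x0 + y) - Phi x0)) by apply: smooth_comp sPx.
have sg : smooth g by apply: smoothB => //; exact: smooth_id.
have g0 : g 0 = 0 by rewrite /g addr0 subrr A0 subr0.
have Dg w : 'D_w g 0 = 0.
  have d1 := smooth_derivable (x := 0) (v := w) sAP.
  have d2 : derivable (fun y : V => y) 0 w by exact: derivable_id.
  rewrite /g; etransitivity; first exact: (deriveB d1 d2).
  rewrite derive_id (derive_chain (g := A) (f := fun y => Phi (x0 + y) - Phi x0))//.
  have [_ ->] : is_derive (Phi (x0 + 0) - Phi x0) ('D_w (fun y => Phi (x0 + y) - Phi x0) 0) A (A ('D_w (fun y => Phi (x0 + y) - Phi x0) 0)).
    by apply: is_derive_affine => h; rewrite linA addrC.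
  suff -> : 'D_w (fun y => Phi (x0 + y) - Phi x0) 0 = B w by rewrite BA subrr.
  rewrite -DPhi /derive.
  set F1 := (X in X @ _); set F2 := (X in _ = lim (X @ _)).
  suff -> : F1 = F2 by [].
  apply/funext => k; rewrite /F1 /F2 /=; congr (_ *: _).
  by rewrite !addr0 opprB addrA subrK [x0 + _]addrC.
have [K cK Kbox] := frame_box_compact (V := V) 2.
pose chi := @cutoff _ _ FV 1 2.
have schi : smooth chi by exact: smooth_cutoff.
pose h (r : R) y := chi y *: (r^-1 *: g (r *: y)).
have sgr r : smooth (fun y => r^-1 *: g (r *: y)).
  apply: smoothZ; first exact: smooth_cst.
  apply: (smooth_comp (g := g)) => //.
  by apply: smoothZ; [exact: smooth_cst|exact: smooth_id].
have sh r : smooth (h r) by exact: smoothZ.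
have sfst : smooth (fun q : V * R^o => q.1) by apply: smooth_fst; exact: smooth_id.
have ssnd : smooth (fun q : V * R^o => q.2 : R) by apply: smooth_snd; exact: smooth_id.
have near_g (p : V) (eta : R) : 0 < eta -> \forall q \near (p, 0 : R), q.2 != 0 ->
    `|q.2^-1 *: g (q.2 *: q.1)| <= eta.
  move=> eta0.
  have [c c0 cP] := @norm_frame _ _ FV.
  pose eta' := eta / (c * (@fdim _ _ FV)%:R + 1).
  have den0 : 0 < c * (@fdim _ _ FV)%:R + 1 by rewrite ltr_wpDl// mulr_ge0// ltW.
  have eta'0 : 0 < eta' by rewrite divr_gt0.
  pose L (q : V * R^o) := 'D_(q.1) g ((q.2 : R) *: q.1).
  have sL : smooth L by apply: smooth_derive2 => //; exact: smoothZ.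
  have Hi (i : 'I_(@fdim _ _ FV)) : \forall q \near (p, 0 : R), forall s : R, `|s| <= `|q.2| -> `|fco i (L (q.1, s))| <= eta'.
    apply: (@near_pair_shrink p (fun q => `|fco i (L q)| <= eta')).
    apply: (@continuous_small R p (fun q => fco i (L q))) => //.
      by apply: (smooth_continuous (V := (V * R^o)%type)); exact: smooth_co.
    by rewrite /L/= scale0r Dg fco0.
  have H0 : \forall q \near (p, 0 : R), forall (i : 'I_(@fdim _ _ FV)) (s : R),
      `|s| <= `|q.2| -> `|fco i (L (q.1, s))| <= eta'.
    exact: near_forall_fin Hi.
  apply: filterS H0 => -[p' r] /= H r0.
  rewrite normrZ normfV ler_pdivrMl ?normr_gt0//.
  rewrite (le_trans (cP _))//.
  apply: (@le_trans _ _ (c * \sum_(i < @fdim _ _ FV) `|r| * eta')).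
    rewrite ler_pM2l//; apply: ler_sum => i _.
    have [|s sr] := @MVT_line _ _ (fun y => fco i (g y)) 0 p' r.
      by move=> s _; apply: smooth_derivable; exact: smooth_co.
    rewrite g0 fco0 subr0 !addr0 => ->; rewrite normrM ler_wpM2l//.
    have [_ ->] := is_derive_co i (smooth_derivable (x := s *: p') (v := p') sg).
    exact: H.
  rewrite sumr_const card_ord -mulr_natr.
  have E : eta' * (c * (@fdim _ _ FV)%:R + 1) = eta by rewrite divfK ?gt_eqF.
  rewrite -E.
  have -> : c * (`|r| * eta' * (@fdim _ _ FV)%:R) = `|r| * (eta' * (c * (@fdim _ _ FV)%:R)) by ring.
  by rewrite ler_wpM2l// ler_pM2l// lerDl.
have near_Dg (p : V) (eta : R) (j : 'I_(@fdim _ _ FV)) : 0 < eta -> \forall q \near (p, 0 : R),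
    `|'D_(fvec j) g (q.2 *: q.1)| <= eta.
  move=> eta0; apply: (@continuous_small _ p (fun q => 'D_(fvec j) g (q.2 *: q.1))) => //.
    apply: (smooth_continuous (V := (V * R^o)%type)).
    apply: smooth_derive2 => //; first exact: smoothZ.
    exact: smooth_cst.
  by rewrite /= scale0r Dg.
have Dh (r : R) y w : r != 0 -> 'D_w (h r) y = chi y *: 'D_w g (r *: y) + 'D_w chi y *: (r^-1 *: g (r *: y)).
  move=> r0.
  have c1 : {for y, continuous (fun y => r^-1 *: g (r *: y))} by exact: smooth_continuous.
  have [_ ->] := is_derive_scale (smooth_derivable (x := y) (v := w) schi)
      (smooth_derivable (x := y) (v := w) (sgr r)) c1.
  congr (_ *: _ + _).
  have sgr' : smooth (fun y => g (r *: y)).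
    apply: (smooth_comp (g := g)) => //.
    by apply: smoothZ; [exact: smooth_cst|exact: smooth_id].
  etransitivity; first exact: (deriveZ r^-1 (smooth_derivable (x := y) (v := w) sgr')).
  have [|_ ->] := is_derive_comp (g := g) (f := fun y => r *: y) (x := y) (v := w) openT I (smooth_C1 sg).
    by apply: smooth_derivable; apply: smoothZ; [exact: smooth_cst|exact: smooth_id].
  have [_ ->] : is_derive y w (fun y => r *: y) (r *: w).
    by apply: is_derive_affine => k; rewrite scalerDr addrC !scalerA mulrC.
  by rewrite derive_dirZ// scalerA mulVf// scale1r.
have : \forall r \near (0 : R)^', is_diffeo (fun x => x + h r x).
  apply: (small_diffeo (K := K)) => //.
  - exact: nearW.
  - move=> r p Kp; rewrite /h; suff -> : chi p = 0 by rewrite scale0r.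
    have [i /negP] : exists i : 'I_(@fdim _ _ FV), ~ `|fco i p| <= 2.
      by apply/existsNP => /Kbox.
    by rewrite -ltNge => pi; apply: (@cutoff0 _ _ _ _ _ _ i); rewrite ?ler01 ?ltr1n// ltW.
  - move=> eta p eta0 Kp.
    apply: (@near_pair_dnbhs p (fun q => `|h q.2 q.1| <= eta /\
       forall j : 'I_(@fdim _ _ FV), `|'D_(fvec j) (h q.2) q.1| <= eta)).
    pose C := 1 + `|chi p| + \sum_(j < @fdim _ _ FV) `|'D_(fvec j) chi p|.
    have C1 : 1 <= C by rewrite /C -addrA lerDl addr_ge0// sumr_ge0.
    have C0 : 0 < C by exact: lt_le_trans C1.
    pose eta' := eta / (2 * C).
    have eta'0 : 0 < eta' by rewrite divr_gt0// mulr_gt0.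
    have nbd (u : V -> R) : smooth u -> \forall q \near (p, 0 : R), `|u q.1| <= 1 + `|u p|.
      move=> su.
      have : \forall q \near (p, 0 : R), `|u q.1 - u p| <= 1.
        apply: (@continuous_small _ p (fun q : V * R => u q.1 - u p)) => //; last by rewrite subrr.
        apply: (smooth_continuous (V := (V * R^o)%type)).
        by apply: smoothB; [exact: smooth_comp|exact: smooth_cst].
      apply: filterS => q uq; rewrite -[X in `|X| <= _](subrK (u p)).
      by rewrite (le_trans (ler_normD _ _))// lerD2r.
    have nchi : \forall q \near (p, 0 : R), `|chi q.1| <= C.
      apply: filterS (nbd chi schi) => q /le_trans; apply.
      by rewrite /C lerDl sumr_ge0.
    have nDchi : \forall q \near (p, 0 : R), forall j : 'I_(@fdim _ _ FV), `|'D_(fvec j) chi q.1| <= C.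
      apply: near_forall_fin => j.
      apply: filterS (nbd _ (smooth_derive (fvec j) schi)) => q /le_trans; apply.
      rewrite /C -addrA lerD2l (bigD1 j)//= addrCA lerDl addr_ge0// sumr_ge0//.
    have nDg : \forall q \near (p, 0 : R), forall j : 'I_(@fdim _ _ FV), `|'D_(fvec j) g (q.2 *: q.1)| <= eta'.
      by apply: near_forall_fin => j; exact: near_Dg.
    have ng := near_g p eta' eta'0.
    have Ceta : C * eta' = eta / 2 by rewrite /eta'; field; rewrite gt_eqF.
    have eta2 : eta / 2 <= eta by lra.
    near=> q => q0.
    have ngq : `|q.2^-1 *: g (q.2 *: q.1)| <= eta'.
      by move: q0; near: q; exact: ng.
    have nchiq : `|chi q.1| <= C by near: q; exact: nchi.
    have nDchiq : forall j : 'I_(@fdim _ _ FV), `|'D_(fvec j) chi q.1| <= C by near: q; exact: nDchi.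
    have nDgq : forall j : 'I_(@fdim _ _ FV), `|'D_(fvec j) g (q.2 *: q.1)| <= eta' by near: q; exact: nDg.
    split=> [|j].
      by rewrite /h normrZ (le_trans _ eta2)// -Ceta ler_pM.
    rewrite Dh// (le_trans (ler_normD _ _))// !normrZ (splitr eta) -Ceta.
    by rewrite -(normrZ q.2^-1); apply: lerD; apply: ler_pM.
move=> H.
have [r [r0 dr]] : exists r : R, r != 0 /\ is_diffeo (fun x => x + h r x).
  apply: (@filter_ex _ ((0 : R)^')); near=> r; split.
    by near: r; exact: nbhs_dnbhs_neq.
  by near: r; exact: H.
have daff (a : R) (v : V) : a != 0 -> is_diffeo (fun x : V => a *: x + v).
  move=> a0; split.
    by apply: smoothD; [apply: smoothZ; [exact: smooth_cst|exact: smooth_id]|exact: smooth_cst].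
  exists (fun y => a^-1 *: (y - v)); split.
  - apply: smoothZ; first exact: smooth_cst.
    by apply: smoothB; [exact: smooth_id|exact: smooth_cst].
  - by move=> x; rewrite addrK scalerA mulVf// scale1r.
  - by move=> y; rewrite scalerA divff// scale1r subrK.
exists (fun x => B (r *: ((r^-1 *: x - r^-1 *: x0) + h r (r^-1 *: x - r^-1 *: x0)) + 0) + Phi x0).
  apply: (diffeo_comp (f := fun y => y + Phi x0)).
    by apply: diffeo_ext (daff 1 (Phi x0) _) => // x; rewrite scale1r.
  apply: diffeo_comp => //; apply: (diffeo_comp (f := fun y => r *: y + 0)); first exact: daff.
  apply: (diffeo_comp (f := fun y => y + h r y) (g := fun x => r^-1 *: x - r^-1 *: x0)) => //.
  by apply: daff; rewrite invr_eq0.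
have : \forall x \near x0, forall i : 'I_(@fdim _ _ FV), `|fco i (r^-1 *: (x - x0))| <= 1.
  apply: filter_forall => i; apply: cvgr0_norm_le => //.
  have cc : continuous (fun x : V => fco i (r^-1 *: (x - x0)) : R).
    apply: smooth_continuous; apply: smooth_co; apply: smoothZ; first exact: smooth_cst.
    by apply: smoothB; [exact: smooth_id|exact: smooth_cst].
  have -> : (0 : R) = fco i (r^-1 *: (x0 - x0)) by rewrite subrr scaler0 fco0.
  exact: cc.
apply: filterS => x Hx; rewrite -scalerBr /h /chi cutoff1// ?ltr1n// scale1r.
rewrite addr0 scalerDr scalerA divff// scale1r scalerA divff// !scale1r.
by rewrite /g [X in B X]addrC subrK AB subrK [X in _ = Phi X]addrC subrK.
Unshelve. all: by end_near. Qed.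

End LocalExtension.

(** * Smooth dependence of inverses on parameters *)

Section JointInverse.
Context {R : realType}.

(** Near each point Phi is a diffeomorphism of the whole space, whose inverse is
smooth and must agree there with Psi. *)
Lemma smooth_inverse (V : normedModType R) (FV : frame V) (Phi Psi : V -> V) :
  smooth Phi -> cancel Phi Psi -> cancel Psi Phi ->
  (forall x0, exists A B : V -> V, [/\ is_diffeo B, smooth A,
     (forall a u v, A (a *: u + v) = a *: A u + A v),
     cancel A B /\ cancel B A & forall w, 'D_w Phi x0 = B w]) -> smooth Psi.
Proof.
move=> sPhi PhiK PsiK H; apply: smooth_local => y0.
have [A [B [dB sA linA [AB BA] DPhi]]] := H (Psi y0).
have [Th dT PT] := local_extension sPhi dB sA linA AB BA DPhi.
have [T dT' [ThK TK]] := diffeo_inv dT.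
have TP : T y0 = Psi y0.
  by apply: (can_inj ThK); rewrite TK -(nbhs_singleton PT) PsiK.
have : nbhs y0 [set y | Phi (T y) = Th (T y)].
  have Tc : T y @[y --> y0] --> Psi y0.
    by rewrite -TP; exact: (smooth_continuous (diffeo_smooth dT')).
  exact: Tc PT.
rewrite nbhsE => -[U [oU Uy] US]; exists U, T; split=> //.
  by apply: smooth_open_sub (diffeo_smooth dT').
by move=> y /US; rewrite /= TK => {1}<-; rewrite PhiK.
Qed.

Context {V : normedModType R} {FV : frame V}.

Lemma smooth_apply2 {P Q W : normedModType R} {FP : frame P} {FQ : frame Q} {FW : frame W}
   (F : P -> Q -> W) (a : V -> P) (b : V -> Q) :
  smooth (fun q : P * Q => F q.1 q.2) -> smooth a -> smooth b -> smooth (fun x => F (a x) (b x)).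
Proof.
move=> sF sa sb; apply: (smooth_comp (g := fun q : P * Q => F q.1 q.2) (f := fun x => (a x, b x))) => //.
exact: smooth_pair.
Qed.

Lemma smooth_slice (F : R -> V -> V) t :
  smooth (fun q : R^o * V => F q.1 q.2) -> smooth (F t).
Proof.
move=> sF; apply: (smooth_apply2 (P := R^o) (a := fun=> t) (b := id)) => //; first exact: smooth_cst.
exact: smooth_id.
Qed.

Lemma derive_pair {W Z : normedModType R} {FW : frame W} {FZ : frame Z} (f : V -> W) (g : V -> Z) x v :
  smooth f -> smooth g -> 'D_v (fun x => (f x, g x)) x = ('D_v f x, 'D_v g x).
Proof.
move=> sf sg.
suff [_ ->] : is_derive x v (fun x => (f x, g x)) ('D_v f x, 'D_v g x) by [].
apply: is_derive_cvg.
apply: (@cvg_pair _ _ _ _ (nbhs _) (nbhs _)).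
  have := smooth_derivable (x := x) (v := v) sf; exact.
have := smooth_derivable (x := x) (v := v) sg; exact.
Qed.

End JointInverse.

Section JointInverse2.
Context {R : realType} {V : normedModType R} {FV : frame V}.
Variables (F G : R -> V -> V).
Hypothesis sF : smooth (fun q : R^o * V => F q.1 q.2).
Hypothesis sG : forall t, smooth (G t).
Hypothesis FK : forall t, cancel (F t) (G t).
Hypothesis GK : forall t, cancel (G t) (F t).

Let Fh (q : R^o * V) := F q.1 q.2.
Let Phi (q : R^o * V) : R^o * V := (q.1, Fh q).
Let Psi (q : R^o * V) : R^o * V := (q.1, G q.1 q.2).

Let sfst : smooth (fun q : R^o * V => q.1). Proof. by apply: smooth_fst; exact: smooth_id. Qed.
Let ssnd : smooth (fun q : R^o * V => q.2). Proof. by apply: smooth_snd; exact: smooth_id. Qed.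

Let sPhi : smooth Phi. Proof. exact: smooth_pair. Qed.

Let D0 t p w : 'D_((0, w) : R^o * V) Fh (t, p) = 'D_w (F t) p.
Proof.
have sp : smooth (fun p : V => (t, p) : R^o * V).
  by apply: smooth_pair; [exact: smooth_cst|exact: smooth_id].
have := derive_chain (g := Fh) (f := fun p : V => (t, p) : R^o * V) (FW := frame_prod _ _) (FZ := FV) p w sF sp.
rewrite -[X in X = _]/('D_w (F t) p) => ->.
by have [_ ->] : is_derive p w (fun p : V => (t, p) : R^o * V) (0, w)
  by apply: is_derive_affine => k; congr pair; rewrite /= ?scaler0 ?addr0// addrC.
Qed.

(** The map (t, p) -> (t, F t p) has the derivative (tau, w) -> (tau, a tau + L w),
with L the invertible derivative of F t: it is block triangular, and its inverse
A is explicit. *)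
Lemma joint_inverse : smooth (fun q : R^o * V => G q.1 q.2).
Proof.
suff : smooth Psi by move/smooth_snd.
apply: (smooth_inverse _ sPhi).
- by move=> [t p]; rewrite /Psi /Phi /Fh/= FK.
- by move=> [t p]; rewrite /Psi /Phi /Fh/= GK.
move=> [t p].
pose A (q : R^o * V) : R^o * V :=
  (q.1, 'D_(q.2 - 'D_((q.1, 0) : R^o * V) Fh (t, p)) (G t) (F t p)).
pose B (q : R^o * V) : R^o * V := (q.1, 'D_q Fh (t, p)).
have split_q (tau : R^o) (w : V) : 'D_((tau, w) : R^o * V) Fh (t, p) =
    'D_((tau, 0) : R^o * V) Fh (t, p) + 'D_w (F t) p.
  rewrite -D0 -derive_dirD//; congr ('D_ _ _ _).
  by congr pair; rewrite /= ?addr0 ?add0r.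
have sA : smooth A.
  apply: (smooth_pair sfst); apply: (smooth_derive2 (sG t) (@smooth_cst _ _ _ (F t p))).
  apply: (smoothB ssnd); apply: (smooth_derive2 sF (@smooth_cst _ _ _ (t, p))).
  exact: (smooth_pair sfst (@smooth_cst _ _ _ (0 : V))).
have sB : smooth B.
  apply: (smooth_pair sfst).
  exact: (smooth_derive2 sF (@smooth_cst _ _ _ (t, p)) (@smooth_id _ _)).
have GF w : 'D_('D_w (F t) p) (G t) (F t p) = w.
  rewrite -(derive_chain (g := G t) (f := F t))//; last exact: smooth_slice.
  rewrite (_ : (fun y => _) = id) ?derive_id//.
  by apply/funext => y; rewrite FK.
have FG w : 'D_('D_w (G t) (F t p)) (F t) p = w.
  rewrite -[X in 'D_ _ _ X](FK t p) -(derive_chain (g := F t) (f := G t))//; last exact: smooth_slice.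
  rewrite (_ : (fun y => _) = id) ?derive_id//.
  by apply/funext => y; rewrite GK.
have AB : cancel A B.
  move=> [tau w]; rewrite /A /B/= split_q FG.
  by rewrite addrC subrK.
have BA : cancel B A.
  by move=> [tau w]; rewrite /A /B/= split_q addrAC subrr add0r GF.
exists A, B; split => //.
- by split=> //; exists A.
- move=> a [u1 u2] [v1 v2]; rewrite /A/=; congr pair => /=.
  rewrite -[X in _ = X](@derive_linear _ _ _ _ _ (G t))//; congr ('D_ _ _ _).
  rewrite scalerBr -addrACA -opprD; congr (_ - _).
  rewrite -derive_linear//; congr ('D_ _ _ _).
  by congr pair; rewrite /= scaler0 addr0.
- move=> w; rewrite /Phi (derive_pair (f := fun q => q.1))//.
  congr pair; have [_ ->//] : is_derive (t, p) w (fun q : R^o * V => q.1) w.1.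
  by apply: is_derive_affine => k; rewrite /= addrC.
Qed.

End JointInverse2.

(** * Isotopies *)

Section Isotopy.
Context {R : realType} {V : normedModType R} {FV : frame V}.

(** Times range over the whole line, which gives two-sided derivatives
everywhere and avoids manifolds with boundary. *)
Definition isotopy (F : R -> V -> V) : Prop :=
  smooth (fun q : R^o * V => F q.1 q.2) /\ forall t, is_diffeo (F t).

Lemma isotopy_inv F : isotopy F -> exists2 G, isotopy G &
  forall t, cancel (F t) (G t) /\ cancel (G t) (F t).
Proof.
move=> [sF dF].
have /choice[G HG] t : exists g, is_diffeo g /\ cancel (F t) g /\ cancel g (F t).
  by have [g dg ?] := diffeo_inv (dF t); exists g.
exists G; last by move=> t; have [_] := HG t.
split=> [|t]; last by have [] := HG t.
apply: (joint_inverse sF) => t; have [dg [? ?]] := HG t => //.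
exact: diffeo_smooth.
Qed.

Lemma isotopy_comp F G : isotopy F -> isotopy G -> isotopy (fun t p => F t (G t p)).
Proof.
move=> [sF dF] [sG dG]; split=> [|t]; last exact: diffeo_comp.
apply: (smooth_apply2 (P := R^o)) => //.
by apply: smooth_fst; exact: smooth_id.
Qed.

Lemma isotopy_reparam F (a : R -> R) : isotopy F -> smooth a -> isotopy (fun t => F (a t)).
Proof.
move=> [sF dF] sa; split=> [|t]; last exact: dF.
apply: (smooth_apply2 (P := R^o)) => //.
  by apply: (smooth_comp (g := a)) => //; apply: smooth_fst; exact: smooth_id.
by apply: smooth_snd; exact: smooth_id.
Qed.

Lemma isotopy_cst f : is_diffeo f -> isotopy (fun _ => f).
Proof.
move=> df; split=> //; apply: (smooth_comp (g := f)); first exact: diffeo_smooth.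
by apply: smooth_snd; exact: smooth_id.
Qed.

End Isotopy.

(** * Diffeomorphisms reached by null paths *)

Section NullReach.
Context {R : realType} {n : nat}.
Local Notation V := 'rV[R]_(n + n + 1).
Implicit Types (F G : R -> V -> V) (f g : V -> V) (K : set V).

Lemma alpha0Z (q : V) (a : R) v : alpha0 q (a *: v) = a * alpha0 q v.
Proof.
rewrite /alpha0 /zcoord /ycoord mxE mulrDr mulr_sumr; congr (_ + _).
by apply: eq_bigr => i _; rewrite mxE mulrCA.
Qed.

Lemma alpha0D (q : V) u v : alpha0 q (u + v) = alpha0 q u + alpha0 q v.
Proof.
rewrite /alpha0 /zcoord /ycoord mxE addrACA -big_split/=; congr (_ + _).
by apply: eq_bigr => i _; rewrite mxE mulrDr.
Qed.

Definition velocity F (t : R) (p : V) : V := 'D_1 (fun s : R => F s p) t.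

Definition null F := forall t p, alpha0 (F t p) (velocity F t p) = 0.

(** Paths are constant outside the unit interval, which makes them easy to
concatenate. *)
Definition null_reach K f := exists F, [/\ isotopy F, null F,
  (forall t p, t <= 0 -> F t p = p) /\ (forall t p, 1 <= t -> F t p = f p) &
  forall t p, ~ K p -> F t p = p].

Lemma isotopy_time F p : isotopy F -> smooth (fun s : R => F s p).
Proof.
move=> [sF _]; apply: (smooth_apply2 (P := R^o) (a := id) (b := fun=> p)) => //.
  exact: smooth_id.
exact: smooth_cst.
Qed.

Lemma velocity_near F G t p : {near t, (fun s => F s p) =1 (fun s => G s p)} ->
  velocity F t p = velocity G t p.
Proof. exact: near_eq_derive. Qed.

Lemma velocity_reparam F (a : R -> R) t p : isotopy F -> smooth a ->
  velocity (fun s => F (a s)) t p = 'D_1 a t *: velocity F (a t) p.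
Proof.
move=> iF sa; rewrite /velocity.
rewrite (derive_chain (g := fun s : R => F s p) (f := a))//; last exact: isotopy_time.
rewrite -derive_dirZ ?[_ *: 1]mulr1//; exact: isotopy_time.
Qed.

(** The null condition is local in time, and it survives reparametrization and a
change of the starting point from p to q. *)
Lemma null_near F t p G (a : R -> R) q : isotopy G -> null G -> smooth a ->
  {near t, (fun s => F s p) =1 (fun s => G (a s) q)} ->
  alpha0 (F t p) (velocity F t p) = 0.
Proof.
move=> iG nG sa FG; have -> : F t p = G (a t) q by exact: (nbhs_singleton FG).
have -> : velocity F t p = velocity (fun s => G (a s)) t q by exact: near_eq_derive FG.
by rewrite velocity_reparam// alpha0Z nG mulr0.
Qed.

(** The two motions take place from 0 to 1/3 and from 2/3 to 1, so that near any
time at most one of them is in progress. *)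
Definition step1of2 (t : R) : R := step (3 * t).
Definition step2of2 (t : R) : R := step (3 * t - 2).

Lemma smooth_step1of2 : smooth step1of2.
Proof.
apply: (smooth_comp (g := step) (f := fun t : R => 3 * t)); first exact: smooth_step.
by apply: smoothM; [exact: smooth_cst|exact: smooth_id].
Qed.

Lemma smooth_step2of2 : smooth step2of2.
Proof.
apply: (smooth_comp (g := step) (f := fun t : R => 3 * t - 2)); first exact: smooth_step.
apply: smoothB; last exact: smooth_cst.
by apply: smoothM; [exact: smooth_cst|exact: smooth_id].
Qed.

(** Before the time 1/2 only G can move, and from then on only F. *)
Lemma null_concat F G g : isotopy F -> isotopy G -> null F -> null G ->
  (forall p, F 0 p = p) -> (forall p, G 1 p = g p) ->
  null (fun t p => F (step2of2 t) (G (step1of2 t) p)).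
Proof.
move=> iF iG nF nG F0 G1 t p; have [t2|t2] := ltP t (1 / 2).
  apply: (null_near (G := G) (a := step1of2) (q := p) iG nG smooth_step1of2).
  near=> s; rewrite /step2of2 step0 ?F0//.
  have : s < 1 / 2 by near: s; exact: lt_nbhsl.
  by lra.
apply: (null_near (G := F) (a := step2of2) (q := g p) iF nF smooth_step2of2).
near=> s; rewrite [step1of2 s]step1 ?G1//.
have : 1 / 3 < s by near: s; apply: lt_nbhsr; lra.
by lra.
Unshelve. all: by end_near. Qed.

Lemma isotopy_concat F G : isotopy F -> isotopy G ->
  isotopy (fun t p => F (step2of2 t) (G (step1of2 t) p)).
Proof.
move=> iF iG.
exact: (isotopy_comp (isotopy_reparam iF smooth_step2of2) (isotopy_reparam iG smooth_step1of2)).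
Qed.

Lemma null_reach_comp K f g : null_reach K f -> null_reach K g ->
  null_reach K (fun p => f (g p)).
Proof.
move=> [F [iF nF [F0 F1] FK]] [G [iG nG [G0 G1] GK]].
exists (fun t p => F (step2of2 t) (G (step1of2 t) p)); split.
- exact: (isotopy_concat iF iG).
- exact: (null_concat iF iG nF nG (fun p => F0 0 p (lexx 0)) (fun p => G1 1 p (lexx 1))).
- split=> t p t0.
    by rewrite /step2of2 /step1of2 !step0 ?G0 ?F0//; lra.
  by rewrite /step2of2 /step1of2 !step1 ?G1 ?F1//; lra.
- by move=> t p Kp; rewrite GK// FK.
Qed.

Lemma null_reach_ext K f g : (forall p, f p = g p) -> null_reach K f -> null_reach K g.
Proof. by move=> /funext ->. Qed.

Lemma null_reach_diffeo K f : null_reach K f -> is_diffeo f.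
Proof.
move=> [F [[_ dF] _ [_ F1] _]]; apply: diffeo_ext (dF 1) => p; exact: F1.
Qed.

Lemma null_reach_fix K f p : null_reach K f -> ~ K p -> f p = p.
Proof. by move=> [F [_ _ [_ F1] FK]] Kp; rewrite -(F1 1)// FK. Qed.

Lemma null_reach_sub K K' f : K `<=` K' -> null_reach K f -> null_reach K' f.
Proof.
by move=> KK [F [iF nF F01 FK]]; exists F; split=> // t p Kp; apply: FK => /KK.
Qed.

Lemma null_reach_id K : null_reach K (fun p => p).
Proof.
exists (fun _ p => p); split=> //; first by apply: isotopy_cst; exact: diffeo_id.
move=> t p; rewrite /velocity (derive_cst p).
by have := alpha0Z p 0 0; rewrite scale0r mul0r.
Qed.

(** The path is run backwards, starting from its end. *)
Lemma null_reach_inv K f g : cancel f g -> cancel g f -> null_reach K f -> null_reach K g.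
Proof.
move=> fg gf Nf; have df := null_reach_diffeo Nf.
have gK p : ~ K p -> g p = p by move=> Kp; rewrite -{1}(null_reach_fix Nf Kp).
have dg : is_diffeo g.
  have [h dh [fh hf]] := diffeo_inv df.
  by apply: diffeo_ext dh => p; apply: (can_inj fg); rewrite hf gf.
case: Nf => F [iF nF [F0 F1] FK].
have s1 : smooth (fun t : R => 1 - t) by apply: smoothB; [exact: smooth_cst|exact: smooth_id].
exists (fun t p => F (1 - t) (g p)); split.
- by apply: (isotopy_comp (isotopy_reparam iF s1) (isotopy_cst dg)).
- move=> t p; apply: (null_near (G := F) (a := fun t => 1 - t) (q := g p)) => //.
  by near=> s.
- split=> t p t0; first by rewrite F1 ?gf//; lra.
  by rewrite F0//; lra.
- by move=> t p Kp; rewrite gK// FK.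
Unshelve. all: by end_near. Qed.

End NullReach.

(** * Slopes of shears with compact support *)

Section LineShear.
Context {R : realType} {V : normedModType R} {FV : frame V}.
Variables (E : V -> V) (b : V -> R).
Hypothesis sE : smooth E.
Hypothesis EE : forall p (s : R), E (p + s *: E p) = E p.
Hypothesis E0 : forall p, E p != 0.
Hypothesis sb : smooth b.

(** Along each line the displacement vanishes far away, where the derivative is 1,
and a diffeomorphism has no critical point: by continuity the derivative stays
positive. *)
Lemma shear_slope_gt0 K : compact K -> (forall p, ~ K p -> b p = 0) ->
  is_diffeo (fun p => p + b p *: E p) -> forall p, 0 < 1 + 'D_(E p) b p.
Proof.
move=> cK bK [sS [T [sT ST TS]]] p.
have DE q : 'D_(E q) E q = 0.
  have [_ ->//] : is_derive q (E q) E 0.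
  by apply: is_derive_affine => k; rewrite scaler0 addr0 addrC EE.
have nz q : 1 + 'D_(E q) b q != 0.
  apply/eqP => D0.
  have : 'D_(E q) (fun p => T (p + b p *: E p)) q = E q.
    by rewrite (_ : (fun p => _) = id) ?derive_id//; apply/funext => y; rewrite ST.
  rewrite (derive_chain (g := T) (f := fun p => p + b p *: E p))//.
  have -> : 'D_(E q) (fun p => p + b p *: E p) q = 0.
    have d1 : derivable (fun p : V => p) q (E q) by exact: derivable_id.
    have d2 := is_derive_scale (smooth_derivable (x := q) (v := E q) sb)
      (smooth_derivable (x := q) (v := E q) sE).
    have cE : {for q, continuous E} by exact: smooth_continuous.
    have [d3 d4] := d2 cE.
    etransitivity; first exact: (deriveD d1 d3).
    by rewrite d4 derive_id DE scaler0 add0r -{1}[E q]scale1r -scalerDl D0 scale0r.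
  by rewrite derive0 => /esym/eqP; rewrite (negPf (E0 q)).
pose u (s : R) := 1 + 'D_(E p) b (s *: E p + p).
have cu : continuous u.
  apply: smooth_continuous; apply: smoothD; first exact: smooth_cst.
  apply: (smooth_comp (g := 'D_(E p) b) (f := fun s : R => s *: E p + p)); first exact: smooth_derive.
  by apply: smoothD; [apply: smoothZ; [exact: smooth_id|exact: smooth_cst]|exact: smooth_cst].
have u0 s : u s != 0.
  by have := nz (p + s *: E p); rewrite EE [p + _]addrC.
have [M [_ HM]] := compact_bounded cK.
pose r := 1 + `|M|.
have Kr y : K y -> `|y| <= r.
  by move=> Ky; apply: (HM r) => //; rewrite /r ltr_pwDl// ler_norm.
have r0 : 0 < r by rewrite /r ltr_pwDl.
pose s1 := (r + `|p| + 1) / `|E p|.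
have us1 : u s1 = 1.
  rewrite /u; suff -> : 'D_(E p) b (s1 *: E p + p) = 0 by rewrite addr0.
  have oU : open (~` K) by apply: closed_openC; apply: compact_closed => //; exact: norm_hausdorff.
  have Ux : (~` K) (s1 *: E p + p).
    move=> /Kr; apply/negP; rewrite -ltNge.
    have : `|s1 *: E p| <= `|s1 *: E p + p| + `|p|.
      by rewrite -[X in `|X| <= _](addrK p) ler_normB.
    rewrite normrZ /s1 normrM normfV normr_id divfK ?normr_eq0//.
    have r1 : 0 <= r + `|p| + 1 by rewrite addr_ge0// addr_ge0// ltW.
    by rewrite ger0_norm//; lra.
  rewrite (near_eq_derive (g := cst 0)) ?derive_cst//.
  exact: (open_near (P := fun y => b y = 0) oU Ux bK).
have s10 : 0 <= s1 by rewrite divr_ge0// addr_ge0// addr_ge0// ltW.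
have -> : 1 + 'D_(E p) b p = u 0 by rewrite /u scale0r add0r.
rewrite ltNge; apply/negP => ule.
have [||s _ us] := @IVT _ u 0 s1 0 s10.
- exact: continuous_subspaceT.
- by rewrite us1 ge_min le_max ule ler01 orbT.
by have := u0 s; rewrite us eqxx.
Qed.

End LineShear.

(** * Families close to the identity *)

Section SmallFamily.
Context {R : realType} {V : normedModType R} {FV : frame V}.

Lemma continuous_compact_bound (h : V -> R) K : compact K -> continuous h ->
  (forall p, ~ K p -> h p = 0) -> exists M, forall p, `|h p| <= M.
Proof.
move=> cK ch hK.
have [M [_ HM]] := compact_bounded (continuous_compact (continuous_subspaceT ch) cK).
exists (1 + `|M|) => p; have [Kp|/hK ->] := pselect (K p); last by rewrite normr0 addr_ge0.
by apply: (HM (1 + `|M|)); [rewrite ltr_pwDl// ler_norm|exists p].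
Qed.

(** The values and derivatives of H q tend to those of H q0 = 0 as q tends
to q0, by joint continuity. *)
Lemma small_family (Q : normedModType R) (FQ : frame Q) (H : Q -> V -> V) (q0 : Q) (K : set V) :
  compact K -> smooth (fun x : Q * V => H x.1 x.2) ->
  (forall p, H q0 p = 0) -> (forall q p, ~ K p -> H q p = 0) ->
  \forall q \near q0, is_diffeo (fun p => p + H q p).
Proof.
move=> cK sH H0 HK; apply: (small_diffeo (K := K)) => //.
  apply: nearW => q; apply: (smooth_apply2 (F := H) (a := fun=> q) (b := id)) => //.
    exact: smooth_cst.
  exact: smooth_id.
move=> eta p eta0 Kp.
have near_small (W : normedModType R) (u : Q * V -> W) : continuous u ->
    u (q0, p) = 0 -> \forall p' \near p & q \near q0, `|u (q, p')| <= eta.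
  move=> cu u0.
  have L : (fun x : V * Q => u (x.2, x.1)) x @[x --> (p, q0)] --> (0 : W).
    rewrite -u0.
    apply: (@continuous_comp (V * Q)%type (Q * V)%type W (fun x => (x.2, x.1)) u (p, q0)); last exact: cu.
    by apply: (@cvg_pair _ _ _ _ (nbhs _) (nbhs _)); [exact: cvg_snd|exact: cvg_fst].
  by move/cvgr0_norm_le : L; apply.
have D j (q : Q) p' : 'D_(fvec j) (H q) p' = 'D_((0, fvec j) : Q * V) (fun x : Q * V => H x.1 x.2) (q, p').
  have sp : smooth (fun p : V => (q, p) : Q * V).
    by apply: smooth_pair; [exact: smooth_cst|exact: smooth_id].
  rewrite -[LHS]/('D_(fvec j) (fun p : V => (fun x : Q * V => H x.1 x.2) (q, p)) p').
  rewrite (derive_chain (g := fun x : Q * V => H x.1 x.2) (f := fun p : V => (q, p) : Q * V))//.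
  have [_ ->//] : is_derive p' (fvec j) (fun p : V => (q, p) : Q * V) (0, fvec j).
  by apply: is_derive_affine => k; congr pair; rewrite /= ?scaler0 ?addr0// addrC.
have N1 : \forall p' \near p & q \near q0, `|H q p'| <= eta.
  by apply: (near_small V (fun x => H x.1 x.2)); [exact: smooth_continuous|exact: H0].
have N2 (j : 'I_(@fdim _ _ FV)) : \forall p' \near p & q \near q0, `|'D_(fvec j) (H q) p'| <= eta.
  have := near_small V ('D_((0, fvec j) : Q * V) (fun x : Q * V => H x.1 x.2)).
  rewrite -D; set c := continuous _ => HH.
  have cc : c by exact: (smooth_continuous (smooth_derive _ sH)).
  have e0 : 'D_(fvec j) (H q0) p = 0.
    by rewrite (_ : H q0 = cst 0) ?derive_cst//; apply/funext => y; rewrite H0.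
  by apply: filterS (HH cc e0) => -[p' q] /=; rewrite D.
have N2' : \forall x \near filter_prod (nbhs p) (nbhs q0), forall (j : 'I_(@fdim _ _ FV)), `|'D_(fvec j) (H x.2) x.1| <= eta.
  apply: (@filter_forall _ _ (fun (j : 'I_(@fdim _ _ FV)) (x : V * Q) => `|'D_(fvec j) (H x.2) x.1| <= eta)) => j.
  exact: N2.
exact: filterI N1 N2'.
Qed.

End SmallFamily.

(** * The contact form and its null fields *)

Section Geometry.
Context {R : realType} {n : nat}.
Local Notation V := 'rV[R]_(n + n + 1).

Definition ex (i : 'I_n) : V := delta_mx 0 (lshift 1 (lshift n i)).
Definition ey (i : 'I_n) : V := delta_mx 0 (lshift 1 (rshift n i)).
Definition ez : V := delta_mx 0 (rshift (n + n) ord0).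

(** Together with the d/dx_i, these legendrian fields span xi_0. *)
Definition Yf (i : 'I_n) (p : V) : V := ey i - xcoord p i *: ez.

Lemma xcoordD (p q : V) i : xcoord (p + q) i = xcoord p i + xcoord q i.
Proof. by rewrite /xcoord mxE. Qed.
Lemma xcoordZ (a : R) (p : V) i : xcoord (a *: p) i = a * xcoord p i.
Proof. by rewrite /xcoord mxE. Qed.
Lemma ycoordD (p q : V) i : ycoord (p + q) i = ycoord p i + ycoord q i.
Proof. by rewrite /ycoord mxE. Qed.
Lemma ycoordZ (a : R) (p : V) i : ycoord (a *: p) i = a * ycoord p i.
Proof. by rewrite /ycoord mxE. Qed.

Lemma xcoord_ex i j : xcoord (ex i) j = (i == j)%:R.
Proof. by rewrite /xcoord mxE eqxx/= (inj_eq (@lshift_inj _ _)) (inj_eq (@lshift_inj _ _)) eq_sym. Qed.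
Lemma xcoord_ey i j : xcoord (ey i) j = 0.
Proof. by rewrite /xcoord mxE (inj_eq (@lshift_inj _ _)) eq_lrshift. Qed.
Lemma xcoord_ez j : xcoord ez j = 0.
Proof. by rewrite /xcoord mxE eq_lrshift. Qed.
Lemma ycoord_ex i j : ycoord (ex i) j = 0.
Proof. by rewrite /ycoord mxE (inj_eq (@lshift_inj _ _)) eq_rlshift. Qed.
Lemma ycoord_ey i j : ycoord (ey i) j = (i == j)%:R.
Proof. by rewrite /ycoord mxE eqxx/= (inj_eq (@lshift_inj _ _)) (inj_eq (@rshift_inj _ _)) eq_sym. Qed.
Lemma ycoord_ez j : ycoord ez j = 0.
Proof. by rewrite /ycoord mxE eq_lrshift. Qed.
Lemma zcoord_ex i : zcoord (ex i) = 0.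
Proof. by rewrite /zcoord mxE eq_rlshift. Qed.
Lemma zcoord_ey i : zcoord (ey i) = 0.
Proof. by rewrite /zcoord mxE eq_rlshift. Qed.
Lemma zcoord_ez : zcoord ez = 1.
Proof. by rewrite /zcoord mxE !eqxx. Qed.

Lemma coordE (p : V) : p = \sum_i xcoord p i *: ex i + \sum_i ycoord p i *: ey i + zcoord p *: ez.
Proof. by rewrite {1}[p]row_sum_delta big_split_ord big_split_ord big_ord1. Qed.

Lemma smooth_xcoord i : smooth (fun p : V => xcoord p i).
Proof. by apply: smooth_coord; exact: smooth_id. Qed.
Lemma smooth_Yf i : smooth (Yf i).
Proof.
apply: smoothB; first exact: smooth_cst.
by apply: smoothZ; [exact: smooth_xcoord|exact: smooth_cst].
Qed.

Lemma xcoord_Yf i p j : xcoord (Yf i p) j = 0.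
Proof. by rewrite xcoordD -scaleNr xcoordZ xcoord_ez mulr0 addr0 xcoord_ey. Qed.

Lemma Yf_eq i p q : xcoord p i = xcoord q i -> Yf i p = Yf i q.
Proof. by rewrite /Yf => ->. Qed.

Lemma alpha0_ex q i : alpha0 q (ex i) = 0.
Proof. by rewrite /alpha0 zcoord_ex big1 ?addr0// => j _; rewrite ycoord_ex mulr0. Qed.

Lemma alpha0_ez q : alpha0 q ez = 1.
Proof. by rewrite /alpha0 zcoord_ez big1 ?addr0// => j _; rewrite ycoord_ez mulr0. Qed.

Lemma alpha0_ey q i : alpha0 q (ey i) = xcoord q i.
Proof.
rewrite /alpha0 zcoord_ey add0r (bigD1 i)//= ycoord_ey eqxx mulr1 big1 ?addr0// => j ji.
by rewrite ycoord_ey eq_sym (negPf ji) mulr0.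
Qed.

Lemma alpha0_Yf q i : alpha0 q (Yf i q) = 0.
Proof. by rewrite alpha0D -scaleNr alpha0Z alpha0_ez alpha0_ey mulr1 subrr. Qed.

Lemma ex_neq0 i : ex i != 0.
Proof.
apply/eqP => /(congr1 (fun p => xcoord p i)); rewrite xcoord_ex eqxx /xcoord mxE.
by move/eqP; rewrite oner_eq0.
Qed.

Lemma Yf_neq0 i p : Yf i p != 0.
Proof.
apply/eqP => /(congr1 (fun p => ycoord p i)).
rewrite ycoordD -scaleNr ycoordZ ycoord_ez mulr0 addr0 ycoord_ey eqxx /ycoord mxE.
by move/eqP; rewrite oner_eq0.
Qed.

(** The orbits are straight lines tangent to the contact structure, so a flow or a
shear along the field is explicit and null. *)
Definition null_field (E : V -> V) := [/\ smooth E,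
  (forall (p : V) (s : R), E (p + s *: E p) = E p), (forall p, E p != 0) &
  forall p, alpha0 p (E p) = 0].

Lemma null_field_ex i : null_field (fun _ => ex i).
Proof.
split=> // [|p|p]; [exact: smooth_cst|exact: ex_neq0|exact: alpha0_ex].
Qed.

Lemma null_field_Yf i : null_field (Yf i).
Proof.
split=> [|p s|p|p]; [exact: smooth_Yf| |exact: Yf_neq0|exact: alpha0_Yf].
by apply: Yf_eq; rewrite xcoordD xcoordZ xcoord_Yf mulr0 addr0.
Qed.

(** The displacement is multiplied by a function of time that increases from 0
to 1.  At intermediate times the slope is a convex combination of 1 and the final
slope, which is positive by [shear_slope_gt0]; so all times give diffeomorphisms.
A point moves along an orbit of E, hence tangentially to the contact structure. *)
Lemma null_reach_shear (K : set V) (E : V -> V) (b : V -> R) : null_field E -> compact K ->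
  smooth b -> (forall p, ~ K p -> b p = 0) ->
  is_diffeo (fun p : V => p + b p *: E p) -> null_reach K (fun p => p + b p *: E p).
Proof.
move=> [sE EE E0 aE] cK sb bK dS.
have slope (p : V) : 0 < 1 + 'D_(E p) b p by exact: (shear_slope_gt0 sE EE E0 sb cK bK dS).
have [M bM] := continuous_compact_bound cK (smooth_continuous sb) bK.
have sstep : smooth (fun q : R^o * V => step (q.1 : R)).
  apply: (smooth_comp (g := step) (f := fun q : R^o * V => q.1)); first exact: smooth_step.
  by apply: smooth_fst; exact: smooth_id.
have ssnd : smooth (fun q : R^o * V => q.2) by apply: smooth_snd; exact: smooth_id.
have iF : isotopy (fun t p => p + (step t * b p) *: E p).
  split.
    apply: (smoothD (f := fun q : R^o * V => q.2)
        (g := fun q : R^o * V => (step q.1 * b q.2) *: E q.2) ssnd).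
    apply: smoothZ; last exact: (smooth_comp (g := E) sE ssnd).
    exact: (smoothM sstep (smooth_comp (g := b) sb ssnd)).
  move=> t; apply: (@shear_diffeo _ _ _ E (fun p => step t * b p) sE EE _ M).
  - by apply: (smoothM _ sb); exact: smooth_cst.
  - move=> p; rewrite normrM ger0_norm ?step_ge0// (le_trans _ (bM p))//.
    by rewrite ler_piMl// step_le1.
  - move=> p; have -> : 'D_(E p) (fun p => step t * b p) p = step t * 'D_(E p) b p.
      exact: (deriveZ (step t) (smooth_derivable (x := p) (v := E p) sb)).
    have := slope p; have := step_ge0 t; have := step_le1 t.
    set s := step t; set d := 'D_ _ _ _ => s1 s0 d1.
    have [d0|d0] := leP 0 d; first by rewrite ltr_pwDl// mulr_ge0.
    have : d <= s * d by rewrite -[leLHS]mul1r ler_wnM2r// ltW.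
    by lra.
exists (fun t p => p + (step t * b p) *: E p); split=> //.
- move=> t p; have -> : velocity (fun t p => p + (step t * b p) *: E p) t p =
      ('D_1 step t * b p) *: E p.
    rewrite /velocity.
    pose g (s : R) : V := p + (s * b p) *: E p.
    have sg : smooth g.
      apply: smoothD; first exact: smooth_cst.
      apply: smoothZ; last exact: smooth_cst.
      by apply: smoothM; [exact: smooth_id|exact: smooth_cst].
    rewrite -[LHS]/('D_1 (fun s => g (step s)) t) (derive_chain t 1 sg smooth_step).
    set d := 'D_1 step t.
    have [_ ->//] : is_derive (step t) d g ((d * b p) *: E p).
    apply: is_derive_affine => h; rewrite /g -addrA scalerA -scalerDl mulrA -mulrDl.
    by rewrite [h *: d + _]addrC.
  rewrite -[X in alpha0 _ (_ *: X)](EE p (step t * b p)) alpha0Z aE mulr0//.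
- split=> t p t0; first by rewrite step0// mul0r scale0r addr0.
  by rewrite step1// mul1r.
- by move=> t p Kp; rewrite bK// mulr0 scale0r addr0.
Qed.

End Geometry.

(** * Shears along z *)

Section Reach.
Context {R : realType} {n : nat}.
Local Notation V := 'rV[R]_(n + n + 1).

Lemma fixed_off_stable (T : Type) (K : set T) (s : T -> T) p : injective s ->
  (forall q, ~ K q -> s q = q) -> K p -> K (s p).
Proof.
move=> inj fix_ Kp; apply: contrapT => Ks.
by have /inj sp := fix_ _ Ks; apply: Ks; rewrite sp.
Qed.

(** Writing the displacement as a function of g p instead of p, the last map is a
shear after g. *)
Lemma null_reach_shear_step (K K' : set V) (g : V -> V) (a : V -> R) (E : V -> V) :
  null_field E -> compact K -> K `<=` K' -> smooth a ->
  (forall p, ~ K p -> a p = 0) -> (forall p, ~ K p -> g p = p) ->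
  is_diffeo (fun p => g p + a p *: E (g p)) ->
  null_reach K' g -> null_reach K' (fun p => g p + a p *: E (g p)).
Proof.
move=> nE cK KK sa aK gK dg' Ng.
have dg := null_reach_diffeo Ng.
have [h dh [gh hg]] := diffeo_inv dg.
have sb : smooth (fun q => a (h q)) by exact: (smooth_comp sa (diffeo_smooth dh)).
have hK p : ~ K p -> h p = p by move=> Kp; rewrite -{1}(gK p Kp) gh.
have S : null_reach K (fun q => q + a (h q) *: E q).
  apply: (null_reach_shear nE cK sb) => [q Kq|]; first by rewrite hK// aK.
  apply: (diffeo_quotient (g := g)) => //.
  by apply: diffeo_ext dg' => p; rewrite gh.
apply: (null_reach_ext (f := fun p => g p + a (h (g p)) *: E (g p))) => [p|]; first by rewrite gh.
exact: null_reach_comp (null_reach_sub KK S) Ng.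
Qed.

Section ZShear.
Variables (i : 'I_n) (K K' : set V) (chi b : V -> R) (c : R).
Hypothesis cK : compact K.
Hypothesis cK' : compact K'.
Hypothesis KK : K `<=` K'.
Hypothesis schi : smooth chi.
Hypothesis chi1 : forall p, K p -> chi p = 1.
Hypothesis chi0 : forall p, ~ K' p -> chi p = 0.
Hypothesis c0 : c != 0.
Hypothesis sb : smooth b.
Hypothesis bK : forall p, ~ K p -> b p = 0.
Hypothesis ds : is_diffeo (fun p : V => p + b p *: ez).
Hypothesis ds1 : is_diffeo (fun p : V => p + (b p / c) *: Yf i p).
Hypothesis dphi : is_diffeo (fun p : V => p + (c * chi p) *: ex i).

(** Where chi = 1, conjugating by the translation phi turns the field Y into
Y - c d/dz, so that flowing b/c along Y and then back along the conjugate field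
moves b along d/dz.  The backward flow is the shear tau; that it is a
diffeomorphism follows from the identity tau phi s1 = phi s. *)
Lemma null_reach_zshear : null_reach K' (fun p : V => p + b p *: ez).
Proof.
pose s p : V := p + b p *: ez.
pose s1 p : V := p + (b p / c) *: Yf i p.
pose phi p : V := p + (c * chi p) *: ex i.
have sbc : smooth (fun p => b p / c).
  exact: (smoothM sb (@smooth_cst _ _ _ c^-1)).
have Ns1 : null_reach K' s1.
  apply: (null_reach_sub KK); apply: (null_reach_shear (null_field_Yf i) cK sbc); last exact: ds1.
  by move=> p Kp; rewrite bK// mul0r.
have Nphi : null_reach K' phi.
  apply: (null_reach_shear (b := fun p => c * chi p) (null_field_ex i) cK'); last exact: dphi.
    exact: (smoothM (@smooth_cst _ _ _ c) schi).
  by move=> p Kp; rewrite chi0// mulr0.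
have [s1' ds1' [s1K s1'K]] := diffeo_inv ds1.
have [phi' dphi' [phiK phi'K]] := diffeo_inv dphi.
have s1off p : ~ K p -> s1 p = p by move=> Kp; rewrite /s1 bK// mul0r scale0r addr0.
have soff p : ~ K p -> s p = p by move=> Kp; rewrite /s bK// scale0r addr0.
have phioff p : ~ K' p -> phi p = p by move=> Kp; rewrite /phi chi0// mulr0 scale0r addr0.
have s1'off p : ~ K p -> s1' p = p by move=> Kp; rewrite -{1}(s1off p Kp) s1K.
have phi'off p : ~ K' p -> phi' p = p by move=> Kp; rewrite -{1}(phioff p Kp) phiK.
pose beta r := - (b (s1' (phi' r)) / c).
have sbeta : smooth beta.
  apply: smoothN; exact: (smooth_comp sbc (smooth_comp (diffeo_smooth ds1') (diffeo_smooth dphi'))).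
have betaoff r : ~ K' r -> beta r = 0.
  move=> Kr; have K1 : ~ K r by move=> /KK.
  by rewrite /beta phi'off// s1'off// bK// mul0r oppr0.
pose tau r := r + beta r *: Yf i r.
have tauE p : tau (phi (s1 p)) = phi (s p).
  rewrite /tau /beta phiK s1K.
  have [Kp|Kp] := pselect (K p); last first.
    by rewrite bK// mul0r oppr0 scale0r addr0 soff// s1off.
  have Ks1 : K (s1 p) by apply: fixed_off_stable => //; exact: can_inj s1K.
  have Ks : K (s p).
    by apply: fixed_off_stable => //; have [s' _ [sK _]] := diffeo_inv ds; exact: can_inj sK.
  have YE : Yf i (phi (s1 p)) = Yf i p - c *: ez.
    have xs1 : xcoord (s1 p) i = xcoord p i by rewrite xcoordD xcoordZ xcoord_Yf mulr0 addr0.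
    have xphi : xcoord (phi (s1 p)) i = xcoord p i + c.
      by rewrite xcoordD xcoordZ xcoord_ex eqxx mulr1 chi1// mulr1 xs1.
    by rewrite /Yf xphi scalerDl opprD addrA.
  have E : (b p / c) *: (Yf i p - c *: ez) = (b p / c) *: Yf i p - b p *: ez.
    by rewrite scalerBr scalerA divfK.
  rewrite YE scaleNr E opprB /phi !chi1// /s1 /s.
  move: (_ *: ex i) (_ *: Yf _ _) (_ *: ez) => x y z.
  by rewrite (addrAC p y x) addrA addrAC addrK addrAC.
have dtau : is_diffeo tau.
  apply: (diffeo_quotient (g := fun p => phi (s1 p))); first exact: (diffeo_comp dphi ds1).
  by apply: diffeo_ext (diffeo_comp dphi ds) => p; exact: (esym (tauE p)).
have Ntau : null_reach K' tau by exact: (null_reach_shear (null_field_Yf i) cK' sbeta betaoff dtau).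
apply: (null_reach_ext (f := fun p => phi' (tau (phi (s1 p))))) => [p|].
  by rewrite tauE phiK.
apply: (null_reach_comp (f := phi')); first exact: (null_reach_inv phiK phi'K Nphi).
apply: (null_reach_comp (f := tau)); first exact: Ntau.
exact: (null_reach_comp Nphi Ns1).
Qed.

End ZShear.
End Reach.

(** * Compactly supported isotopies *)

(** The real line is connected. *)
Lemma locally_constant (R : realType) (P : R -> Prop) :
  (forall t0, \forall t \near t0, P t <-> P t0) -> P 0 -> P 1.
Proof.
move=> H P0.
have /connected_intervalP cT : is_interval [set: R] by [].
suff : [set t | P t] = setT by move/seteqP => [_]; apply.
apply: cT; first by exists 0.
  exists [set t | P t]; last by rewrite setTI.
  rewrite openE => t /= Pt; rewrite /interior.
  by have := H t; apply: filterS => s [_]; apply.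
exists [set t | P t]; last by rewrite setTI.
rewrite -[X in closed X]setCK; apply: open_closedC.
rewrite openE => t /= Pt; rewrite /interior.
by have := H t; apply: filterS => s [+ _] Ps; apply: contra_not Pt; exact.
Qed.

Section NullFamily.
Context {R : realType} {n : nat}.
Local Notation V := 'rV[R]_(n + n + 1).
Variables (i0 : 'I_n) (K K' : set V) (chi : V -> R).
Hypothesis cK : compact K.
Hypothesis cK' : compact K'.
Hypothesis KK : K `<=` K'.
Hypothesis schi : smooth chi.
Hypothesis chi1 : forall p, K p -> chi p = 1.
Hypothesis chi0 : forall p, ~ K' p -> chi p = 0.

Let sfst : smooth (fun q : R^o * V => q.1).
Proof. exact: (smooth_fst (@smooth_id R (R^o * V)%type)). Qed.
Let ssnd : smooth (fun q : R^o * V => q.2).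
Proof. exact: (smooth_snd (@smooth_id R (R^o * V)%type)). Qed.

(** The length c has to be small for the cut-off translation to be injective. *)
Lemma translation_diffeo : exists2 c : R, c != 0 & is_diffeo (fun p : V => p + (c * chi p) *: ex i0).
Proof.
have H : \forall c \near (0 : R^o), is_diffeo (fun p : V => p + (c * chi p) *: ex i0).
  apply: (@small_family R V _ R^o _ (fun c p => (c * chi p) *: ex i0) 0 K' cK').
  - apply: smoothZ; last exact: smooth_cst.
    exact: (smoothM sfst (smooth_comp schi ssnd)).
  - by move=> p; rewrite mul0r scale0r.
  - by move=> c p Kp; rewrite chi0// mulr0 scale0r.
have [c [c0 dc]] : exists c : R, c != 0 /\ is_diffeo (fun p : V => p + (c * chi p) *: ex i0).
  apply: (@filter_ex _ ((0 : R)^')); near=> c; split.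
    by near: c; exact: nbhs_dnbhs_neq.
  by near: c; rewrite near_withinE; apply: filterS H.
by exists c.
Unshelve. all: by end_near. Qed.

Variables (F : R -> V -> V) (t0 : R).
Hypothesis iF : isotopy F.
Hypothesis FK : forall t p, ~ K p -> F t p = p.
Hypothesis F0 : forall p, F t0 p = p.

(** The displacement h is expanded in the frame d/dx_i, Y_i, d/dz at the point p,
in which the last coordinate is c = alpha_0(h).  Hy j and Hx j keep the first
terms of this expansion, the Y_i preceding the d/dx_i. *)
Let h t p := F t p - p.
Let hx (i : 'I_n) t p := xcoord (h t p) i.
Let hy (i : 'I_n) t p := ycoord (h t p) i.
Let c t p := zcoord (h t p) + \sum_(i < n) xcoord p i * hy i t p.
Let Hy (j : nat) t p := \sum_(i < n) (if (i < j)%N then hy i t p *: Yf i p else 0).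
Let Hx (j : nat) t p := Hy n t p + \sum_(i < n) (if (i < j)%N then hx i t p *: ex i else 0).

Let h0 p : h t0 p = 0. Proof. by rewrite /h F0 subrr. Qed.
Let hK t p : ~ K p -> h t p = 0. Proof. by move=> Kp; rewrite /h FK// subrr. Qed.

Let coord0 t p : h t p = 0 -> [/\ forall i, hx i t p = 0, forall i, hy i t p = 0,
  c t p = 0, forall j, Hy j t p = 0 & forall j, Hx j t p = 0].
Proof.
move=> h0'.
have x0 i : hx i t p = 0 by rewrite /hx h0' /xcoord mxE.
have y0 i : hy i t p = 0 by rewrite /hy h0' /ycoord mxE.
have Hy0 j : Hy j t p = 0.
  by rewrite /Hy big1// => i _; rewrite y0 scale0r; case: ifP.
split=> //.
  by rewrite /c h0' /zcoord mxE add0r big1// => i _; rewrite y0 mulr0.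
by move=> j; rewrite /Hx Hy0 add0r big1// => i _; rewrite x0 scale0r; case: ifP.
Qed.

Let sh : smooth (fun q : R^o * V => h q.1 q.2).
Proof. exact: (smoothB iF.1 ssnd). Qed.
Let shx i : smooth (fun q : R^o * V => hx i q.1 q.2).
Proof. exact: (smooth_coord _ sh). Qed.
Let shy i : smooth (fun q : R^o * V => hy i q.1 q.2).
Proof. exact: (smooth_coord _ sh). Qed.
Let sc : smooth (fun q : R^o * V => c q.1 q.2).
Proof.
apply: smoothD; first exact: (smooth_coord _ sh).
apply: smooth_sum => i.
exact: (smoothM (smooth_comp (smooth_xcoord i) ssnd) (shy i)).
Qed.
Let sHy j : smooth (fun q : R^o * V => Hy j q.1 q.2).
Proof.
apply: smooth_sum => i; case: (i < j)%N; last exact: smooth_cst.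
exact: (smoothZ (shy i) (smooth_comp (smooth_Yf i) ssnd)).
Qed.
Let sHx j : smooth (fun q : R^o * V => Hx j q.1 q.2).
Proof.
apply: (smoothD (sHy n)).
apply: smooth_sum => i; case: (i < j)%N; last exact: smooth_cst.
exact: (smoothZ (shx i) (@smooth_cst _ _ _ (ex i))).
Qed.

Let x_Hy j t p i : xcoord (p + Hy j t p) i = xcoord p i.
Proof.
rewrite xcoordD /Hy /xcoord summxE big1 ?addr0// => k _.
case: ifP => _; last by rewrite mxE.
by rewrite -[LHS]/(xcoord (hy k t p *: Yf k p) i) xcoordZ xcoord_Yf mulr0.
Qed.

Let FE t p : F t p = (p + Hx n t p) + c t p *: ez.
Proof.
have -> : F t p = p + h t p by rewrite /h subrKC.
rewrite -addrA; congr (_ + _); rewrite {1}(coordE (h t p)) /Hx.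
rewrite [X in _ = _ + X + _](eq_bigr (fun i => hx i t p *: ex i)) => [|i _]; last by rewrite ltn_ord.
have -> : Hy n t p = \sum_(i < n) hy i t p *: ey i - (\sum_(i < n) xcoord p i * hy i t p) *: ez.
  rewrite scaler_suml -sumrB /Hy; apply: eq_bigr => i _; rewrite ltn_ord /Yf scalerBr scalerA.
  by rewrite [xcoord _ _ * _]mulrC.
pose a := \sum_(i < n) hx i t p *: ex i; pose b := \sum_(i < n) hy i t p *: ey i.
rewrite -[LHS]/(a + b + zcoord (h t p) *: ez) -/a -/b /c scalerDl.
move: (zcoord _ *: _) ((\sum_(i < n) _) *: ez) => d e.
by rewrite (addrAC b) (addrC d) addrA subrK (addrC b).
Qed.

(** Order of the elementary moves: the fields Y_i first, while the x-coordinates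
still have their initial values, then the d/dx_i and finally d/dz.  Each of the
finitely many partial displacements is small for t near t0, so that the partial
compositions are diffeomorphisms. *)
Lemma null_reach_near : \forall t \near t0, null_reach K' (F t).
Proof.
have [k k0 dphi] := translation_diffeo.
have NHy (j : 'I_n.+1) : \forall t \near t0, is_diffeo (fun p : V => p + Hy j t p).
  apply: (@small_family R V _ R^o _ (Hy j) t0 K cK (sHy j)) => [p|t p Kp].
    by have [_ _ _ ->] := coord0 (h0 p).
  by have [_ _ _ ->] := coord0 (hK t Kp).
have NHx (j : 'I_n.+1) : \forall t \near t0, is_diffeo (fun p : V => p + Hx j t p).
  apply: (@small_family R V _ R^o _ (Hx j) t0 K cK (sHx j)) => [p|t p Kp].
    by have [_ _ _ _ ->] := coord0 (h0 p).
  by have [_ _ _ _ ->] := coord0 (hK t Kp).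
(* S is the last partial composition with its move c along d/dz replaced by the move
   c / k along Y, as required for the construction of the shear along d/dz. *)
pose S t p := Hx n t p + (c t p / k) *: Yf i0 (p + Hx n t p).
have NS : \forall t \near t0, is_diffeo (fun p : V => p + S t p).
  apply: (@small_family R V _ R^o _ S t0 K cK) => [|p|t p Kp].
  - apply: (smoothD (sHx n)); apply: (smoothZ (a := fun q => c q.1 q.2 / k)).
      exact: (smoothM sc (@smooth_cst _ _ _ k^-1)).
    exact: (smooth_comp (smooth_Yf i0) (smoothD ssnd (sHx n))).
  - by have [_ _ c00 _ Hx0] := coord0 (h0 p); rewrite /S c00 Hx0 mul0r scale0r addr0.
  - by have [_ _ c00 _ Hx0] := coord0 (hK t Kp); rewrite /S c00 Hx0 mul0r scale0r addr0.
near=> t.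
have dHy : forall j : 'I_n.+1, is_diffeo (fun p : V => p + Hy j t p).
  by near: t; apply: filter_forall.
have dHx : forall j : 'I_n.+1, is_diffeo (fun p : V => p + Hx j t p).
  by near: t; apply: filter_forall.
have dS : is_diffeo (fun p : V => p + S t p) by near: t.
have slice (f : R -> V -> R) : smooth (fun q : R^o * V => f q.1 q.2) -> smooth (f t).
  by move=> sf; exact: (smooth_apply2 sf (@smooth_cst _ _ R^o t) (@smooth_id _ V)).
have Ny (j : nat) : (j <= n)%N -> null_reach K' (fun p => p + Hy j t p).
  elim: j => [_|j IH jn].
    apply: null_reach_ext (null_reach_id K') => p.
    by rewrite /Hy big1 ?addr0// => i _; rewrite ltn0.
  pose j' := Ordinal jn.
  have E p : p + Hy j.+1 t p = (p + Hy j t p) + hy j' t p *: Yf j' (p + Hy j t p).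
    have -> : Hy j.+1 t p = Hy j t p + hy j' t p *: Yf j' p.
      by rewrite /Hy -!big_mkcond/= (sum_ltS _ j').
    by rewrite addrA; congr (_ + _ *: _); apply: Yf_eq; rewrite x_Hy.
  apply: (null_reach_ext (fun p => esym (E p))).
  apply: (null_reach_shear_step (null_field_Yf j') cK KK (slice _ (shy j'))).
  - by move=> p Kp; have [_ -> _ _ _] := coord0 (hK t Kp).
  - by move=> p Kp; have [_ _ _ -> _] := coord0 (hK t Kp); rewrite addr0.
  - apply: diffeo_ext (dHy (Ordinal (n := n.+1) (jn : (j.+1 < n.+1)%N))) => p; exact: E.
  - exact: IH (ltnW jn).
have Nx (j : nat) : (j <= n)%N -> null_reach K' (fun p => p + Hx j t p).
  elim: j => [_|j IH jn].
    apply: null_reach_ext (Ny n (leqnn n)) => p; congr (_ + _).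
    by rewrite /Hx [X in _ = _ + X]big1 ?addr0// => i _; rewrite ltn0.
  pose j' := Ordinal jn.
  have E p : p + Hx j.+1 t p = (p + Hx j t p) + hx j' t p *: ex j'.
    by rewrite /Hx -!big_mkcond/= (sum_ltS _ j') !addrA.
  apply: (null_reach_ext (fun p => esym (E p))).
  apply: (null_reach_shear_step (null_field_ex j') cK KK (slice _ (shx j'))).
  - by move=> p Kp; have [-> _ _ _ _] := coord0 (hK t Kp).
  - by move=> p Kp; have [_ _ _ _ ->] := coord0 (hK t Kp); rewrite addr0.
  - apply: diffeo_ext (dHx (Ordinal (n := n.+1) (jn : (j.+1 < n.+1)%N))) => p; exact: E.
  - exact: IH (ltnW jn).
have Ng := Nx n (leqnn n); have dg := null_reach_diffeo Ng.
pose g p := p + Hx n t p.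
have [g' dg' [gK g'K]] := diffeo_inv dg.
have g'off p : ~ K p -> g' p = p.
  move=> Kp; have gp : g p = p by have [_ _ _ _ E] := coord0 (hK t Kp); rewrite /g E addr0.
  by rewrite -{1}gp gK.
have sb : smooth (fun q => c t (g' q)) by exact: (smooth_comp (slice _ sc) (diffeo_smooth dg')).
have bK q : ~ K q -> c t (g' q) = 0.
  by move=> Kq; rewrite g'off//; have [_ _ -> _ _] := coord0 (hK t Kq).
have ds : is_diffeo (fun q : V => q + c t (g' q) *: ez).
  apply: (diffeo_quotient dg); apply: diffeo_ext (iF.2 t) => p.
  by rewrite FE -/(g p) gK.
have ds1 : is_diffeo (fun q : V => q + (c t (g' q) / k) *: Yf i0 q).
  apply: (diffeo_quotient dg); apply: diffeo_ext dS => p.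
  by rewrite -/(g p) gK /S addrA.
have Nz := null_reach_zshear cK cK' KK schi chi1 chi0 k0 sb bK ds ds1 dphi.
apply: null_reach_ext (null_reach_comp Nz Ng) => p.
by rewrite FE -/(g p) gK.
Unshelve. all: by end_near. Qed.

End NullFamily.

Section NullEnd.
Context {R : realType} {n : nat}.
Local Notation V := 'rV[R]_(n + n + 1).

(** F_t is the product of F_t F_t0^-1, which is reachable for t near t0, and
F_t0: so whether F_t is reachable does not depend on t. *)
Lemma null_reach_isotopy (i0 : 'I_n) (K K' : set V) (chi : V -> R) (F : R -> V -> V) :
  compact K -> compact K' -> K `<=` K' -> smooth chi ->
  (forall p, K p -> chi p = 1) -> (forall p, ~ K' p -> chi p = 0) ->
  isotopy F -> (forall t p, ~ K p -> F t p = p) -> (forall p, F 0 p = p) ->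
  null_reach K' (F 1).
Proof.
move=> cK cK' KK schi chi1 chi0 iF FK F0.
apply: (locally_constant (P := fun t => null_reach K' (F t))); last first.
  by apply: null_reach_ext (null_reach_id K') => p; rewrite F0.
move=> t0.
have [g dg [Fg gF]] := diffeo_inv (iF.2 t0).
have iF' : isotopy (fun t p => F t (g p)) by exact: (isotopy_comp iF (isotopy_cst dg)).
have gK p : ~ K p -> g p = p by move=> Kp; rewrite -{1}(FK t0 p Kp) Fg.
have F'K t p : ~ K p -> F t (g p) = p by move=> Kp; rewrite gK// FK.
have := null_reach_near i0 cK cK' KK schi chi1 chi0 iF' F'K gF.
apply: filterS => t Nt; split => Nf.
  have [h dh [Fh hF]] := diffeo_inv (null_reach_diffeo Nt).
  apply: null_reach_ext (null_reach_comp (null_reach_inv Fh hF Nt) Nf) => p.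
  by apply: (can_inj Fh); rewrite hF Fg.
by apply: null_reach_ext (null_reach_comp Nt Nf) => p; rewrite Fg.
Qed.

End NullEnd.

(** * Balls *)

Section Balls.
Context {R : realType} {m : nat}.
Local Notation V := 'rV[R]_m.

Lemma rV_norm_ge (p : V) i : `|p 0 i| <= `|p|.
Proof.
rewrite [leRHS]/Num.norm/= mx_normrE.
exact: (le_bigmax _ (fun ij => `|p ij.1 ij.2|) (0, i)).
Qed.

Lemma rV_norm_le (p : V) (b : R) : 0 <= b -> (forall i, `|p 0 i| <= b) -> `|p| <= b.
Proof.
move=> b0 H; rewrite [leLHS]/Num.norm/= mx_normrE.
by apply: bigmax_le => // -[i j] _ /=; rewrite (ord1 i).
Qed.

Lemma closed_ball_compact (r : R) : compact [set p : V | `|p| <= r].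
Proof.
apply: bounded_closed_compact.
  exists r; split; first exact: num_real.
  by move=> M rM p /= /le_trans; apply; exact: ltW.
apply: (preimage_closed _ (@closed_le _ r)) => p _.
exact: norm_continuous.
Qed.

Lemma cutoff_in (a b : R) (p : V) : 0 <= a -> a < b -> `|p| <= a -> cutoff a b p = 1.
Proof.
by move=> a0 ab pa; apply: cutoff1 => // i; exact: le_trans (rV_norm_ge p i) pa.
Qed.

Lemma cutoff_out (a b : R) (p : V) : 0 <= a -> a < b -> b < `|p| -> cutoff a b p = 0.
Proof.
move=> a0 ab bp.
have [i /negP] : exists i, ~ `|p 0 i| <= b.
  apply/existsNP => H; have := rV_norm_le (ltW (le_lt_trans a0 ab)) H.
  by rewrite leNgt bp.
by rewrite -ltNge => pi; apply: (@cutoff0 _ _ _ _ _ _ i) => //; exact: ltW.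
Qed.

End Balls.

(** * Isotopy extension *)

Section Extension.
Context {R : realType} {m : nat}.
Local Notation V := 'rV[R]_m.
Variables (F : R -> V -> V).
Hypothesis iF : isotopy F.
Hypothesis F0 : forall p, F 0 p = p.
Variable r : R.

(** H is a compactly supported isotopy that follows F on the ball of radius r, but
stops at the time tau. *)
Definition extends_on (tau : R) (H : R -> V -> V) (rho : R) :=
  [/\ isotopy H, (forall p, H 0 p = p), (forall t p, rho < `|p| -> H t p = p) &
     forall t p, `|p| <= r -> H t p = F (tau * step t) p].

Let image_bound (s0 : R) : exists2 M : R, 0 <= M &
  forall s p, `|s| <= s0 -> `|p| <= r -> `|F s p| <= M.
Proof.
pose A : set (R^o * V) := [set` `[- s0, s0]] `*` [set p | `|p| <= r].
have cA : compact A by apply: compact_setX; [exact: segment_compact|exact: closed_ball_compact].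
have cF : continuous (fun q : R^o * V => F q.1 q.2) by exact: (smooth_continuous iF.1).
have [M [_ HM]] := compact_bounded (continuous_compact (continuous_subspaceT cF) cA).
exists (1 + `|M|) => [|s p s1 pr]; first by rewrite addr_ge0.
apply: (HM (1 + `|M|)); first by rewrite ltr_pwDl// ler_norm.
by exists (s, p) => //; split=> //=; rewrite in_itv/= -ler_norml.
Qed.

(** If H follows F up to the time b, it can be made to follow F up to a nearby
time a by composing it with F_(a u) F_(b u)^-1, where u = [step t].  That map is
C^1-close to the identity on compact sets, uniformly in u, so it can be cut off
outside a ball of radius M that contains the images under F_(b u) of the ball of
radius r.  Openness and closedness in tau both use this, hence the two
directions. *)
Let local_step (tau0 : R) : \forall tau \near tau0, forall a b, (a = tau /\ b = tau0) \/ (a = tau0 /\ b = tau) ->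
  forall H rho, extends_on b H rho -> exists H' rho', extends_on a H' rho'.
Proof.
have [G iG FG] := isotopy_inv iF.
have [M M0 HM] := image_bound (`|tau0| + 1).
pose chi : V -> R := @cutoff R V (frame_rV m) M (M + 1).
have schi : smooth chi by exact: smooth_cutoff.
have MM : M < M + 1 by rewrite ltrDl.
pose cutstep (a b u : R) (p : V) : V := chi p *: (F (a * u) (G (b * u) p) - p).
have scut (W : normedModType R) (FW : frame W) (a b u : W -> R) (v : W -> V) : smooth a -> smooth b -> smooth u -> smooth v ->
    smooth (fun q => cutstep (a q) (b q) (u q) (v q)).
  move=> sa sb su sv; apply: (smoothZ (smooth_comp schi sv)); apply: (smoothB _ sv).
  apply: (smooth_apply2 (F := F) (P := R^o) iF.1 (smoothM sa su)).
  exact: (smooth_apply2 (F := G) (P := R^o) iG.1 (smoothM sb su) sv).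
have cut0 a u p : cutstep a a u p = 0 by rewrite /cutstep (FG (a * u)).2 subrr scaler0.
have cutK a b u p : ~ `|p| <= M + 1 -> cutstep a b u p = 0.
  by move=> /negP; rewrite -ltNge => Mp; rewrite /cutstep /chi cutoff_out ?scale0r.
have Q1 : smooth (fun q : (R^o * R^o) * V => q.1.1 : R).
  exact: (smooth_fst (smooth_fst (@smooth_id R ((R^o * R^o) * V)%type))).
have Q2 : smooth (fun q : (R^o * R^o) * V => q.1.2 : R).
  exact: (smooth_snd (smooth_fst (@smooth_id R ((R^o * R^o) * V)%type))).
have Q3 : smooth (fun q : (R^o * R^o) * V => q.2).
  exact: (smooth_snd (@smooth_id R ((R^o * R^o) * V)%type)).
have Qc : smooth (fun q : (R^o * R^o) * V => tau0) by exact: smooth_cst.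
have cball := @closed_ball_compact R m (M + 1).
have N1 : \forall tau \near tau0, [set` `[0, 1]] `<=` (fun u => is_diffeo (fun p => p + cutstep tau tau0 u p)).
  have cov := (compact_near_coveringP [set` `[0 : R, 1]]).1 (@segment_compact R 0 1) R (nbhs tau0)
    (fun tau u => is_diffeo (fun p => p + cutstep tau tau0 u p)) _.
  apply: cov.
  move=> u _.
  have := @small_family R V _ (R^o * R^o)%type _ (fun q p => cutstep q.2 tau0 q.1 p) (u, tau0) _ cball.
  apply.
  - exact: (scut _ _ _ _ _ _ Q2 Qc Q1 Q3).
  - by move=> p; exact: cut0.
  - by move=> q p Kp; exact: cutK.
have N2 : \forall tau \near tau0, [set` `[0, 1]] `<=` (fun u => is_diffeo (fun p => p + cutstep tau0 tau u p)).
  have cov := (compact_near_coveringP [set` `[0 : R, 1]]).1 (@segment_compact R 0 1) R (nbhs tau0)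
    (fun tau u => is_diffeo (fun p => p + cutstep tau0 tau u p)) _.
  apply: cov.
  move=> u _.
  have := @small_family R V _ (R^o * R^o)%type _ (fun q p => cutstep tau0 q.2 q.1 p) (u, tau0) _ cball.
  apply.
  - exact: (scut _ _ _ _ _ _ Qc Q2 Q1 Q3).
  - by move=> p; exact: cut0.
  - by move=> q p Kp; exact: cutK.
near=> tau => a b ab H rho [iH H0 HK HE].
have dcut u : 0 <= u <= 1 -> is_diffeo (fun p => p + cutstep a b u p).
  have n1 : [set` `[0, 1]] `<=` (fun u => is_diffeo (fun p => p + cutstep tau tau0 u p)) by near: tau.
  have n2 : [set` `[0, 1]] `<=` (fun u => is_diffeo (fun p => p + cutstep tau0 tau u p)) by near: tau.
  by move=> u01; case: ab => -[-> ->]; [apply: n1|apply: n2].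
have btau : `|b| <= `|tau0| + 1.
  have : `|tau - tau0| <= 1 by near: tau; apply: cvgr0_norm_le => //; apply/subr_cvg0; exact: cvg_id.
  case: ab => -[_ ->]; first by rewrite lerDl.
  move=> H1; rewrite -[X in `|X|](subrK tau0) addrC (le_trans (ler_normD _ _))//.
  by rewrite lerD2l.
have step01 (t : R) : 0 <= step t <= 1 by rewrite step_ge0 step_le1.
exists (fun t p => H t p + cutstep a b (step t) (H t p)), (Num.max rho (M + 1)); split.
- split; last by move=> t; exact: (diffeo_comp (dcut _ (step01 t)) (iH.2 t)).
  apply: (smoothD iH.1).
  have sst : smooth (fun q : R^o * V => step (q.1 : R)).
    exact: (smooth_comp smooth_step (smooth_fst (@smooth_id R (R^o * V)%type))).
  exact: (scut _ _ _ _ _ _ (@smooth_cst _ _ _ a) (@smooth_cst _ _ _ b) sst iH.1).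
- move=> p; rewrite H0 /cutstep step0// !mulr0 F0.
  by rewrite -[X in X - p]F0 (FG 0).2 subrr scaler0 addr0.
- move=> t p; rewrite gt_max => /andP[rp Mp]; rewrite HK// cutK ?addr0//.
  by apply/negP; rewrite -ltNge.
- move=> t p pr; rewrite HE// /cutstep (FG (b * step t)).1.
  rewrite /chi cutoff_in ?scale1r ?subrKC//.
  apply: HM => //; rewrite normrM; have /andP[s0 s1] := step01 t.
  by rewrite (ger0_norm s0) (le_trans _ btau)// ler_piMr.
Unshelve. all: by end_near. Qed.

(** Cutting off the isotopy itself in small time steps avoids integrating a
cut-off vector field. *)
Lemma isotopy_extension : exists H rho, extends_on 1 H rho.
Proof.
apply: (locally_constant (P := fun tau => exists H rho, extends_on tau H rho)); last first.
  exists (fun _ p => p), 0; split=> //; first by apply: isotopy_cst; exact: diffeo_id.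
  by move=> t p _; rewrite mul0r F0.
move=> tau0; have := local_step tau0; apply: filterS => tau L; split => -[H [rho HE]].
  by apply: (L tau0 tau _ H rho HE); right.
by apply: (L tau tau0 _ H rho HE); left.
Qed.

End Extension.

(** * Infinite products of null paths *)

Section InfiniteComposition.
Context {R : realType} {n : nat}.
Local Notation V := 'rV[R]_(n + n + 1).

Variables (h : nat -> V -> V) (N : nat -> R -> V -> V) (f : V -> V).
Hypothesis iN : forall j, isotopy (N j).
Hypothesis nN : forall j, null (N j).
Hypothesis N0 : forall j t p, t <= 0 -> N j t p = p.
Hypothesis N1 : forall j t p, 1 <= t -> N j t p = h j p.
Hypothesis NK : forall j t p, `|p| < j%:R - 1 -> N j t p = p.
Hypothesis df : is_diffeo f.

Fixpoint compose (k m : nat) (p : V) : V :=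
  if m is m'.+1 then h k (compose k.+1 m' p) else p.

Hypothesis fE : forall m p, `|p| < m%:R -> compose 0 m p = f p.

(** The j-th factor moves during the interval with ends u j < v j; consecutive
intervals are disjoint and the next one lies to the left. *)
Let u (j : nat) : R := (2 * j.+1)%:R^-1.
Let v (j : nat) : R := (2 * j).+1%:R^-1.

Let vu j : v j.+1 < u j.
Proof. by rewrite /v /u ltf_pV2 ?posrE ?ltr0n// ltr_nat mulnS. Qed.

Let uv j : u j < v j.
Proof. by rewrite /v /u ltf_pV2 ?posrE ?ltr0n// ltr_nat mulnS. Qed.

Let u0 j : 0 < u j. Proof. by rewrite invr_gt0 ltr0n. Qed.

Let v1 j : v j <= 1. Proof. by rewrite invf_le1 ?ltr0n// ler1n. Qed.

Let v_anti i j : (i <= j)%N -> v j <= v i.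
Proof. by move=> ij; rewrite lef_pV2 ?posrE ?ltr0n// ler_nat ltnS leq_mul2l ij orbT. Qed.

Let a (j : nat) (t : R) : R := step ((t - u j) / (v j - u j)).

Let sa j : smooth (a j).
Proof.
apply: (smooth_comp (g := step) (f := fun t => (t - u j) / (v j - u j)) smooth_step).
apply: (smoothM (b := fun=> (v j - u j)^-1)); last exact: smooth_cst.
exact: (smoothB (@smooth_id R R) (@smooth_cst R R _ (u j))).
Qed.

Let a0 j t : t <= u j -> a j t = 0.
Proof. by move=> tu; rewrite /a step0// mulr_le0_ge0 ?invr_ge0 ?subr_le0 ?subr_ge0// ltW. Qed.

Let a1 j t : v j <= t -> a j t = 1.
Proof. by move=> tu; rewrite /a step1// ler_pdivlMr ?subr_gt0// mul1r lerD2r. Qed.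

(** The factors k, ..., k + m - 1, with later factors moving at earlier times. *)
Fixpoint partial_path (k m : nat) (t : R) (p : V) : V :=
  if m is m'.+1 then N k (a k t) (partial_path k.+1 m' t p) else p.

Let isotopy_partial_path m k : isotopy (partial_path k m).
Proof.
elim: m k => [|m IH] k; first exact: (isotopy_cst (f := fun p : V => p) (@diffeo_id R V)).
exact: (isotopy_comp (isotopy_reparam (iN k) (sa k)) (IH k.+1)).
Qed.

Let partial_path1 m k t p : v k <= t -> partial_path k m t p = compose k m p.
Proof.
elim: m k => [//|m IH] k vt /=.
rewrite IH; last by rewrite (le_trans _ vt)// v_anti.
by rewrite N1// a1.
Qed.

(** Before the time u_k the factor k has not started, and around later times all
the other factors have come to rest. *)
Let null_partial_path m k : null (partial_path k m).
Proof.
elim: m k => [|m IH] k t p.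
  by rewrite /velocity (derive_cst p); have := alpha0Z p 0 0; rewrite scale0r mul0r.
have [tu|ut] := ltP t (u k).
  have E : {near t, (fun s => partial_path k m.+1 s p) =1 (fun s => partial_path k.+1 m s p)}.
    near=> s; rewrite /= N0// a0//; apply: ltW; near: s; exact: lt_nbhsl.
  by rewrite (velocity_near E) (nbhs_singleton E) IH.
apply: (null_near (G := N k) (a := a k) (q := compose k.+1 m p) (iN k) (nN k) (sa k)).
near=> s; rewrite /= partial_path1//; apply: ltW; near: s; apply: lt_nbhsr.
exact: lt_le_trans (vu k) ut.
Unshelve. all: by end_near. Qed.

Let partial_path_rcons m k t p : partial_path k m.+1 t p = partial_path k m t (N (k + m)%N (a (k + m)%N t) p).
Proof.
elim: m k => [|m IH] k; first by rewrite addn0.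
rewrite -[LHS]/(N k (a k t) (partial_path k.+1 m.+1 t p)) IH /=.
by rewrite addSnnS.
Qed.

Let partial_path_stable m m' t p : (m <= m')%N -> `|p| < m%:R - 1 ->
  partial_path 0 m' t p = partial_path 0 m t p.
Proof.
move=> /subnK <- pm; elim: (m' - m)%N => [//|d IH].
rewrite addSn partial_path_rcons add0n NK//.
by rewrite (lt_le_trans pm)// lerD2r ler_nat leq_addl.
Qed.

Let bound (p : V) : nat := (Num.bound `|p|).+1.

Let boundP p : `|p| < (bound p)%:R - 1.
Proof. by rewrite -natr1 addrK archi_boundP. Qed.

Definition infinite_path (t : R) (p : V) : V := partial_path 0 (bound p) t p.

Let infinite_pathE m t p : `|p| < m%:R - 1 -> infinite_path t p = partial_path 0 m t p.
Proof.
move=> pm; rewrite /infinite_path.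
rewrite -(partial_path_stable t (leq_maxl (bound p) m) (boundP p)).
by rewrite -(partial_path_stable t (leq_maxr (bound p) m) pm).
Qed.

Let partial_path_cat m k l t p : partial_path k (m + l) t p = partial_path k m t (partial_path (k + m) l t p).
Proof.
elim: m k => [|m IH] k; first by rewrite addn0.
by rewrite addSn /= IH addSnnS.
Qed.

Let diffeo_h j : is_diffeo (h j).
Proof. by apply: diffeo_ext ((iN j).2 1) => p; rewrite N1. Qed.

Let diffeo_compose m k : is_diffeo (compose k m).
Proof.
elim: m k => [|m IH] k; first exact: diffeo_id.
exact: (diffeo_comp (diffeo_h k) (IH k.+1)).
Qed.

Let compose_cat m k l p : compose k (m + l) p = compose k m (compose (k + m) l p).
Proof.
elim: m k => [|m IH] k; first by rewrite addn0.
by rewrite addSn /= IH addSnnS.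
Qed.

Let infinite_path1 t p : 1 <= t -> infinite_path t p = f p.
Proof.
move=> t1; rewrite /infinite_path partial_path1; last exact: le_trans (v1 0) t1.
by rewrite fE// (lt_trans (boundP p))// ltrBlDr ltrDl.
Qed.

Let infinite_path0 t p : t <= 0 -> infinite_path t p = p.
Proof.
move=> t0; suff H m k : partial_path k m t p = p by exact: H.
elim: m k => [//|m IH] k /=; by rewrite IH N0// a0// (le_trans t0)// ltW.
Qed.

(** At a time t > 0 the factors from some k on, with v_k <= t, have finished, and
their product is (h_0 ... h_(k-1))^-1 f, which is a diffeomorphism. *)
Let diffeo_infinite_path t : is_diffeo (infinite_path t).
Proof.
have [t0|t0] := leP t 0.
  by apply: diffeo_ext (@diffeo_id _ V) => p; rewrite infinite_path0.
pose k := Num.bound t^-1.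
have vk : v k <= t.
  have kt : t^-1 < k%:R by apply: archi_boundP; rewrite invr_ge0 ltW.
  rewrite /v -[leRHS]invrK lef_pV2 ?posrE ?invr_gt0 ?ltr0n//.
  rewrite (le_trans (ltW kt))// ler_nat.
  by rewrite (leq_trans (leq_addr k k))// addnn -mul2n.
have [A dA [cA Ac]] := diffeo_inv (diffeo_compose k 0).
apply: diffeo_ext (diffeo_comp ((isotopy_partial_path k 0).2 t) (diffeo_comp dA df)) => p /=.
pose m := bound p.
have pm : `|p| < (k + m)%:R - 1.
  by rewrite (lt_le_trans (boundP p))// lerD2r ler_nat leq_addl.
rewrite (infinite_pathE t pm) partial_path_cat add0n (partial_path1 m p vk).
have pm' : `|p| < (k + m)%:R by rewrite (lt_trans pm)// ltrBlDr ltrDl.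
by rewrite -(fE pm') compose_cat add0n cA.
Qed.

(** The j-th factor fixes the ball of radius j - 1, so that locally in space the
path is a finite composition, also around the time 0 where the intervals
accumulate. *)
Lemma null_reach_infinite : null_reach setT f.
Proof.
exists infinite_path; split.
- split; last exact: diffeo_infinite_path.
  apply: smooth_local => -[t p].
  pose U : set (R^o * V) := [set q | `|q.2| < (bound p)%:R - 1].
  exists U, (fun q => partial_path 0 (bound p) q.1 q.2); split.
  + apply: (@open_comp _ _ (fun q : R^o * V => `|q.2|) [set x | x < (bound p)%:R - 1]); last exact: open_lt.
    move=> q _; apply: (@continuous_comp _ _ _ (fun q : R^o * V => q.2) (fun p => `|p|)); first exact: cvg_snd.
    exact: norm_continuous.
  + exact: boundP.
  + exact: (smooth_open_sub (@subsetT _ U) (isotopy_partial_path _ _).1).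
  + by move=> [s q] Uq; exact: (@infinite_pathE (bound p) s q Uq).
- move=> t p.
  have E : {near t, (fun s => infinite_path s p) =1 (fun s => partial_path 0 (bound p) s p)}.
    by near=> s; exact: infinite_pathE (boundP p).
  by rewrite (velocity_near E) (nbhs_singleton E) null_partial_path.
- by split=> t p; [exact: infinite_path0|exact: infinite_path1].
- by move=> t p; case.
Unshelve. all: by end_near. Qed.

End InfiniteComposition.

(** * Reaching the end of an isotopy *)

Section NullExistence.
Context {R : realType} {n : nat} (i0 : 'I_n).
Local Notation V := 'rV[R]_(n + n + 1).

(** The bound a may be negative, and the shell is then a ball. *)
Definition shell (a b : R) : set V := [set p | a <= `|p| /\ `|p| <= b].

Lemma shell_compact a b : compact (shell a b).
Proof.
have -> : shell a b = [set p : V | a <= `|p|] `&` [set p | `|p| <= b] by [].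
apply: (subclosed_compact _ (@closed_ball_compact R _ b)); last exact: subIsetr.
apply: closedI; last by apply: compact_closed; [exact: norm_hausdorff|exact: closed_ball_compact].
apply: (preimage_closed _ (@closed_ge _ a)) => p _.
exact: norm_continuous.
Qed.

(** A difference of cut-off functions of balls; the inner one is absent if
j = 0. *)
Lemma shell_cutoff (j : nat) (rho : R) : 0 <= rho -> exists chi : V -> R, [/\ smooth chi,
  forall p, shell j%:R rho p -> chi p = 1 & forall p, ~ shell (j%:R - 1) (rho + 1) p -> chi p = 0].
Proof.
move=> rho0; have rr : rho < rho + 1 by rewrite ltrDl.
have big (c : R) (p : V) : cutoff rho (rho + 1) p * c != 0 -> `|p| <= rho + 1.
  apply: contra_neqT; rewrite -ltNge => pr.
  by rewrite cutoff_out// mul0r.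
have soff : smooth (fun p : V => cutoff rho (rho + 1) p) by exact: smooth_cutoff.
case: j => [|j].
  exists (fun p => cutoff rho (rho + 1) p * 1); split.
  - exact: (smoothM soff (@smooth_cst _ _ _ (1 : R))).
  - by move=> p [_ pr]; rewrite mulr1 cutoff_in.
  - move=> p np; apply/eqP; apply: contra_notT np => /big pr; split=> //.
    by rewrite sub0r (le_trans _ (normr_ge0 p))// oppr_le0.
have jj : j%:R < j%:R + 1 / 2 :> R by rewrite ltrDl.
exists (fun p => cutoff rho (rho + 1) p * (1 - cutoff j%:R (j%:R + 1 / 2) p)); split.
- apply: (smoothM soff); apply: (smoothB (@smooth_cst _ _ _ (1 : R))).
  exact: smooth_cutoff.
- move=> p [jp pr]; rewrite cutoff_in// cutoff_out ?subr0 ?mulr1 ?ler0n//.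
  by rewrite (lt_le_trans _ jp)// -[j.+1%:R]natr1 ltrD2l; lra.
- move=> p np; apply/eqP; apply: contra_notT np => c0; split; last exact: big c0.
  rewrite -[j.+1%:R]natr1 addrK leNgt; apply/negP => pj; move: c0.
  by rewrite (@cutoff_in _ _ j%:R) ?ler0n ?(ltW pj)// subrr mulr0 eqxx.
Qed.

Lemma null_reach_shell (j : nat) (rho : R) (F : R -> V -> V) : 0 <= rho -> isotopy F ->
  (forall p, F 0 p = p) -> (forall t p, ~ shell j%:R rho p -> F t p = p) ->
  null_reach (shell (j%:R - 1) (rho + 1)) (F 1).
Proof.
move=> rho0 iF F0 FK; have [chi [schi chi1 chi0]] := shell_cutoff j rho0.
apply: (null_reach_isotopy i0 (@shell_compact _ _) (@shell_compact _ _) _ schi chi1 chi0 iF FK F0).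
move=> p [jp pr]; split; first by rewrite (le_trans _ jp)// gerBl.
by rewrite (le_trans pr)// lerDl.
Qed.

(** The isotopies H_j agree with F on the ball of radius j.  The path H_j^-1 H_(j+1)
is supported in a shell of inner radius j, so its end h_j is reachable within a
shell of inner radius j - 1, and h_0 ... h_(m-1) telescopes to H_m. *)
Lemma null_reach_Diff0 (F : R -> V -> V) : isotopy F -> (forall p, F 0 p = p) ->
  null_reach setT (F 1).
Proof.
move=> iF F0.
have /choice[Hr HrE] (j : nat) : exists Hr : (R -> V -> V) * R, extends_on F j%:R 1 Hr.1 Hr.2.
  by have [H [rho HE]] := isotopy_extension iF F0 j%:R; exists (H, rho).
pose H (j : nat) : R -> V -> V := if j is 0%N then fun _ p => p else (Hr j).1.
pose rho (j : nat) : R := `|(Hr j).2|.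
have iH j : isotopy (H j).
  case: j => [|j]; first exact: (isotopy_cst (f := fun p : V => p) (@diffeo_id R V)).
  by have [] := HrE j.+1.
have H0 j p : H j 0 p = p by case: j => [//|j]; have [_ + _ _] := HrE j.+1; apply.
have Hoff j t p : rho j < `|p| -> H j t p = p.
  case: j => [//|j] rp; have [_ _ + _] := HrE j.+1; apply.
  exact: le_lt_trans (ler_norm _) rp.
have HF j t p : (0 < j)%N -> `|p| <= j%:R -> H j t p = F (1 * step t) p.
  by case: j => [//|j] _; have [_ _ _] := HrE j.+1; apply.
have /choice[G HG] j : exists G, isotopy G /\ forall t, cancel (H j t) (G t) /\ cancel (G t) (H j t).
  by have [G ? ?] := isotopy_inv (iH j); exists G.
pose h (j : nat) p := G j 1 (H j.+1 1 p).
have Nh j : null_reach (shell (j%:R - 1) (Num.max (rho j) (rho j.+1) + 1)) (h j).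
  apply: (null_reach_shell (F := fun t p => G j t (H j.+1 t p))).
  - by rewrite le_max normr_ge0.
  - exact: (isotopy_comp (HG j).1 (iH j.+1)).
  - by move=> p; rewrite H0 -[X in G j 0 X](H0 j) ((HG j).2 0).1.
  - move=> t p np.
    suff E : H j.+1 t p = H j t p by rewrite E ((HG j).2 t).1.
    have [pj|jp] := ltP `|p| j%:R.
      have j0 : (0 < j)%N by rewrite -(ltr0n R) (le_lt_trans _ pj).
      rewrite !HF//; first exact: ltW.
      by rewrite (le_trans (ltW pj))// ler_nat.
    have : Num.max (rho j) (rho j.+1) < `|p|.
      by rewrite ltNge; apply/negP => pr; apply: np.
    by rewrite gt_max => /andP[r1 r2]; rewrite !Hoff.
have /choice[N HN] j : exists N, [/\ isotopy N, null N,
  (forall t p, t <= 0 -> N t p = p) /\ (forall t p, 1 <= t -> N t p = h j p) &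
  forall t p, ~ shell (j%:R - 1) (Num.max (rho j) (rho j.+1) + 1) p -> N t p = p] := Nh j.
apply: (@null_reach_infinite R n h N (F 1)) => //.
- by move=> j; have [] := HN j.
- by move=> j; have [] := HN j.
- by move=> j; have [_ _ []] := HN j.
- by move=> j; have [_ _ []] := HN j.
- move=> j t p pj; have [_ _ _] := HN j; apply => -[].
  by rewrite leNgt pj.
- exact: iF.2.
- move=> m p pm.
  have E k l q : compose h k l q = G k 1 (H (k + l)%N 1 q).
    elim: l k => [|l IH] k /=; first by rewrite addn0 ((HG k).2 1).1.
    by rewrite IH /h ((HG k.+1).2 1).2 addSnnS.
  rewrite E add0n.
  have m0 : (0 < m)%N by rewrite -(ltr0n R) (le_lt_trans _ pm).
  rewrite HF ?(ltW pm)// mul1r step1//.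
  by have := ((HG 0%N).2 1).2 (F 1 p).
Qed.

End NullExistence.

(** * Smooth paths and isotopies *)

Section FromPaths.
Context {R : realType} {V : normedModType R} {FV : frame V}.

(** The step maps the line into the unit interval, near whose points F has local
smooth extensions. *)
Lemma diffeo_path_isotopy (F : R -> V -> V) : diffeo_path F -> isotopy (fun t => F (step t)).
Proof.
have st t : step t \in `[0 : R, 1] by rewrite in_itv/= step_ge0 step_le1.
move=> [dF sF]; split=> [|t]; last exact: dF.
apply: smooth_local => -[t0 p0].
have [|U [g [[oU Ux] sg gE]]] := sF (step t0, p0); first by split=> //=.
pose Th (q : R^o * V) : R^o * V := (step (q.1 : R), q.2).
have sTh : smooth Th.
  apply: smooth_pair.
    exact: (smooth_comp smooth_step (smooth_fst (@smooth_id R (R^o * V)%type))).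
  exact: (smooth_snd (@smooth_id R (R^o * V)%type)).
have oTU : open (Th @^-1` U).
  by apply: open_comp => // q _; exact: (smooth_continuous sTh).
exists (Th @^-1` U), (fun q => g (Th q)); split=> //.
  apply: (smooth_open_comp oU oTU _ sg) => //.
  exact: (smooth_open_sub (@subsetT _ _) sTh).
by move=> [t p] Uq; rewrite -gE//; split=> /=.
Qed.

Lemma isotopy_diffeo_path (F : R -> V -> V) : isotopy F -> diffeo_path F.
Proof.
move=> [sF dF]; split=> [t _|q _]; first exact: dF.
exists setT, (fun q => F q.1 q.2); split=> //.
by split=> //; exact: openT.
Qed.

Lemma isotopy_generates (F : R -> V -> V) (X : R -> V -> V) : isotopy F ->
  (forall t p, X t (F t p) = 'D_1 (fun s : R => F s p) t) -> generates F X.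
Proof.
move=> iF XE t p _; rewrite XE.
have dF : derivable (fun s : R => F s p) t 1.
  apply: smooth_derivable.
  exact: (smooth_apply2 (P := R^o) iF.1 (@smooth_id R R) (@smooth_cst R R _ p)).
have : (fun h : R => h^-1 *: (((fun s => F s p) \o shift t) (h *: 1) - F t p)) @ 0^' --> 'D_1 (fun s : R => F s p) t by exact: dF.
have sub : (fun s : R => s - t) @ within [set` `[0, 1]] t^' --> 0^'.
  move=> A A0.
  have A0' : \forall h \near (0 : R), h != 0 -> A h by exact: A0.
  have c : (fun s : R => s - t) s @[s --> t] --> (0 : R) by apply/subr_cvg0; exact: cvg_id.
  have := c _ A0'; rewrite !near_simpl => H.
  have K : \forall s \near t^', A (s - t).
    by apply: filterS H => s Hs st; apply: Hs; rewrite subr_eq0.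
  exact: (@cvg_within _ (t^') _ [set` `[0, 1]] _ K).
move=> cv; apply: cvg_trans (cvg_comp _ _ sub cv).
apply: near_eq_cvg; near=> s => /=.
by rewrite [_ *: 1]mulr1 subrK.
Unshelve. all: by end_near. Qed.

End FromPaths.

(** * Neighbourhoods of the inclusion *)

Section CinftyNbhs.

(** In an initial topology only inverse images of neighbourhoods have to be
tested. *)
Lemma cvg_initial (S : choiceType) (T : topologicalType) (f : S -> T)
    (F : set_system S) (s : S) : Filter F ->
  f @ F --> f s -> F --> (s : initial_topology f).
Proof.
move=> FF fF A /= [_ [[B oB <-] Bs BA]].
have FB : F (f @^-1` B) by apply: fF; exact: open_nbhs_nbhs.
exact: filterS BA FB.
Qed.

Context {R : realType} {V W : normedModType R}.

Lemma Cinfty_cvg (U : set V) (F : set_system (Cinfty_space (W := W) U)) (x : Cinfty_space (W := W) U) :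
  Filter F -> (forall (s : seq V) (A : set V) (e : R), compact A -> A `<=` U -> 0 < e ->
    \forall h \near F, forall y, A y ->
      `|dderiv s ('valL_(0 : W) (x : U -> W)) y - dderiv s ('valL_(0 : W) (h : U -> W)) y| < e) ->
  F --> x.
Proof.
move=> FF H; apply/cvg_sup => s.
apply: cvg_initial; apply/fam_cvgP => A [AU cA] P /uniform_nbhs [E [entE EP]].
move: entE; rewrite -entourage_ballE => -[e /= e0 eE].
have := H s A e cA AU e0; apply: filterS => h hA; apply: EP => y Ay.
by apply: eE; rewrite /= -ball_normE; exact: hA.
Qed.

Lemma valL_sigL (U : set V) (f : V -> W) x : U x -> 'valL_(0 : W) (sigL U f) x = f x.
Proof.
move=> Ux; have E : 'valL_(0 : W) (sigL U f) = patch (fun=> 0) U f.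
  by rewrite -[patch _ _]sigLK.
by rewrite E patchT// inE.
Qed.

Lemma dderiv_near (s : seq V) (U : set V) (f g : V -> W) : open U ->
  (forall x, U x -> f x = g x) -> forall x, U x -> dderiv s f x = dderiv s g x.
Proof.
move=> oU fg; elim: s => [|v s IH] x Ux /=; first exact: fg.
apply: near_eq_derive.
exact: (open_near (P := fun y => dderiv s f y = dderiv s g y) oU Ux IH).
Qed.

Lemma sigL_Cinfty (U : set V) (f : V -> W) : open U -> smooth f -> Cinfty (sigL U f).
Proof.
move=> oU sf; apply: (smooth_open_ext oU (f := f)) => [x Ux|].
  by rewrite valL_sigL.
exact: smooth_open_sub (@subsetT _ U) sf.
Qed.

(** Affine maps have constant first derivatives and no others, so a family of
affine perturbations of the identity tends to the inclusion as soon as its values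
and first derivatives do. *)
Lemma affine_dderiv (f : V -> W) (L : V -> W) (s : seq V) :
  (forall x v (h : R), f (h *: v + x) = f x + h *: L v) ->
  dderiv s f = match s with [::] => f | [:: v] => fun=> L v | _ => fun=> 0 end.
Proof.
move=> H.
have D v : 'D_v f = fun=> L v.
  by apply/funext => x; have [_ ->//] := is_derive_affine (H x v).
have D0 w v : 'D_v (fun _ : V => w) = fun _ => (0 : W).
  by apply/funext => x; exact: (derive_cst w).
elim/last_ind: s => [//|s v _]; rewrite dderiv_rcons D.
elim/last_ind: s => [//|s w _]; rewrite dderiv_rcons D0.
have -> : dderiv s (fun=> 0) = (fun _ : V => (0 : W)).
  by elim: s => [//|u s /= ->]; exact: D0.
by rewrite -!cats1 -catA; case: s => [|a [|b s]].
Qed.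

End CinftyNbhs.

Section AffineFamily.
Context {R : realType} {V : normedModType R} {FV : frame V}.
Variables (U : set V) (T : set R) (g B M : R -> R -> V -> V).
Hypothesis oU : open U.
Hypothesis sg : forall d t, smooth (g d t).
Hypothesis gE : forall d t x, T t -> U x -> g d t x = x + d *: B d t x.
Hypothesis BM : forall d t x v (h : R), B d t (h *: v + x) = B d t x + h *: M d t v.
Hypothesis bounded_BM : forall r : R, exists2 C : R, 0 < C & forall d t x, `|d| <= 1 -> T t ->
  `|x| <= r -> `|B d t x| <= C /\ `|M d t x| <= C.

(** The set T contains the times: the neighbourhood is entered at the same d for
all of them, which is expressed by convergence along a filter of sets that contain
the whole path. *)
Lemma Cinfty_nbhs_affine (N : set (U -> V)) :
  Cinfty_nbhs set_val N -> \forall d \near (0 : R), forall t, T t -> N (sigL U (g d t)).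
Proof.
move=> NN.
pose F : set_system (Cinfty_space (W := V) U) := fun A =>
  \forall d \near (0 : R), forall t, T t -> A (sigL U (g d t)).
have FF : Filter F.
  split.
  - by apply: (@filterE _ (nbhs (0 : R))) => d t _.
  - by move=> A A' FA FA'; apply: (@filterS2 _ (nbhs (0 : R)) _ _ _ _ _ FA FA') => d H H' t Tt; split; [exact: H|exact: H'].
  - by move=> A A' AA' FA; apply: (@filterS _ (nbhs (0 : R)) _ _ _ _ FA) => d H t Tt; apply: AA'; exact: H.
have cv : F --> (set_val : Cinfty_space (W := V) U).
  apply: Cinfty_cvg => s A e cA AU e0.
  have [r [_ Hr]] := compact_bounded cA.
  pose r1 := 1 + `|r| + \sum_(v <- s) `|v|.
  have [C C0 HC] := bounded_BM r1.
  have s0 : 0 <= \sum_(v <- s) `|v| by rewrite sumr_ge0.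
  have Ar y : A y -> `|y| <= r1.
    move=> Ay; rewrite (le_trans (Hr (1 + `|r|) _ y Ay))//; first by rewrite ltr_pwDl// ler_norm.
    by rewrite /r1 lerDl.
  suff : \forall d \near (0 : R), forall t, T t -> forall y, A y ->
      `|dderiv s ('valL_(0 : V) (set_val : U -> V)) y -
        dderiv s ('valL_(0 : V) (sigL U (g d t))) y| < e by [].
  near=> d => t Tt y Ay.
  have Uy : U y by exact: AU.
  have d1 : `|d| <= 1 by near: d; apply: cvgr0_norm_le => //; exact: cvg_id.
  have dC : `|d| * C < e.
    rewrite -ltr_pdivlMr//; near: d; apply: cvgr0_norm_lt; first exact: cvg_id.
    by rewrite divr_gt0.
  pose aff x := x + d *: B d t x.
  have E1 : dderiv s ('valL_(0 : V) (set_val : U -> V)) y = dderiv s id y.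
    by apply: (dderiv_near s oU _ Uy) => x Ux; exact: (valL_sigL id Ux).
  have E2 : dderiv s ('valL_(0 : V) (sigL U (g d t))) y = dderiv s aff y.
    by apply: (dderiv_near s oU _ Uy) => x Ux; rewrite valL_sigL// gE.
  rewrite E1 E2 (@affine_dderiv _ _ _ id id s) => [|x v h]; last by rewrite addrC.
  rewrite (@affine_dderiv _ _ _ aff (fun v => v + d *: M d t v) s); last first.
    by move=> x v h; rewrite /aff BM !scalerDr !scalerA (mulrC d h) [h *: v + x]addrC addrACA.
  have r1s v : s = [:: v] -> `|v| <= r1.
    by move=> sv; rewrite /r1 sv big_seq1 lerDr addr_ge0.
  move: r1 r1s HC Ar {E1 E2 s0} => r1; case: s => [|v [|w s]] r1s HC Ar.
  - rewrite /aff opprD addrA subrr add0r normrN normrZ (le_lt_trans _ dC)// ler_wpM2l//.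
    by have [] := HC d t y d1 Tt (Ar y Ay).
  - rewrite opprD addrA subrr add0r normrN normrZ (le_lt_trans _ dC)// ler_wpM2l//.
    by have [] := HC d t v d1 Tt (r1s v erefl).
  - by rewrite subrr normr0.
have H := cv _ NN; apply: (@filterS _ (nbhs (0 : R)) _ _ _ _ H) => d {}H t Tt; apply: H => //.
exact: sigL_Cinfty.
Unshelve. all: by end_near. Qed.

End AffineFamily.

(** * A null path to a vertical translation *)

Section Loop.
Context {R : realType} {n : nat} (i : 'I_n).
Local Notation V := 'rV[R]_(n + n + 1).

(** For s from 0 to 1 the curve (u, v) is a loop, and z is - int u dv.  The
function v vanishes at both ends; with u = 30 v v' the curve is closed, and the
factor 30 makes int u dv = 1. *)
Definition loop_u (s : R) : R := 30 * (s * (1 - s) * (1 - 2 * s)).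
Definition loop_v (s : R) : R := s * (1 - s).
Definition loop_z (s : R) : R := 24 * s ^+ 5 - 60 * s ^+ 4 + 50 * s ^+ 3 - 15 * s ^+ 2.

(** The flow of Y_i for the time d v, followed by the translation by d u along
d/dx_i and by d^2 z along d/dz.  The x-coordinate of the moving point is
x + d u; there Y_i differs from its initial value by - d u d/dz, and z
compensates for this. *)
Definition helix (d s : R) (p : V) : V :=
  p + (d * loop_v s) *: Yf i p + ((d * loop_u s) *: ex i + (d ^+ 2 * loop_z s) *: ez).

Lemma smooth_loop_v : smooth loop_v.
Proof.
exact: (smoothM (@smooth_id R R) (smoothB (@smooth_cst R R _ (1 : R)) (@smooth_id R R))).
Qed.

Lemma smooth_loop_u : smooth loop_u.
Proof.
apply: (smoothM (@smooth_cst R R _ (30 : R))); apply: (smoothM smooth_loop_v).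
apply: (smoothB (@smooth_cst R R _ (1 : R))).
exact: (smoothM (@smooth_cst R R _ (2 : R)) (@smooth_id R R)).
Qed.

Lemma smooth_pow (k : nat) : smooth (fun s : R => s ^+ k).
Proof.
elim: k => [|k IH]; first exact: (@smooth_cst R R _ (1 : R)).
rewrite (_ : (fun s => _) = fun s : R => s * s ^+ k); last by apply/funext => s; rewrite exprS.
exact: (smoothM (@smooth_id R R) IH).
Qed.

Lemma smooth_loop_z : smooth loop_z.
Proof.
have P (c : R) k := smoothM (@smooth_cst R R _ c) (smooth_pow k).
exact: (smoothB (smoothD (smoothB (P _ _) (P _ _)) (P _ _)) (P _ _)).
Qed.

Lemma loop_form s : 'D_1 loop_z s + loop_u s * 'D_1 loop_v s = 0.
Proof.
have dz : is_derive s 1 loop_z (120 * s ^+ 4 - 240 * s ^+ 3 + 150 * s ^+ 2 - 30 * s).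
  rewrite /loop_z; apply: is_derive_eq.
  by rewrite /GRing.scale/=; ring.
have dv : is_derive s 1 loop_v (1 - 2 * s).
  rewrite /loop_v; apply: is_derive_eq.
  by rewrite /GRing.scale/=; ring.
by have [_ ->] := dz; have [_ ->] := dv; rewrite /loop_u; ring.
Qed.

Lemma translation_is_diffeo (c : V) : is_diffeo (fun p : V => p + c).
Proof.
split; first exact: (smoothD (@smooth_id R V) (@smooth_cst R V _ c)).
exists (fun p => p - c); split.
- exact: (smoothB (@smooth_id R V) (@smooth_cst R V _ c)).
- by move=> p; rewrite addrK.
- by move=> p; rewrite subrK.
Qed.

Lemma Yf_flow_diffeo (k : R) : is_diffeo (fun p : V => p + k *: Yf i p).
Proof.
have sk (k' : R) : smooth (fun p : V => p + k' *: Yf i p).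
  exact: (smoothD (@smooth_id R V) (smoothZ (@smooth_cst R V _ k') (smooth_Yf i))).
have YY k' p : Yf i (p + k' *: Yf i p) = Yf i p.
  by apply: Yf_eq; rewrite xcoordD xcoordZ xcoord_Yf mulr0 addr0.
split; first exact: sk.
exists (fun p => p + (- k) *: Yf i p); split; first exact: sk.
- by move=> p; rewrite YY -addrA -scalerDl subrr scale0r addr0.
- by move=> p; rewrite YY -addrA -scalerDl addNr scale0r addr0.
Qed.

Lemma isotopy_helix d : isotopy (helix d).
Proof.
have ss : smooth (fun q : R^o * V => q.2) by exact: (smooth_snd (@smooth_id R (R^o * V)%type)).
have P (w : R -> R) (c : R) : smooth w -> smooth (fun q : R^o * V => c * w q.1).
  move=> sw; apply: (smoothM (@smooth_cst R (R^o * V)%type _ c)).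
  exact: (smooth_comp sw (smooth_fst (@smooth_id R (R^o * V)%type))).
split.
  apply: smoothD.
    exact: (smoothD ss (smoothZ (P _ d smooth_loop_v) (smooth_comp (smooth_Yf i) ss))).
  apply: smoothD.
    exact: (smoothZ (P _ d smooth_loop_u) (@smooth_cst R (R^o * V)%type _ (ex i))).
  exact: (smoothZ (P _ (d ^+ 2) smooth_loop_z) (@smooth_cst R (R^o * V)%type _ ez)).
move=> t.
exact: (diffeo_comp (translation_is_diffeo ((d * loop_u t) *: ex i + (d ^+ 2 * loop_z t) *: ez))
  (Yf_flow_diffeo (d * loop_v t))).
Qed.

Lemma derive_scale_cst (w : R -> R) (c : V) t : smooth w -> 'D_1 (fun s => w s *: c) t = 'D_1 w t *: c.
Proof.
move=> sw; have sg : smooth (fun s : R => s *: c).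
  exact: (smoothZ (@smooth_id R R) (@smooth_cst R R _ c)).
rewrite (derive_chain t 1 sg sw).
have [_ ->//] : is_derive (w t) ('D_1 w t) (fun s : R => s *: c) ('D_1 w t *: c).
by apply: is_derive_affine => h; rewrite scalerDl addrC scalerA.
Qed.

Lemma xcoord_helix d s p : xcoord (helix d s p) i = xcoord p i + d * loop_u s.
Proof.
rewrite /helix !xcoordD !xcoordZ xcoord_Yf xcoord_ex xcoord_ez eqxx.
by rewrite !mulr0 mulr1 !addr0.
Qed.

Lemma null_helix d : null (helix d).
Proof.
move=> t p; have su := smooth_loop_u; have sv := smooth_loop_v; have sz := smooth_loop_z.
have -> : velocity (helix d) t p = (d * 'D_1 loop_v t) *: Yf i p +
    ((d * 'D_1 loop_u t) *: ex i + (d ^+ 2 * 'D_1 loop_z t) *: ez).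
  have S (w : R -> R) (c : R) : smooth w -> smooth (fun s : R => c * w s).
    by move=> sw; exact: (smoothM (@smooth_cst R R _ c) sw).
  have D (w : R -> R) (c : R) (e : V) : smooth w ->
      is_derive t 1 (fun s : R => (c * w s) *: e) ((c * 'D_1 w t) *: e).
    move=> sw; apply: DeriveDef.
      exact: (smooth_derivable (smoothZ (S w c sw) (@smooth_cst R R _ e))).
    rewrite (derive_scale_cst e t (S w c sw)); congr (_ *: _).
    exact: (deriveZ c (smooth_derivable (x := t) (v := 1) sw)).
  have H := is_deriveD (is_deriveD (is_derive_cst p t 1) (D _ d (Yf i p) sv))
    (is_deriveD (D _ d (ex i) su) (D _ (d ^+ 2) ez sz)).
  have [_ E] := H.
  by rewrite /velocity /helix; etransitivity; first exact: E; rewrite add0r.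
rewrite !alpha0D !alpha0Z alpha0_ex alpha0_ez mulr0 add0r mulr1.
rewrite /Yf -scaleNr alpha0D alpha0Z alpha0_ez alpha0_ey xcoord_helix.
have := loop_form t; set v' := 'D_1 loop_v t; set z' := 'D_1 loop_z t => E.
have -> : z' = - (loop_u t * v') by apply/eqP; rewrite -addr_eq0 E.
by ring.
Qed.

Lemma helix0 d p : helix d 0 p = p.
Proof.
rewrite /helix /loop_v /loop_u /loop_z !expr0n/= !mul0r !mulr0 !addr0 !subr0 !mulr0.
by rewrite !scale0r !addr0.
Qed.

Lemma helix1 d p : helix d 1 p = p - d ^+ 2 *: ez.
Proof.
rewrite /helix /loop_v /loop_u /loop_z subrr !expr1n !mulr0 !mul0r !mulr0 !scale0r addr0 add0r.
have -> : d ^+ 2 * (24 * 1 - 60 * 1 + 50 * 1 - 15 * 1) = - (d ^+ 2) by ring.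
by rewrite scaleNr.
Qed.

End Loop.

(** * From isotopies to null and positive paths *)

Section Paths.
Context {R : realType} {n : nat}.
Local Notation V := 'rV[R]_(n + n + 1).
Implicit Types (F G : R -> V -> V).

Lemma isotopy_field F : isotopy F -> exists X, generates F X /\
  forall (P : V -> V -> Prop) t, (forall p, P (F t p) (velocity F t p)) -> forall q, P q (X t q).
Proof.
move=> iF; have [G iG FG] := isotopy_inv iF.
exists (fun t q => velocity F t (G t q)); split.
  by apply: (isotopy_generates iF) => t p; rewrite (FG t).1.
by move=> P t H q; have := H (G t q); rewrite (FG t).2.
Qed.

Lemma null_isotopy_path F : isotopy F -> null F -> null_path alpha0 F.
Proof.
move=> iF nF; have [X [gX HX]] := isotopy_field iF.
split; first exact: isotopy_diffeo_path.
exists X; split=> // t q _.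
exact: (HX (fun q v => alpha0 q v = 0) t (nF t)).
Qed.

Lemma positive_isotopy_path F : isotopy F ->
  (forall t p, 0 < alpha0 (F t p) (velocity F t p)) -> positive_path alpha0 F.
Proof.
move=> iF nF; have [X [gX HX]] := isotopy_field iF.
split; first exact: isotopy_diffeo_path.
exists X; split=> // t q _.
exact: (HX (fun q v => 0 < alpha0 q v) t (nF t)).
Qed.

(** Translations along z preserve alpha_0, so they may be composed with a null
path without affecting its part of the velocity. *)
Definition rise (c : R) F (t : R) (p : V) : V := F t p + (c * t) *: ez.

Lemma isotopy_rise c F : isotopy F -> isotopy (rise c F).
Proof.
move=> [sF dF]; split.
  apply: (smoothD sF).
  apply: (smoothZ _ (@smooth_cst R (R^o * V)%type _ (ez : V))).
  apply: (smoothM (@smooth_cst R (R^o * V)%type _ c)).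
  exact: (smooth_fst (@smooth_id R (R^o * V)%type)).
by move=> t; exact: (diffeo_comp (translation_is_diffeo ((c * t) *: ez)) (dF t)).
Qed.

Lemma alpha0_rise (q v : V) (a : R) : alpha0 (q + a *: ez) v = alpha0 q v.
Proof.
rewrite /alpha0; congr (_ + _); apply: eq_bigr => j _.
by rewrite xcoordD xcoordZ xcoord_ez mulr0 addr0.
Qed.

Lemma positive_rise c F : 0 < c -> isotopy F -> null F -> positive_path alpha0 (rise c F).
Proof.
move=> c0 iF nF; apply: positive_isotopy_path; first exact: isotopy_rise.
move=> t p; have -> : velocity (rise c F) t p = velocity F t p + c *: ez.
  have sr : smooth (fun s : R => (c * s) *: (ez : V)).
    apply: (smoothZ _ (@smooth_cst R R _ (ez : V))).
    exact: (smoothM (@smooth_cst R R _ c) (@smooth_id R R)).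
  rewrite /velocity; etransitivity.
    exact: (deriveD (smooth_derivable (x := t) (v := 1) (isotopy_time p iF)) (smooth_derivable (x := t) (v := 1) sr)).
  congr (_ + _); have [_ ->//] : is_derive t 1 (fun s : R => (c * s) *: (ez : V)) (c *: ez).
  apply: is_derive_affine => h; rewrite scalerA -scalerDl [h *: 1]mulr1 mulrDr addrC.
  by rewrite [h * c]mulrC.
by rewrite alpha0_rise alpha0D nF add0r alpha0Z alpha0_ez mulr1.
Qed.

End Paths.

(** * Existence of null and positive paths *)

Section Main.
Context {R : realType} {n : nat} (i0 : 'I_n).
Local Notation V := 'rV[R]_(n + n + 1).

Lemma continuous_bound01 (w : R -> R) : smooth w -> exists2 C : R, 0 < C &
  forall s, 0 <= s <= 1 -> `|w s| <= C.
Proof.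
move=> sw.
have [M [_ HM]] := compact_bounded (continuous_compact
  (continuous_subspaceT (smooth_continuous sw)) (@segment_compact R 0 1)).
exists (1 + `|M|) => [|s s01]; first by rewrite ltr_pwDl.
by apply: (HM (1 + `|M|)); [rewrite ltr_pwDl// ler_norm|exists s => //=; rewrite in_itv].
Qed.

Lemma Diff0_isotopy (f : V -> V) : Diff0 f -> exists F, [/\ isotopy F,
  forall p, F 0 p = p & F 1 = f].
Proof.
move=> [_ [F [dF [F0 F1]]]]; exists (fun t => F (step t)); split.
- exact: diffeo_path_isotopy.
- by move=> p; rewrite step0// F0.
- by rewrite step1// F1.
Qed.

Lemma Diff0_null (f : V -> V) : Diff0 f -> exists F, null_path alpha0 F /\ path_from_to id f F.
Proof.
move=> /Diff0_isotopy[F [iF F0 <-]].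
have [N [iN nN [N0 N1] _]] := null_reach_Diff0 i0 iF F0.
exists N; split; first exact: null_isotopy_path.
by split; apply/funext => p; [exact: N0|exact: N1].
Qed.

(** The null path ends at f followed by the translation by -1, since rising at
speed 1 will add 1 to z. *)
Lemma Diff0_positive (f : V -> V) : Diff0 f ->
  exists F, positive_path alpha0 F /\ path_from_to id f F.
Proof.
move=> /Diff0_isotopy[F [iF F0 <-]].
have F'0 p : rise (-1) F 0 p = p by rewrite /rise mulr0 scale0r addr0.
have [N [iN nN [N0 N1] _]] := null_reach_Diff0 i0 (isotopy_rise (-1) iF) F'0.
exists (rise 1 N); split; first exact: positive_rise.
split; apply/funext => p; rewrite /rise.
  by rewrite N0// mulr0 scale0r addr0.
by rewrite N1// /rise !mulr1 scaleN1r scale1r subrK.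
Qed.

Lemma Diffc_null_reach (f : V -> V) : Diffc f -> exists2 K : set V, compact K & null_reach K f.
Proof.
move=> [_ _ [F [dF [K [cK FK]] [F0 F1]]]].
have [M [_ HM]] := compact_bounded cK.
pose r := 1 + `|M|.
have Kr p : K p -> `|p| <= r by move=> Kp; apply: (HM r) => //; rewrite ltr_pwDl// ler_norm.
exists (shell (0%:R - 1) (r + 1)); first exact: shell_compact.
have st t : step t \in `[0 : R, 1] by rewrite in_itv/= step_ge0 step_le1.
have r0 : 0 <= r by rewrite addr_ge0.
have N : (forall p, F (step 0) p = p) ->
    (forall t p, ~ shell 0%:R r p -> F (step t) p = p) ->
    null_reach (shell (0%:R - 1) (r + 1)) (F (step 1)).
  exact: (null_reach_shell i0 (j := 0%N) r0 (diffeo_path_isotopy dF)).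
apply: (null_reach_ext (f := F (step 1))) => [p|]; last apply: N => [p|t p np].
- by rewrite step1// F1.
- by rewrite step0// F0.
- by apply: FK => // Kp; apply: np; split; [exact: normr_ge0|exact: Kr].
Qed.

Variables (K : set V) (M : R -> V -> V) (f : V -> V).
Hypothesis cK : compact K.
Hypothesis iM : isotopy M.
Hypothesis nM : null M.
Hypothesis M0 : forall t p, t <= 0 -> M t p = p.
Hypothesis M1 : forall t p, 1 <= t -> M t p = f p.
Hypothesis MK : forall t p, ~ K p -> M t p = p.

(** First the null path M to f, then the helix, which descends by d^2; during the
whole time the path rises at speed d^2, which makes up for the descent. *)
Let G (d : R) : R -> V -> V :=
  rise (d ^+ 2) (fun t p => helix i0 d (step2of2 t) (M (step1of2 t) p)).

Let positive_G d : d != 0 -> positive_path alpha0 (G d).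
Proof.
move=> d0; apply: positive_rise; first by rewrite exprn_even_gt0.
  exact: (isotopy_concat (isotopy_helix i0 d) iM).
exact: (null_concat (isotopy_helix i0 d) iM (null_helix i0 d) nM (helix0 i0 d) (fun p => M1 p (lexx 1))).
Qed.

Let path_G d : path_from_to id f (G d).
Proof.
split; apply/funext => p; rewrite /G /rise /step2of2 /step1of2.
  rewrite !step0; [|lra|lra].
  by rewrite helix0 M0// mulr0 scale0r addr0.
rewrite !step1; [|lra|lra].
by rewrite helix1 M1// mulr1 subrK.
Qed.

(** Off K the path G is the affine family p + d B, with L the linear part of
B. *)
Let B (d t : R) (p : V) : V := loop_v (step2of2 t) *: Yf i0 p +
  (loop_u (step2of2 t) *: ex i0 + (d * (loop_z (step2of2 t) + t)) *: ez).

Let L (d t : R) (w : V) : V := - (loop_v (step2of2 t) * xcoord w i0) *: ez.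

Let G_off d t p : ~ K p -> G d t p = p + d *: B d t p.
Proof.
move=> Kp; rewrite /G /rise MK// /helix /B.
move: (loop_v _) (loop_u _) (loop_z _) => v u z.
rewrite -!addrA; congr (_ + _); rewrite !scalerDr !scalerA -scalerDl.
by congr (_ + (_ + _)); apply: (congr1 (fun c => c *: (ez : V))); ring.
Qed.

Let B_affine d t x w (h : R) : B d t (h *: w + x) = B d t x + h *: L d t w.
Proof.
rewrite /B /L; move: (loop_v _) (_ + _ *: ez) => v c.
have -> : Yf i0 (h *: w + x) = Yf i0 x - (h * xcoord w i0) *: ez.
  by rewrite /Yf xcoordD xcoordZ scalerDl opprD addrA addrAC.
rewrite scalerBr addrAC; congr (_ + _).
by rewrite !scalerA -scaleNr; apply: (congr1 (fun c => c *: (ez : V))); ring.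
Qed.

Let B_bound (r : R) : exists2 C : R, 0 < C & forall d t x, `|d| <= 1 -> [set` `[0, 1]] t ->
  `|x| <= r -> `|B d t x| <= C /\ `|L d t x| <= C.
Proof.
have [Cu Cu0 Hu] := continuous_bound01 smooth_loop_u.
have [Cv Cv0 Hv] := continuous_bound01 smooth_loop_v.
have [Cz Cz0 Hz] := continuous_bound01 smooth_loop_z.
pose A := `|ex i0 : V| + `|ey i0 : V| + `|ez : V|.
have xA : `|ex i0 : V| <= A by rewrite /A -addrA lerDl addr_ge0.
have yA : `|ey i0 : V| <= A by rewrite /A addrAC lerDr addr_ge0.
have zA : `|ez : V| <= A by rewrite /A lerDr addr_ge0.
have A0 : 0 <= A by rewrite !addr_ge0.
pose r' := `|r|.
have r0 : 0 <= r' by rewrite normr_ge0.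
exists (1 + Cv * (A + r' * A) + Cu * A + (Cz + 1) * A).
  have := mulr_ge0 (ltW Cv0) (addr_ge0 A0 (mulr_ge0 r0 A0)).
  have := mulr_ge0 (ltW Cu0) A0.
  have := mulr_ge0 (addr_ge0 (ltW Cz0) ler01) A0.
  by lra.
move=> d t x d1; rewrite /= in_itv/= => /andP[t0 t1] xr.
have s01 : 0 <= step2of2 t <= 1 by rewrite step_ge0 step_le1.
have {}Hu := Hu _ s01; have {}Hv := Hv _ s01; have {}Hz := Hz _ s01.
have xx : `|xcoord x i0| <= r'.
  by rewrite (le_trans (rV_norm_ge _ _))// (le_trans xr)// ler_norm.
have hY : `|loop_v (step2of2 t) *: Yf i0 x| <= Cv * (A + r' * A).
  rewrite normrZ ler_pM// (le_trans (ler_normB _ _))// lerD// normrZ ler_pM//.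
have hX : `|loop_u (step2of2 t) *: ex i0 : V| <= Cu * A by rewrite normrZ ler_pM.
have hZ : `|(d * (loop_z (step2of2 t) + t)) *: ez : V| <= (Cz + 1) * A.
  rewrite normrZ ler_pM// normrM -[leRHS]mul1r ler_pM//.
  by rewrite (le_trans (ler_normD _ _))// lerD// ger0_norm.
have p1 := mulr_ge0 (ltW Cv0) (addr_ge0 A0 (mulr_ge0 r0 A0)).
have p2 := mulr_ge0 (ltW Cu0) A0.
have p3 := mulr_ge0 (addr_ge0 (ltW Cz0) ler01) A0.
split.
  rewrite /B (le_trans (ler_normD _ _))//.
  have := ler_normD (loop_u (step2of2 t) *: ex i0 : V) ((d * (loop_z (step2of2 t) + t)) *: ez).
  by lra.
have : `|L d t x| <= Cv * (r' * A).
  rewrite /L normrZ normrN normrM -mulrA; apply: ler_pM => //.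
  exact: ler_pM.
have := mulr_ge0 (ltW Cv0) A0.
by rewrite mulrDr in p1 *; lra.
Qed.

Lemma positive_near_inclusion (N : set (~` K -> V)) : Cinfty_nbhs set_val N ->
  exists G, [/\ positive_path alpha0 G, path_from_to id f G
     & forall t, t \in `[0, 1] -> N (sigL (~` K) (G t))].
Proof.
move=> HN.
have oK : open (~` K).
  by apply: closed_openC; apply: compact_closed => //; exact: norm_hausdorff.
have sG d t : smooth (G d t).
  apply: diffeo_smooth; apply: (isotopy_rise (d ^+ 2) _).2.
  exact: (isotopy_concat (isotopy_helix i0 d) iM).
have near_N := Cinfty_nbhs_affine (T := [set` `[0, 1]]) oK sG
  (fun d t x (_ : [set` `[0, 1]] t) Kx => G_off d t Kx) B_affine B_bound HN.
have [d [d0 Hd]] : exists d : R, d != 0 /\ forall t, [set` `[0, 1]] t -> N (sigL (~` K) (G d t)).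
  apply: (@filter_ex _ ((0 : R)^')); near=> d; split.
    by near: d; exact: nbhs_dnbhs_neq.
  by near: d; rewrite near_withinE; apply: filterS near_N => d H _.
by exists (G d); split=> //; exact: positive_G.
Unshelve. all: by end_near. Qed.

End Main.

Theorem theorem1p1 (R : realType) (n : nat) (hn : (1 <= n)%N) :
  (forall f : 'rV[R]_(n + n + 1) -> 'rV[R]_(n + n + 1), Diff0 f ->
    (exists F, null_path alpha0 F /\ path_from_to id f F) /\
    (exists F, positive_path alpha0 F /\ path_from_to id f F)) /\
  (forall f : 'rV[R]_(n + n + 1) -> 'rV[R]_(n + n + 1), Diffc f ->
    (exists F, [/\ null_path alpha0 F, compactly_supported_path F
                 & path_from_to id f F]) /\
    (exists K : set 'rV[R]_(n + n + 1), compact K /\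
      forall N : set (~` K -> 'rV[R]_(n + n + 1)),
        Cinfty_nbhs set_val N ->
        exists G, [/\ positive_path alpha0 G, path_from_to id f G
                    & forall t, t \in `[0, 1] -> N (sigL (~` K) (G t))])).
Proof.
pose i0 : 'I_n := Ordinal hn.
split=> f Df.
  by split; [exact: (Diff0_null i0)|exact: (Diff0_positive i0)].
have [K cK [M [iM nM [M0 M1] MK]]] := Diffc_null_reach i0 Df.
split.
  exists M; split; first exact: null_isotopy_path.
    by exists K; split=> // t p _; exact: MK.
  by split; apply/funext => p; [exact: M0|exact: M1].
exists K; split=> // N HN.
exact: (positive_near_inclusion i0 cK iM nM M0 M1 MK HN).
Qed.
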